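(* For $0<\delta\le2$, $\lambda\in\mathbb{R}$ and $0<\nu\le1$ consider the operator $$M_\delta(\lambda,\nu):=\langle r\rangle^{-\delta}(H_0-\lambda-i\nu)^{-1}\langle r\rangle^{-\delta}$$ on $L^2(\mathbb{R}^2)$. Then for $0<\theta\le\tfrac12$ and $|\lambda|\ge1$ there exists a constant $C=C(\theta)>0$, independent of $\lambda$ and $\nu$, such that $$\|M_\delta(\lambda,\nu)\|_{L^2\to L^2}\le C\,\nu^{-1}\Big(|\lambda|^{-\theta}+(1+\nu)|\lambda|^{-1}+(1+\nu^{-2})|\lambda|^{\theta-1}\Big)^{\delta/2}.$$
   Context: $D_x=-i\partial_x$, $D_y=-i\partial_y$, $r=(x^2+y^2)^{1/2}$, $\langle r\rangle=(1+r^2)^{1/2}$. $H_0=(D_x+y)^2+D_y^2+x$ is the self-adjoint operator on $L^2(\mathbb{R}^2)$ obtained as the closure from $C_0^\infty(\mathbb{R}^2)$. *)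

(* Defs.v *)
From HB Require Import structures.
From mathcomp Require Import all_boot all_order all_algebra.
From mathcomp Require Import all_classical all_reals all_analysis.
From mathcomp Require Export complex.
Import Order.TTheory GRing.Theory Num.Theory.
Import numFieldNormedType.Exports.
Import ComplexField.Normc.

Set Implicit Arguments.
Unset Strict Implicit.
Unset Printing Implicit Defensive.

Local Open Scope classical_set_scope.
Local Open Scope ring_scope.
Local Open Scope complex_scope.

Section L2_plane.
Context {R : realType}.

Definition leb2 :
    {measure set (measurableTypeR R * measurableTypeR R) -> \bar R} :=
  (@lebesgue_measure R \x @lebesgue_measure R)%E.

Definition cfun := R * R -> R[i].

Definition L2 (f : cfun) : Prop :=
  (fun p => complex.Re (f p)) \in Lfun leb2 2%:E /\
  (fun p => complex.Im (f p)) \in Lfun leb2 2%:E.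

Definition L2norm (f : cfun) : \bar R :=
  Lnorm leb2 2%:E (fun p => (normc (f p))%:E).

Definition ae_equal (f g : cfun) : Prop := {ae leb2, forall p, f p = g p}.

(* An operator on L^2 (possibly unbounded, with its own domain) is given by its
   graph: [A f g] reads "f is in the domain of A and A f = g".  Elements of L^2
   are represented by functions, two of which are identified when equal a.e. *)
Definition op := cfun -> cfun -> Prop.

Definition op_norm (A : op) : \bar R :=
  ereal_sup [set t | exists f g,
    [/\ L2 f, L2 g, A f g, (L2norm f <= 1)%E & t = L2norm g]].

Definition bounded_on_L2 (A : op) : Prop :=
  [/\ forall f, L2 f -> exists2 g, L2 g & A f g,
      forall f g h, A f g -> A f h -> ae_equal g h
    & (op_norm A < +oo)%E].

(* The closure of the graph of [A] in L^2 x L^2. *)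
Definition op_closure (A : op) : op := fun u w =>
  [/\ L2 u, L2 w & exists (f g : nat -> cfun),
    [/\ forall n, A (f n) (g n),
        L2norm (fun p => f n p - u p) @[n --> \oo] --> 0%E
      & L2norm (fun p => g n p - w p) @[n --> \oo] --> 0%E]].

(* [op_comp A B] is "A after B". *)
Definition op_comp (A B : op) : op := fun f h =>
  exists2 g, B f g & A g h.

Definition op_sub_scalar (A : op) (z : R[i]) : op := fun u w =>
  L2 w /\ exists2 v, A u v & ae_equal w (fun p => v p - z * u p).

Definition op_inv (A : op) : op := fun f u => A u f.

(* Multiplication by [m], on its maximal domain in L^2. *)
Definition mul_op (m : R * R -> R) : op := fun f g =>
  [/\ L2 f, L2 g & ae_equal g (fun p => (m p)%:C * f p)].

Definition resolvent (A : op) (z : R[i]) : op := op_inv (op_sub_scalar A z).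

(* A - z maps the domain of A bijectively onto L^2, with bounded inverse. *)
Definition resolvent_set (A : op) : set R[i] :=
  [set z | bounded_on_L2 (resolvent A z)].

End L2_plane.

Section Hamiltonian.
Context {R : realType}.

(* Coordinate directions: [false] is x, [true] is y. *)
Definition dir (b : bool) : R * R := if b then (0, 1) else (1, 0).

Definition partial (b : bool) (f : R * R -> R) : R * R -> R :=
  fun p => 'D_(dir b) f p.

(* C^oo: all iterated partial derivatives exist and are continuous. *)
Definition smooth (f : R * R -> R) : Prop := forall s : seq bool,
  continuous (foldr partial f s) /\
  forall b p, derivable (foldr partial f s) p (dir b).

Definition test_function (f : R * R -> R[i]) : Prop :=
  [/\ smooth (fun p => complex.Re (f p)), smooth (fun p => complex.Im (f p))
    & compact (closure [set p | f p != 0])].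

(* D false is D_x = -i d/dx and D true is D_y = -i d/dy; the derivative of a
   complex-valued function is taken on its real and imaginary parts. *)
Definition D (b : bool) (f : R * R -> R[i]) : R * R -> R[i] := fun p =>
  - (0 +i* 1) * (partial b (fun q => complex.Re (f q)) p
                +i* partial b (fun q => complex.Im (f q)) p).

Definition Dx_plus_y (f : R * R -> R[i]) : R * R -> R[i] := fun p =>
  D false f p + p.2%:C * f p.

Definition H0_expr (f : R * R -> R[i]) : R * R -> R[i] := fun p =>
  Dx_plus_y (Dx_plus_y f) p + D true (D true f) p + p.1%:C * f p.

Definition H0_min : op := fun f g => test_function f /\ g = H0_expr f.

Definition H0 : @op R := op_closure H0_min.

Definition jap (p : R * R) : R := Num.sqrt (1 + (p.1 ^+ 2 + p.2 ^+ 2)).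

Definition weight (delta : R) (p : R * R) : R := jap p `^ (- delta).

Definition M (delta lambda nu : R) : op :=
  op_comp (mul_op (weight delta))
    (op_comp (resolvent H0 (lambda +i* nu)) (mul_op (weight delta))).

End Hamiltonian.

(* Main.v *)
(** Write [mu = |lambda|], [w = <r>^-1], [z = lambda + i nu].  Integrating the
    commutator of [H0] with the bounded vector field
    [beta = (atan x, atan y) / (1 + x^2 / mu^2)] over the plane gives, for
    [(H0 - z) u = w h + k],
      [mu |w u|^2 <= C (sqrt mu |u|^2 + sqrt mu |k|^2 + |h|^2)],
    and the symmetry of [H0] gives [nu |u|^2 = - Im <(H0 - z) u, u>].  For
    [delta >= 1] one takes [k = 0] and [h = <r>^(1 - delta) f]; for [delta < 1]
    one takes [h = 0] and interpolates [<r>^(-2 delta)] between [w^2] and [1].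
    Both cases yield [C nu^-1 mu^(- delta / 4)], which the first of the three
    terms of the claimed bound dominates because [theta <= 1 / 2].

    That [z] is in the resolvent set reduces, by the completeness of [L^2] and
    coercivity, to: a [v] orthogonal to the range of [H0 - z] on test functions
    vanishes.  The equation [d psi / dt = - i (H0 - z) psi] has explicit Gaussian
    solutions; along them [<v, psi>] is constant, and it tends to [0] since
    [|psi|] decays like [exp (- nu t)].  Hence [v] is orthogonal to the initial
    values, which include Gaussians of arbitrarily small width around every
    point with a phase vanishing at that point: an approximate identity. *)
Require Import Defs.
From HB Require Import structures.
From mathcomp Require Import all_boot all_order all_algebra.
From mathcomp Require Import all_classical all_reals all_analysis.
From mathcomp Require Import measurable_realfun ring lra.
Import Order.TTheory GRing.Theory Num.Theory.
Import numFieldNormedType.Exports.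

Set Implicit Arguments.
Unset Strict Implicit.
Unset Printing Implicit Defensive.

Local Open Scope classical_set_scope.
Local Open Scope ring_scope.
Local Open Scope complex_scope.

(** The obstacle is the potential [x], unbounded in both directions: the energy identity controls
    the kinetic energy of [u] by [mu] only where [|x|] is of order [mu]. Hence the factor
    [1 / (1 + x^2 / mu^2)]: times [|x|] it stays below [mu], its logarithmic gradient is at most
    [1 / mu], and what it removes from [mu w^2] is at most [1]. The arctangents are bounded, while
    their derivatives [1 / (1 + x^2)] and [1 / (1 + y^2)] dominate [w^2]. The magnetic field and the
    weights leave errors [|u| |grad u|]; Young's inequality splits them into [sqrt mu |u|^2] and
    [|grad u|^2 / sqrt mu], and the energy identity on the cutoff region bounds the second by the
    first. This is the origin of [sqrt mu]. One more energy identity, with the cut-off weight [w^2]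
    and multiplied by the sign of [lambda], converts kinetic energy into [mu |w u|^2] for both
    signs. All pairings are real parts of inner products. Complex information comes back through a
    free constant phase in the packets. *)

Ltac ge0 := repeat first
  [ exact: sqr_ge0 | exact: normr_ge0 | exact: ler0n | exact: ler01 | exact: ltr01 | assumption
  | (apply: ltW; assumption) | apply: mulr_ge0 | apply: addr_ge0 | apply: exprn_ge0
  | rewrite invr_ge0 | lra ].

(** * Real sequences, integrals and square-integrable functions *)

Section RealSequences.
Context (R : realType).
Implicit Types (u v : nat -> R) (a b : R).

Lemma ncvgD u v a b : u n @[n --> \oo] --> a -> v n @[n --> \oo] --> b ->
  u n + v n @[n --> \oo] --> a + b.
Proof. by move=> ua vb; apply: cvgD. Qed.

Lemma ncvgM u v a b : u n @[n --> \oo] --> a -> v n @[n --> \oo] --> b ->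
  u n * v n @[n --> \oo] --> a * b.
Proof. by move=> ua vb; apply: cvgM. Qed.

Lemma ncvgZ c u a : u n @[n --> \oo] --> a -> c * u n @[n --> \oo] --> c * a.
Proof. by move=> ua; apply: ncvgM => //; exact: cvg_cst. Qed.

Lemma ncvg_ext u v a b : (forall n, u n = v n) -> a = b ->
  u n @[n --> \oo] --> a -> v n @[n --> \oo] --> b.
Proof. by move=> uv <-; have -> : v = u by apply/funext => n; rewrite uv. Qed.

Lemma ncvg_le u v a b : (forall n, u n <= v n) ->
  u n @[n --> \oo] --> a -> v n @[n --> \oo] --> b -> a <= b.
Proof.
move=> uv ua vb; rewrite -subr_ge0.
apply: (cvgr_to_ge (cvgB vb ua)).
by apply: nearW => n; rewrite subr_ge0.
Qed.

Lemma ncvg_squeeze0 u v : (forall n, 0 <= u n <= v n) ->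
  v n @[n --> \oo] --> 0 -> u n @[n --> \oo] --> 0.
Proof.
move=> uv v0; apply: (@squeeze_cvgr _ _ _ _ (fun=> 0) v) => //.
- exact: nearW.
- exact: cvg_cst.
Qed.

Lemma ncvg_sqr0 u : u n ^+ 2 @[n --> \oo] --> 0 -> u n @[n --> \oo] --> 0.
Proof.
move=> h; apply/cvgr0Pnorm_lt => e e0.
have [|N _ HN] := (cvgr0Pnorm_lt _).1 h (e ^+ 2); first by rewrite exprn_gt0.
exists N => // n /HN /=; rewrite normrX.
by rewrite ltr_pXn2r// nnegrE// ltW.
Qed.

End RealSequences.

Section RealIntegral.
Context d (T : measurableType d) (R : realType) (mu : {measure set T -> \bar R}).
Implicit Types f g h : T -> R.

Definition itg f := mu.-integrable setT (EFin \o f).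
Definition sqitg f := measurable_fun setT f /\ itg (fun x => f x ^+ 2).

Local Notation I := (Rintegral mu setT).

Lemma itg_measurable f : itg f -> measurable_fun setT f.
Proof. by move=> /integrableP[/measurable_EFinP]. Qed.

Lemma itgD f g : itg f -> itg g -> itg (fun x => f x + g x).
Proof. by move=> fi gi; apply: eq_integrable (integrableD measurableT fi gi). Qed.

Lemma itgZ c f : itg f -> itg (fun x => c * f x).
Proof. by move=> fi; apply: eq_integrable (integrableZl measurableT c fi). Qed.

Lemma itgN f : itg f -> itg (fun x => - f x).
Proof. by move=> fi; apply: eq_integrable (integrableN fi). Qed.

Lemma itgB f g : itg f -> itg g -> itg (fun x => f x - g x).
Proof. by move=> fi gi; apply: itgD => //; exact: itgN. Qed.

Lemma itg0 : itg (fun=> 0).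
Proof. by apply: eq_integrable (integrable0 _ _). Qed.

Lemma itg_le f g : measurable_fun setT f -> itg g ->
  (forall x, `|f x| <= g x) -> itg f.
Proof.
move=> mf gi fg; apply: le_integrable gi => //; first exact/measurable_EFinP.
move=> x _ /=; rewrite lee_fin; exact: le_trans (fg x) (ler_norm _).
Qed.

Lemma itg_norm f : itg f -> itg (fun x => `|f x|).
Proof.
move=> fi; have mf := itg_measurable fi.
apply: eq_integrable (integrable_abse fi) => //.
Qed.

Lemma ID f g : itg f -> itg g -> I (fun x => f x + g x) = I f + I g.
Proof. exact: RintegralD. Qed.

Lemma IB f g : itg f -> itg g -> I (fun x => f x - g x) = I f - I g.
Proof. exact: RintegralB. Qed.

Lemma IZ c f : itg f -> I (fun x => c * f x) = c * I f.
Proof. by move=> fi; rewrite RintegralZl. Qed.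

Lemma IN f : itg f -> I (fun x => - f x) = - I f.
Proof.
move=> fi; rewrite -mulN1r -IZ//; apply: eq_Rintegral => x _; by rewrite mulN1r.
Qed.

Lemma I_le f g : itg f -> itg g -> (forall x, f x <= g x) -> I f <= I g.
Proof. by move=> fi gi fg; apply: le_Rintegral. Qed.

Lemma I_ge0 f : (forall x, 0 <= f x) -> 0 <= I f.
Proof. by move=> f0; apply: Rintegral_ge0. Qed.

Lemma I_norm f : itg f -> `|I f| <= I (fun x => `|f x|).
Proof. exact: le_normr_Rintegral. Qed.

Lemma I_ext f g : (forall x, f x = g x) -> I f = I g.
Proof. by move=> fg; apply: eq_Rintegral => x _. Qed.

Lemma itg_EFin f : itg f -> (\int[mu]_x (f x)%:E = (I f)%:E)%E.
Proof. by move=> fi; rewrite /Rintegral fineK//; exact: integrable_fin_num. Qed.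

Lemma itg_ae f g : measurable_fun setT g -> (\forall x \ae mu, f x = g x) ->
  itg f -> itg g /\ I g = I f.
Proof.
move=> mg fg fi; have mf := itg_measurable fi.
have E : (\int[mu]_x `|(g x)%:E| = \int[mu]_x `|(f x)%:E|)%E.
  apply: ae_eq_integral => //.
  - by apply/measurable_EFinP/measurableT_comp.
  - by apply/measurable_EFinP/measurableT_comp.
  - by apply: filterS fg => x /= ->.
split.
  apply/integrableP; split; first exact/measurable_EFinP.
  by rewrite /= E; case/integrableP: fi.
congr fine; apply: ae_eq_integral => //; try exact/measurable_EFinP.
by apply: filterS fg => x /= ->.
Qed.

Lemma ge0_itg f : measurable_fun setT f -> (forall x, 0 <= f x) ->
  (\int[mu]_x (f x)%:E < +oo)%E -> itg f.
Proof.
move=> mf f0 fi; apply/integrableP; split; first exact/measurable_EFinP.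
rewrite (eq_integral (fun x => (f x)%:E))// => x _ /=.
by rewrite ger0_norm.
Qed.

Lemma I_dct (f_ : nat -> T -> R) f g : (forall n, measurable_fun setT (f_ n)) ->
  itg g -> (forall n x, `|f_ n x| <= g x) ->
  (forall x, f_ n x @[n --> \oo] --> f x) ->
  itg f /\ I (f_ n) @[n --> \oo] --> I f.
Proof.
move=> mf gi fg ff.
have mfl : measurable_fun setT f.
  by apply: (@measurable_fun_cvg _ _ _ _ f_) => // x _; exact: ff.
have fi n : itg (f_ n) by exact: itg_le (fg n).
have [|||||fli _ L] := @dominated_convergence _ T R mu setT measurableT
  (fun n => EFin \o f_ n) (EFin \o f) (EFin \o g).
- by move=> n; exact/measurable_EFinP.
- exact/measurable_EFinP.
- by apply: aeW => x _; apply: cvg_EFin; [exact: nearW | exact: ff].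
- exact: gi.
- by apply: aeW => x n _ /=; rewrite lee_fin.
split => //.
by rewrite /Rintegral; apply: fine_cvg => /=; rewrite fineK//; exact: integrable_fin_num.
Qed.

Lemma I_eq0 f : itg f -> (forall x, 0 <= f x) -> I f = 0 ->
  \forall x \ae mu, f x = 0.
Proof.
move=> fi f0 If; have mf := itg_measurable fi.
have : (\int[mu]_x `|(EFin \o f) x| = 0)%E.
  rewrite (eq_integral (fun x => (f x)%:E)); last first.
    by move=> x _ /=; rewrite ger0_norm.
  by rewrite itg_EFin// If.
move/(ae_eq_integral_abs mu measurableT) => H.
have := H ((measurable_EFinP _ _).2 mf).
by apply: filterS => x /(_ Logic.I) [].
Qed.

Lemma sqitg_mul f g : sqitg f -> sqitg g -> itg (fun x => f x * g x).
Proof.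
move=> [mf fi] [mg gi]; apply: (@itg_le _ (fun x => f x ^+ 2 + g x ^+ 2)).
- exact: measurable_funM.
- exact: itgD.
move=> x; rewrite normrM -(real_normK (num_real (f x))) -(real_normK (num_real (g x))).
move: (normr_ge0 (f x)) (normr_ge0 (g x)); nra.
Qed.

Lemma sqitgD f g : sqitg f -> sqitg g -> sqitg (fun x => f x + g x).
Proof.
move=> hf hg; have fg := sqitg_mul hf hg; case: hf hg => mf fi [mg gi].
split; first exact: measurable_funD.
have H := itgD (itgD fi gi) (itgZ 2 fg).
by congr (itg _): H; apply/funext => x; ring.
Qed.

Lemma sqitgZ c f : sqitg f -> sqitg (fun x => c * f x).
Proof.
move=> [mf fi]; split; first exact: measurable_funM.
have H := itgZ (c ^+ 2) fi.
by congr (itg _): H; apply/funext => x; ring.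
Qed.

Lemma sqitgN f : sqitg f -> sqitg (fun x => - f x).
Proof.
move=> /(sqitgZ (-1)); congr sqitg; apply/funext => x; ring.
Qed.

Lemma sqitgB f g : sqitg f -> sqitg g -> sqitg (fun x => f x - g x).
Proof. by move=> hf hg; apply: sqitgD => //; exact: sqitgN. Qed.

Lemma sqitg_le f g : measurable_fun setT f -> sqitg g ->
  (forall x, `|f x| <= `|g x|) -> sqitg f.
Proof.
move=> mf [mg gi] fg; split => //; apply: itg_le gi _; first exact: measurable_funX.
move=> x; rewrite normrX -(real_normK (num_real (g x))).
by rewrite lerXn2r// nnegrE.
Qed.

Lemma Lfun2P f : f \in Lfun mu 2%:E <-> sqitg f.
Proof.
split.
  move=> h; split; last exact: Lfun2_integrable_sqr.
  by move: h; rewrite inE => /andP[/[!inE]].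
move=> [mf fi]; rewrite inE; apply/andP; split; first by rewrite inE.
rewrite inE /= /finite_norm unlock poweR_lty//.
rewrite (eq_integral (fun x => (f x ^+ 2)%:E)); last first.
  move=> x _; rewrite /= -[2%:R]/(2%:R) powR_mulrn// real_normK ?num_real//.
by rewrite itg_EFin// ltry.
Qed.

End RealIntegral.

(** * Completeness of real L^2 *)

Section RieszFischer.
Context d (T : measurableType d) (R : realType) (mu : {measure set T -> \bar R}).
Local Notation I := (Rintegral mu setT).

(** Cauchy-Schwarz for a telescoping sum with geometric weights: the weights [2^-k] from [n] on sum
    to at most [2 * 2^-n], and the squared increments are charged with [2^k]. The induction peels
    off the first increment, so [n] varies. *)
Lemma telescope_sqr (a : nat -> R) n m :
  (a (n + m)%N - a n) ^+ 2 <=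
  2 * 2^-1 ^+ n * \sum_(n <= k < n + m) 2 ^+ k * (a k.+1 - a k) ^+ 2.
Proof.
elim: m n => [|m IH] n.
  by rewrite addn0 subrr expr0n /= big_geq// mulr0.
have {IH} := IH n.+1; rewrite addSnnS => IH.
rewrite big_ltn; last by rewrite addnS ltnS leq_addr.
rewrite addnS in IH *.
set S := \sum_(_ <= _ < _) _ in IH *.
have -> : 2 * 2^-1 ^+ n * (2 ^+ n * (a n.+1 - a n) ^+ 2 + S) =
  2 * (a n.+1 - a n) ^+ 2 + 2 * (2^-1 ^+ n * S).
  by rewrite exprVn; field; rewrite expf_neq0.
have {}IH : (a (n + m).+1 - a n.+1) ^+ 2 <= 2^-1 ^+ n * S.
  by apply: (le_trans IH); rewrite exprS; lra.
have := sqr_ge0 (a (n + m).+1 - a n.+1 - (a n.+1 - a n)).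
move: IH; set A := a (n + m).+1; set B := a n.+1; set C := a n; set Z := _ * S.
move=> IH.
have -> : (A - C) ^+ 2 = 2 * (A - B) ^+ 2 + 2 * (B - C) ^+ 2 - (A - B - (B - C)) ^+ 2.
  by ring.
lra.
Qed.

(** Since [4^-k] beats [2^k], the weighted squared increments have summable integrals, so their sum
    [H] is finite almost everywhere. Where it is finite, [telescope_sqr] makes the sequence Cauchy,
    with squared distance to the limit at most [2 * 2^-n * H], which is integrable. *)
Lemma riesz_fischer (f : nat -> T -> R) (K : R) :
  (forall n, sqitg mu (f n)) ->
  (forall n, I (fun x => (f n.+1 x - f n x) ^+ 2) <= K * 4^-1 ^+ n) ->
  exists2 g, sqitg mu g & I (fun x => (f n x - g x) ^+ 2) @[n --> \oo] --> 0.
Proof.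
move=> sf fK.
pose D k x := 2 ^+ k * (f k.+1 x - f k x) ^+ 2.
have D0 k x : 0 <= D k x by rewrite /D; ge0.
have itgD k : itg mu (D k).
  by apply: itgZ; have [] := sqitgB (sf k.+1) (sf k).
have mD k : measurable_fun setT (D k) by exact: itg_measurable (itgD k).
pose h x := (\sum_(k <oo) (D k x)%:E)%E.
have mh : measurable_fun setT h.
  apply: ge0_emeasurable_sum => [k x _ _|k _]; first by rewrite lee_fin; exact: D0.
  exact/measurable_EFinP.
have h0 x : (0 <= h x)%E by apply: nneseries_ge0 => k _ _; rewrite lee_fin.
have K0 : 0 <= K.
  by have := fK 0%N; rewrite expr0 mulr1; apply: le_trans; apply: I_ge0 => x; exact: sqr_ge0.
have ID k : I (D k) <= K * 2^-1 ^+ k.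
  rewrite /D IZ; last by have [] := sqitgB (sf k.+1) (sf k).
  apply: (@le_trans _ _ (2 ^+ k * (K * 4^-1 ^+ k))).
    by apply: ler_wpM2l; [ge0|exact: fK].
  rewrite mulrCA; apply: ler_wpM2l => //.
  by rewrite -exprMn; have -> : (2 * 4^-1 : R) = 2^-1 by field.
have ih : (\int[mu]_x h x <= (2 * K)%:E)%E.
  rewrite /h integral_nneseries//; last 2 first.
    by move=> k; apply/measurable_EFinP.
    by move=> k x _; rewrite lee_fin.
  apply: lime_le.
    by apply: is_cvg_nneseries => k _ _; apply: integral_ge0 => x _; rewrite lee_fin.
  apply: nearW => n.
  rewrite (eq_bigr (fun k => (I (D k))%:E)); last by move=> k _; rewrite itg_EFin.
  rewrite sumEFin lee_fin.
  apply: (@le_trans _ _ (\sum_(0 <= k < n) K * 2^-1 ^+ k)); first exact: ler_sum.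
  rewrite -mulr_sumr mulrC ler_wpM2r//.
  have -> : \sum_(0 <= k < n) (2^-1 : R) ^+ k = 2 - 2 * 2^-1 ^+ n.
    elim: n => [|n IHn]; first by rewrite big_geq// expr0; ring.
    by rewrite big_nat_recr//= IHn exprS; field.
  by rewrite gerBl; ge0.
have hI : mu.-integrable setT h.
  apply/integrableP; split => //.
  rewrite (eq_integral h); last by move=> x _; rewrite gee0_abs.
  by rewrite (le_lt_trans ih)// ltry.
pose H x := fine (h x).
have itgH : itg mu H.
  have fae := integrable_ae measurableT hI.
  apply: ge0_itg => [|x|].
  - exact: measurableT_comp.
  - exact: fine_ge0.
  - rewrite (ae_eq_integral h)//; last 2 first.
    + by apply/measurable_EFinP; exact: measurableT_comp.
    + by apply: filterS fae => x /(_ Logic.I) hx _; rewrite /= fineK.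
    by rewrite (le_lt_trans ih)// ltry.
pose A := [set x | h x \is a fin_num].
have mA : measurable A.
  have := emeasurable_fin_num measurableT mh.
  by rewrite setTI.
have hub x n : A x -> \sum_(0 <= k < n) D k x <= H x.
  move=> Ax; rewrite -lee_fin /H fineK// -sumEFin.
  by apply: nneseries_lim_ge => k _ _; rewrite lee_fin.
have sub x n m : A x -> (f (n + m)%N x - f n x) ^+ 2 <= 2 * 2^-1 ^+ n * H x.
  move=> Ax; apply: (le_trans (telescope_sqr (fun k => f k x) n m)).
  apply: ler_wpM2l; first by ge0.
  apply: (le_trans _ (hub x (n + m)%N Ax)).
  rewrite [leRHS](big_cat_nat _ (n := n))//= ?leq_addr//.
  by rewrite lerDr sumr_ge0// => k _; exact: D0.
have H0 x : 0 <= H x by exact: fine_ge0.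
have half0 (c : R) : c * 2^-1 ^+ n @[n --> \oo] --> (0 : R).
  rewrite -[X in _ --> X](mulr0 c); apply: cvgMr.
  by apply: cvg_expr; rewrite ger0_norm// invf_lt1// ltr1n.
have cf x : A x -> cvgn (fun n => f n x).
  move=> Ax; apply/cauchy_cvgP.
  apply/cauchyP => e e0.
  have /cvgrPdist_lt/(_ (e ^+ 2)) [|N _ HN] := half0 (2 * H x); first by rewrite exprn_gt0.
  exists (f N x) => //=; exists N => //= n Nn.
  have /= := HN N (leqnn _); rewrite sub0r normrN => HN'.
  have := sub x N (n - N)%N Ax; rewrite subnKC// => h1.
  suff : `|f N x - f n x| ^+ 2 < e ^+ 2.
    by rewrite ltr_pXn2r// ?nnegrE// ltW.
  rewrite real_normK ?num_real//.
  rewrite -sqrrN opprB; apply: (le_lt_trans h1).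
  rewrite mulrAC; exact: (le_lt_trans (ler_norm _) HN').
(* Setting the sequence to zero where [H] is infinite makes it converge at every point, so the limit
   is measurable. *)
pose F n x := f n x * \1_A x.
pose g x := limn (fun n => F n x).
have cF x : F n x @[n --> \oo] --> g x.
  suff : cvgn (fun n => F n x) by [].
  rewrite /F indicE; case: (asboolP (A x)) => Ax.
    rewrite mem_set//; under eq_fun do rewrite mulr1; exact: cf.
  by rewrite memNset//; under eq_fun do rewrite mulr0; exact: is_cvg_cst.
have mF n : measurable_fun setT (F n).
  by apply: measurable_funM; [case: (sf n)|exact: measurable_indic].
have mg : measurable_fun setT g.
  by apply: (@measurable_fun_cvg _ _ _ _ F) => // x _; exact: cF.
have fin_ae : \forall x \ae mu, A x.
  by apply: filterS (integrable_ae measurableT hI) => x /(_ Logic.I).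
have key x n : A x -> (f n x - g x) ^+ 2 <= 2 * 2^-1 ^+ n * H x.
  move=> Ax.
  have c1 : (F (n + m)%N x - f n x) ^+ 2 @[m --> \oo] --> (g x - f n x) ^+ 2.
    have c2 : F (n + m)%N x @[m --> \oo] --> g x.
      have := cF x; rewrite -(cvg_shiftn n).
      by under eq_fun do rewrite addnC.
    have c3 : F (n + m)%N x - f n x @[m --> \oo] --> g x - f n x.
      by apply: cvgB => //; exact: cvg_cst.
    rewrite expr2; under eq_fun do rewrite expr2.
    exact: cvgM.
  rewrite -sqrrN opprB.
  apply: (@cvgr_to_le _ _ _ _ _ _ _ c1).
  apply: nearW => m; rewrite /F indicE mem_set// mulr1; exact: sub.
have bnd n : itg mu (fun x => (f n x - g x) ^+ 2) /\
  I (fun x => (f n x - g x) ^+ 2) <= 2 * 2^-1 ^+ n * I H.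
  pose q x := (f n x - g x) ^+ 2 * \1_A x.
  have mq : measurable_fun setT (fun x => (f n x - g x) ^+ 2).
    by apply: measurable_funX; apply: measurable_funB => //; case: (sf n).
  have qi : itg mu q.
    apply: (@itg_le _ _ _ _ _ (fun x => 2 * 2^-1 ^+ n * H x)).
    - exact: measurable_funM.
    - exact: itgZ.
    move=> x; rewrite /q normrM (ger0_norm (sqr_ge0 _)) indicE ger0_norm//.
    case: (asboolP (A x)) => Ax; first by rewrite mem_set// mulr1; exact: key.
    by rewrite memNset// mulr0; have := H0 x; ge0.
  have [] := @itg_ae _ _ _ mu q (fun x => (f n x - g x) ^+ 2) mq _ qi.
    by apply: filterS fin_ae => x Ax; rewrite /q indicE mem_set// mulr1.
  move=> gi ->; split => //.
  rewrite -IZ//; apply: I_le => //; first exact: itgZ.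
  move=> x; rewrite /q indicE.
  case: (asboolP (A x)) => Ax; first by rewrite mem_set// mulr1; exact: key.
  by rewrite memNset// mulr0; have := H0 x; ge0.
exists g.
  have s : sqitg mu (fun x => f 0%N x - g x).
    by split; [apply: measurable_funB => //; case: (sf 0%N)|case: (bnd 0%N)].
  have := sqitgB (sf 0%N) s.
  by congr sqitg; apply/funext => x; ring.
apply: (@squeeze_cvgr _ _ _ _ (fun=> 0) (fun n => 2 * I H * 2^-1 ^+ n)).
- apply: nearW => n; rewrite I_ge0/= => [|x]; last exact: sqr_ge0.
  by rewrite mulrAC; case: (bnd n).
- exact: cvg_cst.
- exact: half0.
Qed.

End RieszFischer.

Lemma quadratic_discr (R : realFieldType) (a b c : R) : 0 <= c ->
  (forall t, 0 <= a + 2 * t * b + t ^+ 2 * c) -> b ^+ 2 <= a * c.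
Proof.
move=> c0 H; have [c1|c1] := ltP 0 c; last first.
  have c2 : c = 0 by apply/eqP; rewrite eq_le c1 c0.
  subst c; move=> {c0 c1}.
  rewrite mulr0; have [->|b0] := eqVneq b 0; first by rewrite expr0n /= lexx.
  (* For [c = 0] the form is affine in [t], and at this [t] its value is [-1]. *)
  have := H (- (a + 1) / (2 * b)) => h; exfalso; move: h; apply/negP.
  have -> : a + 2 * (- (a + 1) / (2 * b)) * b = - 1 by field.
  by rewrite mulr0 addr0 -ltNge; lra.
have := H (- b / c).
have -> : a + 2 * (- b / c) * b + (- b / c) ^+ 2 * c = (a * c - b ^+ 2) / c.
  by field; rewrite gt_eqF.
by rewrite pmulr_lge0 ?invr_gt0// subr_ge0.
Qed.

(** * Complex L^2 as a real Hilbert space *)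

Section ComplexL2.
Context d (T : measurableType d) (R : realType) (mu : {measure set T -> \bar R}).
Implicit Types f g h : T -> R[i].
Local Notation I := (Rintegral mu setT).
Local Notation Re := complex.Re.
Local Notation Im := complex.Im.

Definition cL2_on f := sqitg mu (fun x => Re (f x)) /\ sqitg mu (fun x => Im (f x)).
Local Notation cL2 := cL2_on.

(** The real part of the inner product, so that Hilbert space arguments take place over the reals;
    imaginary parts are reached by multiplying one entry by [-i]. *)
Definition cip_on f g := I (fun x => Re (f x) * Re (g x) + Im (f x) * Im (g x)).
Local Notation cip := cip_on.

Definition csq_on f := cip f f.
Local Notation csq := csq_on.

Lemma ReD (z w : R[i]) : Re (z + w) = Re z + Re w. Proof. by case: z w => [? ?] [? ?]. Qed.
Lemma ImD (z w : R[i]) : Im (z + w) = Im z + Im w. Proof. by case: z w => [? ?] [? ?]. Qed.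
Lemma ReB (z w : R[i]) : Re (z - w) = Re z - Re w. Proof. by case: z w => [? ?] [? ?]. Qed.
Lemma ImB (z w : R[i]) : Im (z - w) = Im z - Im w. Proof. by case: z w => [? ?] [? ?]. Qed.
Lemma ReN (z : R[i]) : Re (- z) = - Re z. Proof. by case: z. Qed.
Lemma ImN (z : R[i]) : Im (- z) = - Im z. Proof. by case: z. Qed.
Lemma ReM (z w : R[i]) : Re (z * w) = Re z * Re w - Im z * Im w.
Proof. by case: z w => [? ?] [? ?]. Qed.
Lemma ImM (z w : R[i]) : Im (z * w) = Re z * Im w + Im z * Re w.
Proof. by case: z w => [? ?] [? ?]. Qed.

Definition reimE := (ReD, ImD, ReB, ImB, ReN, ImN, ReM, ImM).

Lemma complex_ext (z w : R[i]) : Re z = Re w -> Im z = Im w -> z = w.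
Proof. by case: z w => [? ?] [? ?] /= -> ->. Qed.

Lemma cL2D f g : cL2 f -> cL2 g -> cL2 (fun x => f x + g x).
Proof.
move=> [f1 f2] [g1 g2]; split.
  by have := sqitgD f1 g1; congr sqitg; apply/funext => x; rewrite ReD.
by have := sqitgD f2 g2; congr sqitg; apply/funext => x; rewrite ImD.
Qed.

Lemma cL2Z (z : R[i]) f : cL2 f -> cL2 (fun x => z * f x).
Proof.
move=> [f1 f2]; split.
  have := sqitgB (sqitgZ (Re z) f1) (sqitgZ (Im z) f2).
  by congr sqitg; apply/funext => x; rewrite ReM.
have := sqitgD (sqitgZ (Re z) f2) (sqitgZ (Im z) f1).
by congr sqitg; apply/funext => x; rewrite ImM.
Qed.

Lemma cL2B f g : cL2 f -> cL2 g -> cL2 (fun x => f x - g x).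
Proof.
move=> [f1 f2] [g1 g2]; split.
  by have := sqitgB f1 g1; congr sqitg; apply/funext => x; rewrite ReB.
by have := sqitgB f2 g2; congr sqitg; apply/funext => x; rewrite ImB.
Qed.

Lemma cip_itg f g : cL2 f -> cL2 g ->
  itg mu (fun x => Re (f x) * Re (g x) + Im (f x) * Im (g x)).
Proof. by move=> [f1 f2] [g1 g2]; apply: itgD; exact: sqitg_mul. Qed.

Lemma cipC f g : cip f g = cip g f.
Proof. by apply: I_ext => x; ring. Qed.

Lemma cipDl f g h : cL2 f -> cL2 g -> cL2 h ->
  cip (fun x => f x + g x) h = cip f h + cip g h.
Proof.
move=> hf hg hh; rewrite /cip -ID; try exact: cip_itg.
by apply: I_ext => x; rewrite !reimE; ring.
Qed.

Lemma cipBl f g h : cL2 f -> cL2 g -> cL2 h ->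
  cip (fun x => f x - g x) h = cip f h - cip g h.
Proof.
move=> hf hg hh; rewrite /cip -IB; try exact: cip_itg.
by apply: I_ext => x; rewrite !reimE; ring.
Qed.

Lemma cipZl (t : R) f h : cL2 f -> cL2 h -> cip (fun x => t%:C * f x) h = t * cip f h.
Proof.
move=> hf hh; rewrite /cip -IZ; last exact: cip_itg.
by apply: I_ext => x; rewrite !reimE /=; ring.
Qed.

Lemma csq_ge0 f : 0 <= csq f.
Proof. by apply: I_ge0 => x; rewrite -!expr2; ge0. Qed.

Lemma csq_lin (t : R) f g : cL2 f -> cL2 g ->
  csq (fun x => f x + t%:C * g x) = csq f + 2 * t * cip f g + t ^+ 2 * csq g.
Proof.
move=> hf hg; have hg' : cL2 (fun x => t%:C * g x) := cL2Z _ hg.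
have hs := cL2D hf hg'.
rewrite /csq cipDl// cipZl// [cip f _]cipC [cip g _]cipC !cipDl// !cipZl//.
rewrite [cip g f]cipC; ring.
Qed.

Lemma csqZ (t : R) f : cL2 f -> csq (fun x => t%:C * f x) = t ^+ 2 * csq f.
Proof.
move=> hf; have hf' : cL2 (fun x => t%:C * f x) := cL2Z _ hf.
by rewrite /csq cipZl// cipC cipZl//; ring.
Qed.

Lemma cauchy_schwarz f g : cL2 f -> cL2 g -> cip f g ^+ 2 <= csq f * csq g.
Proof.
move=> hf hg; apply: quadratic_discr; first exact: csq_ge0.
by move=> t; rewrite -csq_lin//; exact: csq_ge0.
Qed.

Lemma csq_ext f g : (forall x, f x = g x) -> csq f = csq g.
Proof. by move=> fg; congr csq; apply/funext. Qed.

Lemma csq_sum_le f g : cL2 f -> cL2 g ->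
  csq (fun x => f x + g x) <= 2 * csq f + 2 * csq g.
Proof.
move=> hf hg.
rewrite (@csq_ext _ (fun x => f x + 1%:C * g x)); last by move=> x; rewrite mul1r.
have := csq_ge0 (fun x => f x + (-1)%:C * g x).
rewrite !csq_lin//; lra.
Qed.

Lemma csqE f : cL2 f ->
  csq f = I (fun x => Re (f x) ^+ 2) + I (fun x => Im (f x) ^+ 2).
Proof.
move=> [[_ f1] [_ f2]]; rewrite -ID//; apply: I_ext => x; ring.
Qed.

Lemma complex_riesz_fischer (f : nat -> T -> R[i]) (K : R) :
  (forall n, cL2 (f n)) ->
  (forall n, csq (fun x => f n.+1 x - f n x) <= K * 4^-1 ^+ n) ->
  exists2 g, cL2 g & csq (fun x => f n x - g x) @[n --> \oo] --> 0.
Proof.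
move=> fL2 fK.
have cB n : cL2 (fun x => f n.+1 x - f n x) by exact: cL2B.
have [g1 sg1 l1] : exists2 g, sqitg mu g & I (fun x => (Re (f n x) - g x) ^+ 2) @[n --> \oo] --> 0.
  apply: (@riesz_fischer _ _ _ mu (fun n x => Re (f n x)) K) => n; first by case: (fL2 n).
  apply: le_trans (fK n); rewrite csqE// ler_wpDr//.
    by apply: I_ge0 => x; exact: sqr_ge0.
  by rewrite le_eqVlt; apply/orP; left; apply/eqP/I_ext => x; rewrite ReB.
have [g2 sg2 l2] : exists2 g, sqitg mu g & I (fun x => (Im (f n x) - g x) ^+ 2) @[n --> \oo] --> 0.
  apply: (@riesz_fischer _ _ _ mu (fun n x => Im (f n x)) K) => n; first by case: (fL2 n).
  apply: le_trans (fK n); rewrite csqE// ler_wpDl//.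
    by apply: I_ge0 => x; exact: sqr_ge0.
  by rewrite le_eqVlt; apply/orP; left; apply/eqP/I_ext => x; rewrite ImB.
have gL2 : cL2 (fun x => g1 x +i* g2 x) by [].
exists (fun x => g1 x +i* g2 x) => //.
have := cvgD l1 l2; rewrite addr0.
have -> : (fun n => csq (fun x => f n x - (g1 x +i* g2 x))) =
  (fun n => I (fun x => Re (f n x - (g1 x +i* g2 x)) ^+ 2) +
            I (fun x => Im (f n x - (g1 x +i* g2 x)) ^+ 2)).
  by apply/funext => n; rewrite csqE//; exact: cL2B.
have -> : (fun n => I (fun x => Re (f n x - (g1 x +i* g2 x)) ^+ 2) +
                    I (fun x => Im (f n x - (g1 x +i* g2 x)) ^+ 2)) =
  (fun n => I (fun x => (Re (f n x) - g1 x) ^+ 2) + I (fun x => (Im (f n x) - g2 x) ^+ 2)).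
  by apply/funext => n; congr (_ + _); apply: I_ext => x; rewrite !reimE.
by apply; exact: eventually_filter.
Qed.

(** The projection theorem for a real subspace [S] that need not be closed: a minimising sequence
    for the distance to [f] is Cauchy by the parallelogram law, and the residual [v] of its limit is
    orthogonal to [S], hence null. *)
Lemma dense_of_orthogonal_trivial (S : (T -> R[i]) -> Prop) :
  S (fun=> 0) ->
  (forall f g (t : R), S f -> S g -> S (fun x => f x + t%:C * g x)) ->
  (forall f, S f -> cL2 f) ->
  (forall v, cL2 v -> (forall s, S s -> cip v s = 0) -> csq v = 0) ->
  forall f, cL2 f -> forall e : R, 0 < e ->
  exists2 s, S s & csq (fun x => s x - f x) < e.
Proof.
move=> S0 SL SL2 Sorth f fL2.
pose E : set R := [set csq (fun x => s x - f x) | s in S].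
have E0 : has_inf E.
  split; first by exists (csq (fun x => 0 - f x)), (fun=> 0).
  by exists 0 => _ [s _ <-]; exact: csq_ge0.
pose dd := inf E.
have dle s : S s -> dd <= csq (fun x => s x - f x).
  by move=> Ss; apply: (ge_inf E0.2); exists s.
have exn n : exists s, S s /\ csq (fun x => s x - f x) < dd + 4^-1 ^+ n.
  have [_ [s Ss <-] h] : exists2 x, E x & x < dd + 4^-1 ^+ n.
    by apply: inf_adherent => //; rewrite exprn_gt0// invr_gt0.
  by exists s.
have [s sP] := choice exn.
have sS n : S (s n) by case: (sP n).
have sL2 n : cL2 (s n) by exact: SL2.
have sfL2 n : cL2 (fun x => s n x - f x) by exact: cL2B.
have cauchy n : csq (fun x => s n.+1 x - s n x) <= 4 * 4^-1 ^+ n.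
  pose a x := s n x - f x; pose b x := s n.+1 x - f x.
  have aL2 : cL2 a by exact: sfL2.
  have bL2 : cL2 b by exact: sfL2.
  rewrite (@csq_ext _ (fun x => b x + (-1)%:C * a x)); last first.
    by move=> x; rewrite /a /b rmorphN1 mulN1r; ring.
  (* The midpoint of [s n] and [s n.+1] lies in [S], so its squared distance to [f] is at least
     [dd]; the parallelogram law turns this into a bound on the increment. *)
  have hmid : dd <= 2^-1 ^+ 2 * csq (fun x => b x + 1%:C * a x).
    rewrite -csqZ; last by apply: cL2D => //; exact: cL2Z.
    rewrite (@csq_ext _ (fun x => ((0 + (2^-1 : R)%:C * s n x) + (2^-1 : R)%:C * s n.+1 x) - f x)).
      by apply: dle; apply: (SL _ _ _) => //; apply: SL.
    move=> x; apply: complex_ext; rewrite /a /b !reimE /=; lra.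
  have h1 := (sP n).2; have h2 := (sP n.+1).2.
  have h3 : (4^-1 : R) ^+ n.+1 <= 4^-1 ^+ n.
    by rewrite exprS ler_piMl//; ge0.
  move: hmid; rewrite !csq_lin// -/a -/b; rewrite -/(csq _) in h1 h2 *.
  by rewrite -/a in h1; rewrite -/b in h2; lra.
have [g gL2 sg] := complex_riesz_fischer sL2 cauchy.
pose v x := g x - f x.
have vL2 : cL2 v by exact: cL2B.
have v0 : csq v = 0.
  apply: Sorth => // w Sw; have wL2 := SL2 _ Sw.
  have cvgc : cip (fun x => s n x - f x) w @[n --> \oo] --> cip v w.
    have E1 n : cip (fun x => s n x - f x) w = cip (fun x => s n x - g x) w + cip v w.
      rewrite -cipDl//; last exact: cL2B.
      by apply: I_ext => x; rewrite /v !reimE; ring.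
    apply: (ncvg_ext (fun n => esym (E1 n)) (add0r _)); apply: ncvgD; last exact: cvg_cst.
    apply: ncvg_sqr0; apply: (@ncvg_squeeze0 _ _ (fun n => csq w * csq (fun x => s n x - g x))).
      move=> n; rewrite sqr_ge0 /= mulrC; apply: cauchy_schwarz => //; exact: cL2B.
    by rewrite -(mulr0 (csq w)); apply: ncvgZ.
  (* Minimality of [dd] tested on [s n + t w], in the limit: a nonnegative quadratic in [t] without
     constant term, whose linear coefficient must vanish. *)
  have quad t : 0 <= 2 * t * cip v w + t ^+ 2 * csq w.
    have c1 : 2 * t * cip (fun x => s n x - f x) w + t ^+ 2 * csq w + 4^-1 ^+ n @[n --> \oo]
              --> 2 * t * cip v w + t ^+ 2 * csq w + 0.
      apply: cvgD.
        apply: cvgD; last exact: cvg_cst.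
        by apply: cvgM => //; exact: cvg_cst.
      by apply: cvg_expr; rewrite ger0_norm// invf_lt1// ltr1n.
    rewrite -[leRHS]addr0; apply: (@cvgr_to_ge _ _ _ _ _ _ _ c1).
    apply: nearW => n.
    have := dle _ (SL _ _ t (sS n) Sw).
    rewrite (@csq_ext _ (fun x => (s n x - f x) + t%:C * w x)); last by move=> x; ring.
    rewrite csq_lin//; have := (sP n).2; lra.
  have := quadratic_discr (csq_ge0 w) (a := 0) (b := cip v w).
  rewrite mul0r => H; apply/eqP; rewrite -sqrf_eq0 eq_le sqr_ge0 andbT H// => t.
  by rewrite add0r; exact: quad.
move=> e e0; have := sg => /cvgrPdist_lt/(_ (e / 2)) [|N _ HN]; first by lra.
exists (s N) => //; have := HN N (leqnn _).
rewrite /= sub0r normrN ger0_norm ?csq_ge0// => h.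
rewrite (@csq_ext _ (fun x => (s N x - g x) + v x)); last by move=> x; rewrite /v; ring.
apply: (le_lt_trans (csq_sum_le (cL2B (sL2 N) gL2) vL2)).
rewrite v0; lra.
Qed.

End ComplexL2.

(** * Derivatives and integration by parts in the plane *)

Section DirectionalDerivatives.
Context {R : realType}.
Implicit Types (f g : R * R -> R) (p v : R * R).

Lemma is_deriveP (V : normedModType R) (f : V -> R) (p v : V) (d : R) :
  is_derive p v f d <->
  h^-1 *: (f (h *: v + p) - f p) @[h --> 0^'] --> d.
Proof.
split; first by case=> /derivableP h <-; have [] := h.
move=> h; apply: DeriveDef; first by apply/cvg_ex; exists d.
exact/cvg_lim.
Qed.

Lemma is_derive_eqf (V : normedModType R) (f g : V -> R) (p v : V) (d e : R) :
  (forall q, f q = g q) -> d = e -> is_derive p v f d -> is_derive p v g e.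
Proof. by move=> fg <-; have -> : g = f by apply/funext => q; rewrite fg. Qed.

Lemma is_derive_line f p v d :
  is_derive (0 : R) 1 (fun t => f (t *: v + p)) d <-> is_derive p v f d.
Proof.
rewrite !is_deriveP.
suff -> : (fun h : R => h^-1 *: (f ((h *: (1 : R) + 0) *: v + p) - f (0 *: v + p))) =
  (fun h : R => h^-1 *: (f (h *: v + p) - f p)) by [].
by apply/funext => h; rewrite addr0 scale0r add0r [h *: 1]mulr1.
Qed.

Lemma is_derive_x f p d :
  is_derive (p.1 : R) 1 (fun s => f (s, p.2)) d <-> is_derive p (dir false) f d.
Proof.
rewrite !is_deriveP.
suff -> : (fun h : R => h^-1 *: (f ((h *: (1 : R) + p.1), p.2) - f (p.1, p.2))) =
  (fun h : R => h^-1 *: (f (h *: dir false + p) - f p)) by [].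
apply/funext => h; congr (_ *: (f _ - f _)); last by case: p.
by case: p => x y; rewrite /dir /=; congr pair; rewrite /= [h *: 0]mulr0 add0r.
Qed.

Lemma is_derive_y f p d :
  is_derive (p.2 : R) 1 (fun s => f (p.1, s)) d <-> is_derive p (dir true) f d.
Proof.
rewrite !is_deriveP.
suff -> : (fun h : R => h^-1 *: (f (p.1, (h *: (1 : R) + p.2)) - f (p.1, p.2))) =
  (fun h : R => h^-1 *: (f (h *: dir true + p) - f p)) by [].
apply/funext => h; congr (_ *: (f _ - f _)); last by case: p.
by case: p => x y; rewrite /dir /=; congr pair; rewrite /= [h *: 0]mulr0 add0r.
Qed.

(* A copy of [is_derive] hidden from typeclass resolution. *)
Definition isd p v f (d : R) : Prop := is_derive p v f d.

Lemma isd_eq p v f d e : isd p v f d -> d = e -> is_derive p v f e.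
Proof. by move=> fd <-. Qed.

Section Rules.
Variables (p v : R * R).

Lemma dC (c : R) : isd p v (fun=> c) 0.
Proof. exact: is_derive_cst. Qed.

Lemma dD f g a b : isd p v f a -> isd p v g b ->
  isd p v (fun q => f q + g q) (a + b).
Proof. by rewrite /isd => fa gb; exact: (is_deriveD fa gb). Qed.

Lemma dN f a : isd p v f a -> isd p v (fun q => - f q) (- a).
Proof. by rewrite /isd => fa; exact: (is_deriveN fa). Qed.

Lemma dM f g a b : isd p v f a -> isd p v g b ->
  isd p v (fun q => f q * g q) (a * g p + f p * b).
Proof.
rewrite /isd =>  fa gb; apply: (is_derive_eqf (f := f * g) _ _ (is_deriveM fa gb)) => //.
by rewrite addrC [g p *: _]mulrC.
Qed.

Lemma dcomp (h : R -> R) f c a : is_derive (f p) 1 h c -> isd p v f a ->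
  isd p v (fun q => h (f q)) (c * a).
Proof.
rewrite /isd =>  hc /is_derive_line fa; apply/(is_derive_line (fun q => h (f q))).
have hc' : is_derive (f (0 *: v + p)) 1 h c by rewrite scale0r add0r.
exact: (is_derive1_comp (f := h) (g := fun t => f (t *: v + p))).
Qed.

Lemma dX f a n : isd p v f a ->
  isd p v (fun q => f q ^+ n.+1) (n.+1%:R * f p ^+ n * a).
Proof.
rewrite /isd =>  fa; apply: (dcomp (h := fun z => z ^+ n.+1)) fa.
apply: (is_derive_eqf (f := (id : R -> R) ^+ n.+1) _ _
  (is_deriveX n.+1 (is_derive_id (f p) (1 : R)))) => [q|]; last by rewrite /= [_ *: _]mulr1.
by rewrite exprfctE.
Qed.

Lemma dfst : isd p v (fun q => q.1) v.1.
Proof.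
apply/(is_deriveP (V := (R * R)%type)); apply: cvg_near_cst; near=> h.
have h0 : h != 0 by near: h; exact: nbhs_dnbhs_neq.
by rewrite addrK [_ *: _]mulrA mulVf// mul1r.
Unshelve. all: by end_near. Qed.

Lemma dsnd : isd p v (fun q => q.2) v.2.
Proof.
apply/(is_deriveP (V := (R * R)%type)); apply: cvg_near_cst; near=> h.
have h0 : h != 0 by near: h; exact: nbhs_dnbhs_neq.
by rewrite addrK [_ *: _]mulrA mulVf// mul1r.
Unshelve. all: by end_near. Qed.

End Rules.

Lemma partialE b f p d : is_derive p (dir b) f d -> partial b f p = d.
Proof. by case. Qed.

Lemma smooth_continuous f : smooth f -> continuous f.
Proof. by move=> /(_ [::]) []. Qed.

Lemma smooth_is_derive b f p : smooth f -> is_derive p (dir b) f (partial b f p).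
Proof. by move=> /(_ [::]) [_] /(_ b p) /derivableP. Qed.

Lemma smooth_partial b f : smooth f -> smooth (partial b f).
Proof. by move=> sf s; have := sf (rcons s b); rewrite foldr_rcons. Qed.

(** A class of continuous differentiable functions closed under both partial derivatives contains
    every iterated derivative of its members; this replaces an induction on words for each concrete
    function. *)
Lemma smooth_coind (P : (R * R -> R) -> Prop) :
  (forall f, P f -> continuous f /\
     forall b, (forall p, derivable f p (dir b)) /\ P (partial b f)) ->
  forall f, P f -> smooth f.
Proof.
move=> HP f Pf s.
have : P (foldr partial f s).
  by elim: s => //= b s IH; have [_ /(_ b) []] := HP _ IH.
by move=> /HP[cf df]; split => // b p; have [] := df b.
Qed.

Lemma smooth_lin f g (c : R) : smooth f -> smooth g -> smooth (fun q => f q + c * g q).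
Proof.
move=> sf sg.
apply: (@smooth_coind (fun h => exists f g, [/\ smooth f, smooth g &
    h = (fun q => f q + c * g q)])); last by exists f, g.
move=> h [f' [g' [sf' sg' ->]]]; split.
  move=> p; apply: cvgD; first exact: smooth_continuous.
  by apply: cvgM; [exact: cvg_cst|exact: smooth_continuous].
move=> b.
have D p : is_derive p (dir b) (fun q => f' q + c * g' q)
    (partial b f' p + c * partial b g' p).
  apply: (is_derive_eqf (f := fun q => f' q + c * g' q) _ _
    (dD (smooth_is_derive b p sf') (dM (dC _ _ c) (smooth_is_derive b p sg')))) => //.
  by rewrite mul0r add0r.
split; first by move=> p; have [] := D p.
exists (partial b f'), (partial b g'); split; [exact: smooth_partial..|].
by apply/funext => p; exact: partialE (D p).
Qed.

Definition in_box (M : R) f := forall p, M < `|p.1| \/ M < `|p.2| -> f p = 0.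

Lemma open_out_box (M : R) : open [set p : R * R | M < `|p.1| \/ M < `|p.2|].
Proof.
apply: openU.
- apply: (@open_comp _ _ (fun p : R * R => `|p.1|) [set x | M < x]); last exact: open_gt.
  by move=> p _; apply: cvg_norm; exact: cvg_fst.
- apply: (@open_comp _ _ (fun p : R * R => `|p.2|) [set x | M < x]); last exact: open_gt.
  by move=> p _; apply: cvg_norm; exact: cvg_snd.
Qed.

(** The complement of the box is open, so near such a point the difference quotients are zero. *)
Lemma in_box_derive M f p v d : in_box M f -> M < `|p.1| \/ M < `|p.2| ->
  is_derive p v f d -> d = 0.
Proof.
move=> bf pM /is_deriveP h.
have : h^-1 *: (f (h *: v + p) - f p) @[h --> 0^'] --> (0 : R).
  apply: cvg_near_cst.
  have cont : (fun h : R => h *: v + p) @ 0^' --> p.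
    apply: cvg_within_filter.
    have : h *: v + p @[h --> (0 : R)] --> (0 : R) *: v + p.
      by apply: cvgD; [apply: cvgZr_tmp; exact: cvg_id|exact: cvg_cst].
    by rewrite scale0r add0r.
  have /cont : nbhs p [set p : R * R | M < `|p.1| \/ M < `|p.2|].
    by apply: open_nbhs_nbhs; split => //; exact: open_out_box.
  move=> H; apply: (@filterS _ (0 : R)^' _
    ((fun h : R => h *: v + p) @^-1` [set p : R * R | M < `|p.1| \/ M < `|p.2|]) _ _ H).
  by move=> t /(bf (t *: v + p)) ftM; rewrite ftM (bf _ pM) subrr scaler0.
by move=> h0; exact: (cvg_unique _ h h0).
Qed.

Lemma in_box_partial M b f : smooth f -> in_box M f -> in_box M (partial b f).
Proof. by move=> sf bf p pM; apply: (in_box_derive bf pM); exact: smooth_is_derive. Qed.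

End DirectionalDerivatives.

(** * Measurability, integration by parts and mixed derivatives in the plane *)

Section Plane.
Context {R : realType}.
Implicit Types (f g : R * R -> R).
Local Notation leb := (@lebesgue_measure R).
Local Notation mu := (@leb2 R).
Local Notation I2 := (Rintegral (@leb2 R) setT).

Lemma is_derive1_continuous (g : R -> R) (x d : R) : is_derive x 1 g d -> {for x, continuous g}.
Proof. by case=> /derivable1_diffP/differentiable_continuous. Qed.

Lemma MVT_is_derive (g dg : R -> R) (a h : R) : 0 < h ->
  (forall x : R, is_derive x 1 g (dg x)) ->
  exists2 c, a < c < a + h & g (a + h) - g a = dg c * h.
Proof.
move=> h0 dgP.
have aL : a < a + h by rewrite ltrDl.
have cg : {within `[a, a + h], continuous g}.
  by apply: continuous_subspaceT => x; exact: is_derive1_continuous (dgP x).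
have [c + E] := @MVT R g dg a (a + h) aL (fun x _ => dgP x) cg.
rewrite in_itv /= => cI; exists c => //.
by rewrite E; congr (_ * _); ring.
Qed.

Lemma cvg_pair_comp (T : Type) (F : set_system T) (FF : Filter F) (u v : T -> R) (x y : R) f :
  continuous f -> u @ F --> x -> v @ F --> y -> f (u t, v t) @[t --> F] --> f (x, y).
Proof.
move=> cf ux vy; apply: (cvg_comp2 (h := fun a b => f (a, b)) ux vy).
have -> : (fun q : R * R => f (q.1, q.2)) = f by apply/funext => -[].
exact: cf.
Qed.

(** Measurability refers to the product sigma-algebra. Rounding the first coordinate down to a
    multiple of [1 / (n + 1)] leaves countably many strips on which the function depends on the
    second coordinate only; as [n] grows the rounded functions converge to [f] pointwise. *)
Lemma continuous_measurable2 f : continuous f -> measurable_fun setT f.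
Proof.
move=> cf.
pose q n (x : R) : R := (Num.floor (x * n.+1%:R))%:~R / n.+1%:R.
have qcvg x : q n x @[n --> \oo] --> x.
  apply/cvgrPdist_lt => e e0.
  have [N _ HN] := near_infty_natSinv_lt (PosNum e0).
  exists N => // n Nn; have := HN n Nn => /= ne.
  have n0 : (0 : R) < n.+1%:R by rewrite ltr0n.
  have /andP[h1 h2] := real_floor_itv (num_real (x * n.+1%:R)).
  apply: le_lt_trans ne; rewrite /q.
  have -> : x - (Num.floor (x * n.+1%:R))%:~R / n.+1%:R =
    (x * n.+1%:R - (Num.floor (x * n.+1%:R))%:~R) / n.+1%:R.
    by field; rewrite gt_eqF.
  rewrite ger0_norm; last by apply: divr_ge0; [rewrite subr_ge0|exact: ltW].
  rewrite -[leRHS]mul1r ler_pM2r ?invr_gt0//.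
  by move: h2; rewrite intrD; lra.
apply: (@measurable_fun_cvg _ (measurableTypeR R * measurableTypeR R)%type R setT (fun n p => f (q n p.1, p.2))); last first.
  move=> [x y] _; apply: (@cvg_pair_comp _ _ _ (q ^~ x) (fun=> y)) => //; exact: cvg_cst.
move=> n _ B mB; rewrite setTI.
have -> : (fun p : R * R => f (q n p.1, p.2)) @^-1` B =
  \bigcup_(k : int) ([set x : measurableTypeR R | k%:~R <= x * n.+1%:R < (k + 1)%:~R] `*`
      ((fun y : measurableTypeR R => f (k%:~R / n.+1%:R, y)) @^-1` B)).
  apply/seteqP; split => [[x y] /= Bxy | [x y] /= [k _ [/= xk Bk]]].
    exists (Num.floor (x * n.+1%:R)) => //; split => //=.
    exact: real_floor_itv (num_real _).
  by rewrite /q (floor_def xk).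
apply: countable_bigcupT_measurable => // k; apply: measurableX.
  have -> : [set x : measurableTypeR R | k%:~R <= x * n.+1%:R < (k + 1)%:~R] =
    [set` `[(k%:~R / n.+1%:R), ((k + 1)%:~R / n.+1%:R)[%R].
    apply/seteqP; split=> x /=; rewrite in_itv /= ler_pdivrMr ?ltr0n// ltr_pdivlMr ?ltr0n//.
  exact: measurable_itv.
rewrite -[X in measurable X]setTI.
apply: continuous_measurable_fun => // y.
by apply: (@cvg_pair_comp _ _ _ (fun=> k%:~R / n.+1%:R) id) => //; exact: cvg_cst.
Qed.

Definition box (M : R) : set (R * R) := `[- M, M] `*` `[- M, M].

Lemma box_compact M : compact (box M).
Proof. by apply: compact_setX; exact: segment_compact. Qed.

Lemma boxP M p : box M p <-> `|p.1| <= M /\ `|p.2| <= M.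
Proof. by rewrite /box /setX /= !in_itv /= !ler_norml; split=> -[]. Qed.

Lemma notin_boxP M p : ~ box M p <-> M < `|p.1| \/ M < `|p.2|.
Proof.
rewrite boxP; split; last by move=> [] h [h1 h2]; move: h; rewrite ltNge ?h1 ?h2.
by move=> h; rewrite !ltNge; apply: contrapT => /not_orP[/negP h1 /negP h2]; apply: h;
  move: h1 h2; rewrite !negbK.
Qed.

Lemma itg_box M : itg mu (fun p => \1_(box M) p).
Proof.
have mI : measurable (`[- M, M] : set (measurableTypeR R)) by exact: measurable_itv.
have mB : measurable (box M : set (measurableTypeR R * measurableTypeR R)).
  exact: measurableX.
apply: ge0_itg.
- exact: measurable_indic.
- by move=> p; rewrite indicE.
- rewrite integral_indic// setIT.
  have -> : mu (box M) = (leb `[(- M)%R, M] * leb `[(- M)%R, M])%E.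
    exact: product_measure1E.
  rewrite lebesgue_measure_itv /=; by case: ifP => _; [rewrite -EFinD -EFinM ltry|rewrite mul0e ltry].
Qed.

Lemma in_box_bounded M f : continuous f -> in_box M f -> exists K, forall p, `|f p| <= K * \1_(box M) p.
Proof.
move=> cf bf.
have cptI : compact (f @` box M).
  apply: continuous_compact; last exact: box_compact.
  exact: continuous_subspaceT.
have [K [_ HK]] := compact_bounded cptI.
exists (`|K| + 1) => p; rewrite indicE.
have [pB|pB] := pselect (box M p).
  rewrite mem_set// mulr1; apply: (HK (`|K| + 1)); last by exists p.
  by rewrite (le_lt_trans (ler_norm K))// ltrDl.
by rewrite memNset// mulr0 bf ?normr0//; exact/notin_boxP.
Qed.

Lemma itg_in_box M f : continuous f -> in_box M f -> itg mu f.
Proof.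
move=> cf bf; have [K HK] := in_box_bounded cf bf.
apply: (@itg_le _ _ _ mu f _ _ _ HK); first exact: continuous_measurable2.
by apply: itgZ; exact: itg_box.
Qed.

Lemma Rintegral_derive0 (g dg : R -> R) M : (forall x : R, is_derive x 1 g (dg x)) ->
  continuous dg -> (forall x, M < `|x| -> g x = 0) -> (forall x, M < `|x| -> dg x = 0) ->
  (\int[leb]_x (dg x)%:E = 0)%E.
Proof.
move=> gP cdg g0 dg0.
pose N := `|M| + 1.
have MN : M < N by rewrite /N (le_lt_trans (ler_norm M))// ltrDl.
have N0 : 0 < N by rewrite /N ltr_wpDl.
have -> : (\int[leb]_x (dg x)%:E = \int[leb]_(x in `[(- N)%R, N]) (dg x)%:E)%E.
  rewrite [RHS]integral_mkcond; apply: eq_integral => x _.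
  rewrite patchE; case: ifPn => //; rewrite notin_setE /= in_itv /= => /negP.
  rewrite -ler_norml -ltNge => h; rewrite dg0//; exact: lt_trans h.
have cg : continuous g by move=> x; exact: is_derive1_continuous (gP x).
rewrite (@continuous_FTC2 _ _ g); first 1 last.
- by rewrite gtrN.
- exact: continuous_subspaceT.
- split.
  + by move=> x _; have [] := gP x.
  + exact/cvg_at_right_filter/cg.
  + exact/cvg_at_left_filter/cg.
- by move=> x _; rewrite derive1E; have [] := gP x.
by rewrite !g0 ?normrN ?gtr0_norm// subee.
Qed.

(** Integrating along the direction of the derivative comes before the other variable: each line
    contributes zero by the fundamental theorem of calculus. Bounded support and continuity make
    Fubini applicable. *)
Lemma Rintegral_partial0 M b (F dF : R * R -> R) :
  (forall p, is_derive p (dir b) F (dF p)) -> continuous dF -> in_box M F ->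
  I2 dF = 0.
Proof.
move=> FP cdF bF.
have bdF : in_box M dF by move=> p pM; exact: (in_box_derive bF pM (FP p)).
have iF := itg_in_box cdF bdF.
have cs (x y : R) : {for x, continuous (fun s => dF (s, y))} /\ {for y, continuous (fun s => dF (x, s))}.
  split.
    by apply: (@cvg_pair_comp _ _ _ id (fun=> y)) => //; exact: cvg_cst.
  by apply: (@cvg_pair_comp _ _ _ (fun=> x) id) => //; exact: cvg_cst.
case: b FP => FP.
- rewrite /Rintegral -(@integral12_prod_meas1 _ _ _ _ _ leb leb (EFin \o dF))//.
  rewrite integral0_eq// => x _; rewrite /fubini_F.
  apply: (@Rintegral_derive0 (fun s => F (x, s)) (fun s => dF (x, s)) M).
  + by move=> y; exact: (is_derive_y F (x, y) _).2 (FP _).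
  + by move=> y; exact: (cs x y).2.
  + by move=> y h; apply: bF; right.
  + by move=> y h; apply: bdF; right.
- rewrite /Rintegral -(@integral21_prod_meas1 _ _ _ _ _ leb leb (EFin \o dF))//.
  rewrite integral0_eq// => y _; rewrite /fubini_G.
  apply: (@Rintegral_derive0 (fun s => F (s, y)) (fun s => dF (s, y)) M).
  + by move=> x; exact: (is_derive_x F (x, y) _).2 (FP _).
  + by move=> x; exact: (cs x y).1.
  + by move=> x h; apply: bF; left.
  + by move=> x h; apply: bdF; left.
Qed.

(** The second difference of [f] over a small square, evaluated by the mean value theorem in both
    orders, equates the two mixed derivatives at two nearby points; continuity carries the equality
    to [p]. *)
Lemma clairaut f : smooth f ->
  forall p, partial true (partial false f) p = partial false (partial true f) p.
Proof.
move=> sf p.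
have sx := smooth_partial false sf; have sy := smooth_partial true sf.
have cxy := smooth_continuous (smooth_partial true sx).
have cyx := smooth_continuous (smooth_partial false sy).
apply/eqP; rewrite -subr_eq0 -normr_le0; apply/ler_addgt0Pr => e e0; rewrite add0r.
have e2 : 0 < e / 2 by lra.
have n1 := (cvgrPdist_lt _ _).1 (cxy p) _ e2.
have n2 := (cvgrPdist_lt _ _).1 (cyx p) _ e2.
have [k k0 hk] : exists2 k : R, 0 < k & forall q : R * R,
    p.1 < q.1 < p.1 + k -> p.2 < q.2 < p.2 + k ->
    `|partial true (partial false f) p - partial true (partial false f) q| < e / 2 /\
    `|partial false (partial true f) p - partial false (partial true f) q| < e / 2.
  have [k /= k0 hk] := (nbhs_ballP _ _).1 (filterI (n1 _) (n2 _)).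
  exists k => // q h1 h2; apply: hk; split; rewrite /ball /= /ball /= ltr_norml; lra.
have dx (y s : R) : is_derive s 1 (fun t => f (t, y)) (partial false f (s, y)).
  exact: (is_derive_x f (s, y) _).2 (smooth_is_derive false (s, y) sf).
have dy (x s : R) : is_derive s 1 (fun t => f (x, t)) (partial true f (x, s)).
  exact: (is_derive_y f (x, s) _).2 (smooth_is_derive true (x, s) sf).
have [c1 c1I E1] := @MVT_is_derive
  (fun s => f (s, p.2 + k) - f (s, p.2))
  (fun s => partial false f (s, p.2 + k) - partial false f (s, p.2)) p.1 k k0
  (fun s => is_deriveB (dx (p.2 + k) s) (dx p.2 s)).
have [c2 c2I E2] := @MVT_is_derive (fun t => partial false f (c1, t))
  (fun t => partial true (partial false f) (c1, t)) p.2 k k0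
  (fun s => (is_derive_y _ (c1, s) _).2 (smooth_is_derive true (c1, s) sx)).
have [c3 c3I E3] := @MVT_is_derive
  (fun s => f (p.1 + k, s) - f (p.1, s))
  (fun s => partial true f (p.1 + k, s) - partial true f (p.1, s)) p.2 k k0
  (fun s => is_deriveB (dy (p.1 + k) s) (dy p.1 s)).
have [c4 c4I E4] := @MVT_is_derive (fun t => partial true f (t, c3))
  (fun t => partial false (partial true f) (t, c3)) p.1 k k0
  (fun s => (is_derive_x _ (s, c3) _).2 (smooth_is_derive false (s, c3) sy)).
have [h1 _] := hk (c1, c2) c1I c2I; have [_ h2] := hk (c4, c3) c4I c3I.
move: E1 E2 E3 E4 h1 h2; rewrite /=.
move: (partial true (partial false f) p) (partial false (partial true f) p) => A B.
move: (partial true (partial false f) (c1, c2)) (partial false (partial true f) (c4, c3)) => A' B'.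
move: (partial false f (c1, p.2 + k)) (partial false f (c1, p.2)) => f1 f2.
move: (partial true f (p.1 + k, c3)) (partial true f (p.1, c3)) => f3 f4.
move: (f (p.1 + k, p.2 + k)) (f (p.1 + k, p.2)) (f (p.1, p.2 + k)) (f (p.1, p.2)) => g1 g2 g3 g4.
move=> E1 E2 E3 E4 h1 h2.
have kk : k * k != 0 by rewrite mulf_neq0 ?gt_eqF.
have E : A' = B'.
  apply: (mulIf kk); rewrite mulrA -E2 mulrA -E4.
  by rewrite -E1 -E3; ring.
move: h1 h2; rewrite E !ltr_norml => /andP[h1 h2] /andP[h3 h4].
by rewrite ler_norml; apply/andP; split; lra.
Qed.

End Plane.

(** * Energy and virial identities *)

Section ContinuityRules.
Context {R : realType}.
Implicit Types f g : R * R -> R.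

(* A copy of [continuous] on which the head of the function can be matched. *)
Definition contf f : Prop := continuous f.

Lemma contfP f : contf f -> continuous f. Proof. by []. Qed.

Lemma contC (c : R) : contf (fun _ : R * R => c).
Proof. by move=> p; exact: cvg_cst. Qed.
Lemma contD f g : contf f -> contf g -> contf (fun q => f q + g q).
Proof. by move=> cf cg p; apply: cvgD; [exact: cf|exact: cg]. Qed.
Lemma contN f : contf f -> contf (fun q => - f q).
Proof. by move=> cf p; apply: cvgN; exact: cf. Qed.
Lemma contM f g : contf f -> contf g -> contf (fun q => f q * g q).
Proof. by move=> cf cg p; apply: cvgM; [exact: cf|exact: cg]. Qed.
Lemma contX f n : contf f -> contf (fun q => f q ^+ n).
Proof.
move=> cf; elim: n => [|n IH]; first by apply: contC.
have -> : (fun q => f q ^+ n.+1) = (fun q => f q * f q ^+ n).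
  by apply/funext => q; rewrite exprS.
exact: contM.
Qed.
Lemma contcomp (h : R -> R) f : continuous h -> contf f -> contf (fun q => h (f q)).
Proof. by move=> ch cf p; apply: (continuous_comp (cf p)); exact: ch. Qed.

End ContinuityRules.

Lemma contfst (R : realType) : contf (fun q : R * R => q.1).
Proof. by move=> p; exact: cvg_fst. Qed.
Lemma contsnd (R : realType) : contf (fun q : R * R => q.2).
Proof. by move=> p; exact: cvg_snd. Qed.

Ltac deriv :=
  lazymatch goal with
  | |- isd _ _ (fun q => @GRing.add _ _ _) _ => apply: dD; deriv
  | |- isd _ _ (fun q => @GRing.opp _ _) _ => apply: dN; deriv
  | |- isd _ _ (fun q => @GRing.mul _ _ _) _ => apply: dM; deriv
  | |- isd _ _ (fun q => @GRing.exp _ _ _) _ => apply: dX; deriv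
  | |- isd _ _ fst _ => exact: dfst
  | |- isd _ _ snd _ => exact: dsnd
  | |- isd _ _ (fun q => q.1) _ => exact: dfst
  | |- isd _ _ (fun q => q.2) _ => exact: dsnd
  | |- isd _ _ ?F _ =>
    first [ match goal with H : is_derive _ _ ?G _ |- _ => constr_eq F G; exact H end | exact: dC ]
  end.

Ltac cont_rec :=
  lazymatch goal with
  | |- contf (fun q => @GRing.add _ _ _) => apply: contD; cont_rec
  | |- contf (fun q => @GRing.opp _ _) => apply: contN; cont_rec
  | |- contf (fun q => @GRing.mul _ _ _) => apply: contM; cont_rec
  | |- contf (fun q => @GRing.exp _ _ _) => apply: contX; cont_rec
  | |- contf fst => exact: contfst
  | |- contf snd => exact: contsnd
  | |- contf (fun q => q.1) => exact: contfst
  | |- contf (fun q => q.2) => exact: contsnd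
  | |- contf ?F =>
    first [ match goal with H : contf ?G |- _ => constr_eq F G; exact H end | exact: contC ]
  end.

Ltac cont := apply: contfP; cont_rec.

Local Opaque partial.

(* [ring] and [field] compare atoms up to conversion, which is costly on partial derivatives. *)
Ltac gen_partial :=
  repeat match goal with |- context [partial ?s ?f ?p] => move: (partial s f p) => ? end.

Section Hamiltonian.
Context {R : realType}.
Implicit Types (a b : R * R -> R) (u : R * R -> R[i]).
Local Notation mu := (@leb2 R).
Local Notation I2 := (Rintegral (@leb2 R) setT).
Local Notation Re := complex.Re.
Local Notation Im := complex.Im.
Local Notation dx := (partial false).
Local Notation dy := (partial true).

(* Real and imaginary parts of [H0_expr (a + i b)]. *)
Definition HR a b (p : R * R) : R :=
  - dx (dx a) p - dy (dy a) p + 2 * p.2 * dx b p + p.2 ^+ 2 * a p + p.1 * a p.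
Definition HI a b (p : R * R) : R :=
  - dx (dx b) p - dy (dy b) p - 2 * p.2 * dx a p + p.2 ^+ 2 * b p + p.1 * b p.

Lemma DE s u p : D s u p = partial s (fun q => Im (u q)) p +i* (- partial s (fun q => Re (u q)) p).
Proof. by rewrite /D; apply: complex_ext; rewrite !reimE /=; ring. Qed.

Lemma partial_mulx a b p : smooth a -> smooth b ->
  dx (fun q => dx a q + q.2 * b q) p = dx (dx a) p + p.2 * dx b p.
Proof.
move=> sa sb; apply: partialE.
have db := smooth_is_derive false p sb.
have dxa := smooth_is_derive false p (smooth_partial false sa).
by apply: isd_eq; [deriv|rewrite /=; gen_partial; ring].
Qed.

Lemma partialN s a p : smooth a -> partial s (fun q => - a q) p = - partial s a p.
Proof. by move=> sa; apply: partialE; apply: dN; exact: smooth_is_derive. Qed.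

Lemma H0_exprE u a b p : (forall q, Re (u q) = a q) -> (forall q, Im (u q) = b q) ->
  smooth a -> smooth b -> H0_expr u p = HR a b p +i* HI a b p.
Proof.
move=> ua ub sa sb.
have Fa : (fun q => Re (u q)) = a by apply/funext.
have Fb : (fun q => Im (u q)) = b by apply/funext.
have sNa : smooth (fun q => - a q).
  have -> : (fun q => - a q) = (fun q => a q + (- 2) * a q) by apply/funext => q; ring.
  exact: smooth_lin.
have E1 : (fun q => Re (Dx_plus_y u q)) = (fun q => dx b q + q.2 * a q).
  apply/funext => q; rewrite /Dx_plus_y DE Fa Fb !reimE /= ua ub; gen_partial; ring.
have E2 : (fun q => Im (Dx_plus_y u q)) = (fun q => dx (fun q => - a q) q + q.2 * b q).
  apply/funext => q; rewrite partialN// /Dx_plus_y DE Fa Fb !reimE /= ua ub; gen_partial; ring.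
have E3 : (fun q => Re (D true u q)) = dy b by apply/funext => q; rewrite DE Fb.
have E4 : (fun q => Im (D true u q)) = (fun q => - dy a q).
  by apply/funext => q; rewrite DE Fa.
have E5 : dx (fun q => - a q) = fun q => - dx a q.
  by apply/funext => q; rewrite partialN.
have E1p := congr1 (fun f => f p) E1; have E2p := congr1 (fun f => f p) E2.
rewrite /= in E1p E2p.
have H0E : H0_expr u p = D false (Dx_plus_y u) p + p.2%:C * Dx_plus_y u p
    + D true (D true u) p + p.1%:C * u p by [].
have E6 : dx (fun q => - dx a q) p = - dx (dx a) p by apply: partialN; exact: smooth_partial.
have E7 : dy (fun q => - dy a q) p = - dy (dy a) p by apply: partialN; exact: smooth_partial.
rewrite H0E; move: (E1p) (E2p); case: (Dx_plus_y u p) => r1 r2 /= -> ->.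
rewrite !DE E1 E2 E3 E4 !partial_mulx// E5 E6 E7.
apply: complex_ext; rewrite !reimE /= ua ub /HR /HI; gen_partial; ring.
Qed.

Lemma test_in_box u : test_function u ->
  exists M, in_box M (fun q => Re (u q)) /\ in_box M (fun q => Im (u q)).
Proof.
move=> [sa sb /compact_bounded[M [_ HM]]].
have H p : M + 1 < `|p.1| \/ M + 1 < `|p.2| -> u p = 0.
  move=> h; apply: contrapT => /eqP u0.
  have M1 : M < M + 1 by rewrite ltrDl.
  have /= := HM (M + 1) M1 p (@subset_closure _ [set p | u p != 0] p u0).
  rewrite /Num.norm /= ge_max => /andP[h1 h2].
  by case: h; rewrite ltNge ?h1 ?h2.
by exists (M + 1); split => p /H ->.
Qed.

Lemma in_box_test u (M : R) : smooth (fun q => Re (u q)) -> smooth (fun q => Im (u q)) ->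
  (forall p, M < `|p.1| \/ M < `|p.2| -> u p = 0) -> test_function u.
Proof.
move=> sa sb uM; split => //.
apply: (@subclosed_compact _ _ (box M)); [exact: closed_closure|exact: box_compact|].
rewrite closureE; apply: smallest_sub.
  exact: (@compact_closed (R * R)%type (box M) (@norm_hausdorff R (R * R)%type) (@box_compact R M)).
move=> p /= u0; apply: contrapT => /notin_boxP /uM /eqP.
by rewrite (negbTE u0).
Qed.

Section Fluxes.
Variables (M : R) (a b : R * R -> R).
Hypotheses (sa : smooth a) (sb : smooth b) (ba : in_box M a) (bb : in_box M b).

Let ca : contf _ := smooth_continuous sa.
Let cb : contf _ := smooth_continuous sb.
Let cax : contf _ := smooth_continuous (smooth_partial false sa).
Let cay : contf _ := smooth_continuous (smooth_partial true sa).
Let cbx : contf _ := smooth_continuous (smooth_partial false sb).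
Let cby : contf _ := smooth_continuous (smooth_partial true sb).
Let caxx : contf _ := smooth_continuous (smooth_partial false (smooth_partial false sa)).
Let cayy : contf _ := smooth_continuous (smooth_partial true (smooth_partial true sa)).
Let cbxx : contf _ := smooth_continuous (smooth_partial false (smooth_partial false sb)).
Let cbyy : contf _ := smooth_continuous (smooth_partial true (smooth_partial true sb)).
Let caxy : contf _ := smooth_continuous (smooth_partial true (smooth_partial false sa)).
Let cbxy : contf _ := smooth_continuous (smooth_partial true (smooth_partial false sb)).
Let bax := in_box_partial false sa ba.
Let bay := in_box_partial true sa ba.
Let bbx := in_box_partial false sb bb.
Let bby := in_box_partial true sb bb.

(** The common shape of the integral identities of this section: the density is the divergence of
    explicit fluxes with bounded support. *)
Lemma divergence0 (F G dF dG H : R * R -> R) :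
  (forall p, is_derive p (dir false) F (dF p)) ->
  (forall p, is_derive p (dir true) G (dG p)) ->
  continuous dF -> continuous dG -> in_box M F -> in_box M G ->
  (forall p, H p = dF p + dG p) -> itg mu H /\ I2 H = 0.
Proof.
move=> FP GP cF cG bF bG /funext ->.
have iF : itg mu dF.
  by apply: (itg_in_box (M := M)) => // p pM; exact: in_box_derive bF pM (FP p).
have iG : itg mu dG.
  by apply: (itg_in_box (M := M)) => // p pM; exact: in_box_derive bG pM (GP p).
split; first exact: itgD.
by rewrite ID// (Rintegral_partial0 FP cF bF) (Rintegral_partial0 GP cG bG) addr0.
Qed.

(** The density is the imaginary part of [conj u * H0 u], the divergence of the magnetic probability
    current. Its vanishing integral expresses the symmetry of [H0]. *)
Lemma current_divergence :
  itg mu (fun p => a p * HI a b p - b p * HR a b p) /\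
  I2 (fun p => a p * HI a b p - b p * HR a b p) = 0.
Proof.
apply: (@divergence0
  (fun q => - (a q * dx b q - b q * dx a q) - q.2 * (a q ^+ 2 + b q ^+ 2))
  (fun q => - (a q * dy b q - b q * dy a q))
  (fun q => - (a q * dx (dx b) q - b q * dx (dx a) q)
            - 2 * q.2 * (a q * dx a q + b q * dx b q))
  (fun q => - (a q * dy (dy b) q - b q * dy (dy a) q))).
- move=> p.
  have da := smooth_is_derive false p sa; have db := smooth_is_derive false p sb.
  have dxa := smooth_is_derive false p (smooth_partial false sa).
  have dxb := smooth_is_derive false p (smooth_partial false sb).
  by apply: isd_eq; [deriv|rewrite /=; gen_partial; ring].
- move=> p.
  have da := smooth_is_derive true p sa; have db := smooth_is_derive true p sb.
  have dxa := smooth_is_derive true p (smooth_partial true sa).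
  have dxb := smooth_is_derive true p (smooth_partial true sb).
  by apply: isd_eq; [deriv|rewrite /=; gen_partial; ring].
- cont.
- cont.
- by move=> p pM; rewrite (ba pM) (bb pM); ring.
- by move=> p pM; rewrite (ba pM) (bb pM); ring.
- by move=> p; rewrite /HI /HR; gen_partial; ring.
Qed.

(** [A1 + i B1] is the magnetic derivative [(d/dx + i y) u] and [A2 + i B2] is [du/dy], so [grad2]
    is the kinetic energy density. *)
Definition A1 p := dx a p - p.2 * b p.
Definition B1 p := dx b p + p.2 * a p.
Definition A2 p := dy a p.
Definition B2 p := dy b p.
Definition grad2 p := A1 p ^+ 2 + B1 p ^+ 2 + A2 p ^+ 2 + B2 p ^+ 2.

(** The real part of [conj u * H0 u], multiplied by a weight and integrated by parts once. It
    compares kinetic energy, potential and the gradient of the weight. *)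
Lemma energy_divergence (W Wx Wy : R * R -> R) :
  (forall p, is_derive p (dir false) W (Wx p)) ->
  (forall p, is_derive p (dir true) W (Wy p)) ->
  contf W -> contf Wx -> contf Wy ->
  let H p := Wx p * (a p * A1 p + b p * B1 p) + Wy p * (a p * A2 p + b p * B2 p)
    + W p * grad2 p - W p * (a p * HR a b p + b p * HI a b p)
    + p.1 * W p * (a p ^+ 2 + b p ^+ 2) in
  itg mu H /\ I2 H = 0.
Proof.
move=> dWx dWy cW cWx cWy H.
apply: (@divergence0
  (fun q => W q * (a q * A1 q + b q * B1 q))
  (fun q => W q * (a q * A2 q + b q * B2 q))
  (fun q => Wx q * (a q * A1 q + b q * B1 q) + W q * (A1 q ^+ 2 + B1 q ^+ 2
     + a q * (dx (dx a) q - 2 * q.2 * dx b q - q.2 ^+ 2 * a q)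
     + b q * (dx (dx b) q + 2 * q.2 * dx a q - q.2 ^+ 2 * b q)))
  (fun q => Wy q * (a q * A2 q + b q * B2 q) + W q * (A2 q ^+ 2 + B2 q ^+ 2
     + a q * dy (dy a) q + b q * dy (dy b) q))).
- move=> p; have dW := dWx p.
  have da := smooth_is_derive false p sa; have db := smooth_is_derive false p sb.
  have dxa := smooth_is_derive false p (smooth_partial false sa).
  have dxb := smooth_is_derive false p (smooth_partial false sb).
  rewrite /A1 /B1.
  by apply: isd_eq; [deriv|rewrite /=; gen_partial; ring].
- move=> p; have dW := dWy p.
  have da := smooth_is_derive true p sa; have db := smooth_is_derive true p sb.
  have dxa := smooth_is_derive true p (smooth_partial true sa).
  have dxb := smooth_is_derive true p (smooth_partial true sb).
  rewrite /A2 /B2.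
  by apply: isd_eq; [deriv|rewrite /=; gen_partial; ring].
- by rewrite /A1 /B1; cont.
- by rewrite /A2 /B2; cont.
- by move=> p pM; rewrite (ba pM) (bb pM); ring.
- by move=> p pM; rewrite (ba pM) (bb pM); ring.
- by move=> p; rewrite /H /grad2 /HI /HR /A1 /A2 /B1 /B2; gen_partial; ring.
Qed.

Section Virial.
Variables (c1 c2 c1x c1y c2x c2y e ex ey : R * R -> R) (lam : R).
Hypotheses (c1xP : forall p, is_derive p (dir false) c1 (c1x p))
  (c1yP : forall p, is_derive p (dir true) c1 (c1y p))
  (c2xP : forall p, is_derive p (dir false) c2 (c2x p))
  (c2yP : forall p, is_derive p (dir true) c2 (c2y p))
  (exP : forall p, is_derive p (dir false) e (ex p))
  (eyP : forall p, is_derive p (dir true) e (ey p))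
  (eE : forall p, e p = c1x p + c2y p).
Hypotheses (cc1 : contf c1) (cc2 : contf c2) (cc1x : contf c1x)
  (cc1y : contf c1y) (cc2x : contf c2x) (cc2y : contf c2y)
  (ce : contf e) (cex : contf ex) (cey : contf ey).

Definition PR p := c1 p * A1 p + c2 p * A2 p + 2^-1 * e p * a p.
Definition PI p := c1 p * B1 p + c2 p * B2 p + 2^-1 * e p * b p.

(* The commutator of [H0] with the first-order operator [c . grad + div c / 2]. *)
Lemma virial_divergence :
  let H p := c1x p * (A1 p ^+ 2 + B1 p ^+ 2) + c2y p * (A2 p ^+ 2 + B2 p ^+ 2)
    + (c1y p + c2x p) * (A1 p * A2 p + B1 p * B2 p)
    - c2 p * (a p * B1 p - b p * A1 p) + c1 p * (a p * B2 p - b p * A2 p)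
    + 2^-1 * ex p * (a p * A1 p + b p * B1 p) + 2^-1 * ey p * (a p * A2 p + b p * B2 p)
    - 2^-1 * c1 p * (a p ^+ 2 + b p ^+ 2)
    - (PR p * (HR a b p - lam * a p) + PI p * (HI a b p - lam * b p)) in
  itg mu H /\ I2 H = 0.
Proof.
move=> H.
pose A11 q := dx (dx a) q - q.2 * dx b q.
pose B11 q := dx (dx b) q + q.2 * dx a q.
(* The term [- b q] comes from differentiating the coefficient [y]. It is the magnetic field:
   through it the two magnetic derivatives fail to commute, which creates the terms with
   undifferentiated [c1] and [c2] and one derivative of [u]. *)
pose A12 q := dy (dx a) q - b q - q.2 * dy b q.
pose B12 q := dy (dx b) q + a q + q.2 * dy a q.
pose A21 q := dy (dx a) q.
pose B21 q := dy (dx b) q.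
pose A22 q := dy (dy a) q.
pose B22 q := dy (dy b) q.
pose PRx q := c1x q * A1 q + c1 q * A11 q + c2x q * A2 q + c2 q * A21 q
  + 2^-1 * (ex q * a q + e q * dx a q).
pose PIx q := c1x q * B1 q + c1 q * B11 q + c2x q * B2 q + c2 q * B21 q
  + 2^-1 * (ex q * b q + e q * dx b q).
pose PRy q := c1y q * A1 q + c1 q * A12 q + c2y q * A2 q + c2 q * A22 q
  + 2^-1 * (ey q * a q + e q * dy a q).
pose PIy q := c1y q * B1 q + c1 q * B12 q + c2y q * B2 q + c2 q * B22 q
  + 2^-1 * (ey q * b q + e q * dy b q).
have dA1x p : is_derive p (dir false) A1 (A11 p).
  have db := smooth_is_derive false p sb.
  have dxa := smooth_is_derive false p (smooth_partial false sa).
  by rewrite /A1 /A11; apply: isd_eq; [deriv|rewrite /=; gen_partial; ring].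
have dA1y p : is_derive p (dir true) A1 (A12 p).
  have db := smooth_is_derive true p sb.
  have dxa := smooth_is_derive true p (smooth_partial false sa).
  by rewrite /A1 /A12; apply: isd_eq; [deriv|rewrite /=; gen_partial; ring].
have dB1x p : is_derive p (dir false) B1 (B11 p).
  have db := smooth_is_derive false p sa.
  have dxa := smooth_is_derive false p (smooth_partial false sb).
  by rewrite /B1 /B11; apply: isd_eq; [deriv|rewrite /=; gen_partial; ring].
have dB1y p : is_derive p (dir true) B1 (B12 p).
  have db := smooth_is_derive true p sa.
  have dxa := smooth_is_derive true p (smooth_partial false sb).
  by rewrite /B1 /B12; apply: isd_eq; [deriv|rewrite /=; gen_partial; ring].
have dA2x p : is_derive p (dir false) A2 (A21 p).
  by rewrite /A21 clairaut//; exact: smooth_is_derive (smooth_partial true sa).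
have dA2y p : is_derive p (dir true) A2 (A22 p).
  exact: smooth_is_derive (smooth_partial true sa).
have dB2x p : is_derive p (dir false) B2 (B21 p).
  by rewrite /B21 clairaut//; exact: smooth_is_derive (smooth_partial true sb).
have dB2y p : is_derive p (dir true) B2 (B22 p).
  exact: smooth_is_derive (smooth_partial true sb).
have dPRx p : is_derive p (dir false) PR (PRx p).
  have da := smooth_is_derive false p sa.
  have := (c1xP p, c2xP p, exP p, dA1x p, dA2x p) => -[[[[? ?] ?] ?] ?].
  by rewrite /PR /PRx; apply: isd_eq; [deriv|rewrite /=; gen_partial; ring].
have dPIx p : is_derive p (dir false) PI (PIx p).
  have da := smooth_is_derive false p sb.
  have := (c1xP p, c2xP p, exP p, dB1x p, dB2x p) => -[[[[? ?] ?] ?] ?].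
  by rewrite /PI /PIx; apply: isd_eq; [deriv|rewrite /=; gen_partial; ring].
have dPRy p : is_derive p (dir true) PR (PRy p).
  have da := smooth_is_derive true p sa.
  have := (c1yP p, c2yP p, eyP p, dA1y p, dA2y p) => -[[[[? ?] ?] ?] ?].
  by rewrite /PR /PRy; apply: isd_eq; [deriv|rewrite /=; gen_partial; ring].
have dPIy p : is_derive p (dir true) PI (PIy p).
  have da := smooth_is_derive true p sb.
  have := (c1yP p, c2yP p, eyP p, dB1y p, dB2y p) => -[[[[? ?] ?] ?] ?].
  by rewrite /PI /PIy; apply: isd_eq; [deriv|rewrite /=; gen_partial; ring].
have cA1 : contf A1 by rewrite /A1; cont_rec.
have cB1 : contf B1 by rewrite /B1; cont_rec.
have cA2 : contf A2 := cay.
have cB2 : contf B2 := cby.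
have cPR : contf PR by rewrite /PR; cont_rec.
have cPI : contf PI by rewrite /PI; cont_rec.
have cA11 : contf A11 by rewrite /A11; cont_rec.
have cB11 : contf B11 by rewrite /B11; cont_rec.
have cA12 : contf A12 by rewrite /A12; cont_rec.
have cB12 : contf B12 by rewrite /B12; cont_rec.
have cA21 : contf A21 := caxy.
have cB21 : contf B21 := cbxy.
have cA22 : contf A22 := cayy.
have cB22 : contf B22 := cbyy.
have cPRx : contf PRx by rewrite /PRx; cont_rec.
have cPIx : contf PIx by rewrite /PIx; cont_rec.
have cPRy : contf PRy by rewrite /PRy; cont_rec.
have cPIy : contf PIy by rewrite /PIy; cont_rec.
pose n q := a q ^+ 2 + b q ^+ 2.
pose g q := A1 q ^+ 2 + B1 q ^+ 2 + A2 q ^+ 2 + B2 q ^+ 2.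
(* The fluxes are the stress tensor of the equation contracted with the field [c], completed by the
   divergence term of the multiplier [PR + i PI]. *)
apply: (@divergence0
  (fun q => PR q * A1 q + PI q * B1 q - 2^-1 * c1 q * g q - 2^-1 * (q.1 - lam) * c1 q * n q)
  (fun q => PR q * A2 q + PI q * B2 q - 2^-1 * c2 q * g q - 2^-1 * (q.1 - lam) * c2 q * n q)
  (fun q => PRx q * A1 q + PR q * A11 q + PIx q * B1 q + PI q * B11 q
     - 2^-1 * c1x q * g q
     - c1 q * (A1 q * A11 q + B1 q * B11 q + A2 q * A21 q + B2 q * B21 q)
     - 2^-1 * c1 q * n q - 2^-1 * (q.1 - lam) * c1x q * n q
     - (q.1 - lam) * c1 q * (a q * dx a q + b q * dx b q))
  (fun q => PRy q * A2 q + PR q * A22 q + PIy q * B2 q + PI q * B22 q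
     - 2^-1 * c2y q * g q
     - c2 q * (A1 q * A12 q + B1 q * B12 q + A2 q * A22 q + B2 q * B22 q)
     - 2^-1 * (q.1 - lam) * c2y q * n q
     - (q.1 - lam) * c2 q * (a q * dy a q + b q * dy b q))).
- move=> p; have da := smooth_is_derive false p sa; have db := smooth_is_derive false p sb.
  have := (c1xP p, dA1x p, dA2x p, dB1x p, dB2x p, dPRx p, dPIx p) => -[[[[[[? ?] ?] ?] ?] ?] ?].
  by rewrite /g /n; apply: isd_eq; [deriv|rewrite /=; gen_partial; field].
- move=> p; have da := smooth_is_derive true p sa; have db := smooth_is_derive true p sb.
  have := (c2yP p, dA1y p, dA2y p, dB1y p, dB2y p, dPRy p, dPIy p) => -[[[[[[? ?] ?] ?] ?] ?] ?].
  by rewrite /g /n; apply: isd_eq; [deriv|rewrite /=; gen_partial; field].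
- by rewrite /g /n; cont.
- by rewrite /g /n; cont.
- move=> p pM; rewrite /g /n /PR /PI /A1 /B1 /A2 /B2.
  by rewrite (ba pM) (bb pM) (bax pM) (bay pM) (bbx pM) (bby pM); ring.
- move=> p pM; rewrite /g /n /PR /PI /A1 /B1 /A2 /B2.
  by rewrite (ba pM) (bb pM) (bax pM) (bay pM) (bbx pM) (bby pM); ring.
- move=> p; rewrite /H /g /n /PRx /PIx /PRy /PIy /PR /PI /A11 /B11 /A12 /B12 /A21 /B21 /A22 /B22.
  rewrite /HR /HI /A1 /B1 /A2 /B2 !eE.
  by gen_partial; field.
Qed.

End Virial.
End Fluxes.
End Hamiltonian.

(** * The weighted estimate at a single point *)

Section PointwiseInequality.
Context {R : realFieldType}.
Implicit Types u v s r c X : R.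

Lemma young u v s r : 0 < r -> s * r = 1 -> `|u * v| <= 2^-1 * (s * u ^+ 2 + r * v ^+ 2).
Proof.
move=> r0 sr; have h1 := mulr_ge0 (ltW r0) (sqr_ge0 (s * u - v)).
have h2 := mulr_ge0 (ltW r0) (sqr_ge0 (s * u + v)).
have e1 : r * (s * u - v) ^+ 2 = (s * r) * s * u ^+ 2 - 2 * (s * r) * (u * v) + r * v ^+ 2 by ring.
have e2 : r * (s * u + v) ^+ 2 = (s * r) * s * u ^+ 2 + 2 * (s * r) * (u * v) + r * v ^+ 2 by ring.
rewrite e1 in h1; rewrite e2 in h2; rewrite sr in h1 h2.
by rewrite ler_norml; apply/andP; split; lra.
Qed.

Lemma young2 u v u' v' s r : 0 < r -> s * r = 1 ->
  `|u * v + u' * v'| <= 2^-1 * (s * (u ^+ 2 + u' ^+ 2) + r * (v ^+ 2 + v' ^+ 2)).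
Proof.
move=> r0 sr; apply: (le_trans (ler_normD _ _)).
by have := young u v r0 sr; have := young u' v' r0 sr; lra.
Qed.

Lemma norm_mul_le u v c X : `|u| <= c -> `|v| <= X -> `|u * v| <= c * X.
Proof. by move=> uc vX; rewrite normrM; apply: ler_pM. Qed.

Let W_energy_arith (n1 n2 n3 n4 W N K1 K2 h k : R) :
  0 <= N -> n1 <= 2 * W * (2^-1 * (1 * N + 1 * K1)) ->
  n2 <= W * (2^-1 * (1 * N + 1 * K2)) -> n3 <= 1 * (2^-1 * N + (h + k)) -> n4 <= N ->
  W * N <= N -> 0 <= W * K2 ->
  n1 + n2 + W * (K1 + K2) + n3 + n4 <= 2 * (W * (K1 + K2)) + 4 * N + h + k.
Proof. by lra. Qed.

Variables (a b A1 B1 A2 B2 hr hi h1 h2 k1 k2 lam nu mu s r sg : R).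
Variables (x psi psi1 W Wx Wy w : R).
Variables (c1 c2 c1x c2x c2y e ex ey : R).
Let N := a ^+ 2 + b ^+ 2.
Let K1 := A1 ^+ 2 + B1 ^+ 2.
Let K2 := A2 ^+ 2 + B2 ^+ 2.
Let h := h1 ^+ 2 + h2 ^+ 2.
Let k := k1 ^+ 2 + k2 ^+ 2.
Hypotheses (s1 : 1 <= s) (smu : s ^+ 2 = mu) (sr : s * r = 1) (lamE : lam = sg * mu)
  (sg2 : `|sg| = 1) (nu0 : 0 <= nu <= 1).
Hypotheses (fr : hr - lam * a + nu * b = w * h1 + k1) (fi : hi - lam * b - nu * a = w * h2 + k2).
Hypotheses (psi01 : 0 <= psi <= 1) (psix : `|x| * psi <= mu) (psi1b : `|psi1| <= psi).
Hypotheses (w01 : 0 <= w <= 1) (WE : W = psi * w ^+ 2) (Wxb : `|Wx| <= 2 * W) (Wyb : `|Wy| <= W)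
  (xW : `|x| * W <= 1) (Wmu : mu * w ^+ 2 <= mu * W + 1).
Hypotheses (c1b : `|c1| <= 2 * psi) (c2b : `|c2| <= 2 * psi) (eb : `|e| <= 4 * psi)
  (exb : `|ex| <= 17 * psi) (eyb : `|ey| <= psi)
  (c1xb : W - 2 * (psi * r) <= c1x) (c2yb : W <= c2y) (c2xb : `|c2x| <= 2 * (psi * r)).

(** Every function is frozen at one point, which leaves an inequality between real numbers. Here
    [psi] is the cutoff, [w] stands for [<r>^-1], [W = psi w^2], [s = sqrt mu = 1 / r], and
    [w h + k] is the value of [(H0 - lam - i nu) u]. The literal [0] is the y-derivative of [c1]. *)
Definition virial_density :=
  c1x * (A1 ^+ 2 + B1 ^+ 2) + c2y * (A2 ^+ 2 + B2 ^+ 2) + (0 + c2x) * (A1 * A2 + B1 * B2)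
  - c2 * (a * B1 - b * A1) + c1 * (a * B2 - b * A2)
  + 2^-1 * ex * (a * A1 + b * B1) + 2^-1 * ey * (a * A2 + b * B2)
  - 2^-1 * c1 * (a ^+ 2 + b ^+ 2)
  - ((c1 * A1 + c2 * A2 + 2^-1 * e * a) * (hr - lam * a)
     + (c1 * B1 + c2 * B2 + 2^-1 * e * b) * (hi - lam * b)).

Definition energy_density V Vx Vy :=
  Vx * (a * A1 + b * B1) + Vy * (a * A2 + b * B2)
  + V * (A1 ^+ 2 + B1 ^+ 2 + A2 ^+ 2 + B2 ^+ 2) - V * (a * hr + b * hi)
  + x * V * (a ^+ 2 + b ^+ 2).

Let r0 : 0 < r. Proof.
have h' : 0 < s * r by rewrite sr.
by move: h'; rewrite pmulr_rgt0//; exact: lt_le_trans s1.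
Qed.
Let r1 : r <= 1.
Proof. by have := ler_wpM2l (ltW r0) s1; rewrite mulr1 mulrC sr. Qed.
Let N0 : 0 <= N. Proof. by rewrite /N; ge0. Qed.
Let K10 : 0 <= K1. Proof. by rewrite /K1; ge0. Qed.
Let K20 : 0 <= K2. Proof. by rewrite /K2; ge0. Qed.
Let h0 : 0 <= h. Proof. by rewrite /h; ge0. Qed.
Let k0 : 0 <= k. Proof. by rewrite /k; ge0. Qed.
Let rs : r * s = 1. Proof. by rewrite mulrC. Qed.
Let s0 : 0 < s. Proof. exact: lt_le_trans ltr01 s1. Qed.
Let W01 : 0 <= W <= 1.
Proof.
move: psi01 w01; rewrite WE => /andP[p0 p1] /andP[w0 w1]; apply/andP; split; first by ge0.
by apply: mulr_ile1 => //; [ge0|rewrite expr_le1].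
Qed.

Let J1 : `|a * B1 - b * A1| <= 2^-1 * (s * N + r * K1).
Proof.
have := young2 a B1 b (- A1) r0 sr; rewrite mulrN sqrrN => H.
by rewrite /N /K1 [A1 ^+ 2 + _]addrC.
Qed.
Let J2 : `|a * B2 - b * A2| <= 2^-1 * (s * N + r * K2).
Proof.
have := young2 a B2 b (- A2) r0 sr; rewrite mulrN sqrrN => H.
by rewrite /N /K2 [A2 ^+ 2 + _]addrC.
Qed.
Let R1 : `|a * A1 + b * B1| <= 2^-1 * (s * N + r * K1).
Proof. exact: young2. Qed.
Let R2 : `|a * A2 + b * B2| <= 2^-1 * (s * N + r * K2).
Proof. exact: young2. Qed.
Let psiN : psi * (s * N) <= s * N.
Proof. by rewrite ler_piMl//; [rewrite mulr_ge0// ltW|case/andP: psi01]. Qed.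
Let sNN : N <= s * N.
Proof. by rewrite ler_peMl. Qed.
Let psik : psi * (s * k) <= s * k.
Proof. by rewrite ler_piMl//; [rewrite mulr_ge0// ltW|case/andP: psi01]. Qed.
Let skk : k <= s * k.
Proof. by rewrite ler_peMl. Qed.
Let psiN1 : psi * N <= N.
Proof. by rewrite ler_piMl//; case/andP: psi01. Qed.
Let psik1 : psi * k <= k.
Proof. by rewrite ler_piMl//; case/andP: psi01. Qed.
Let psih1 : psi * h <= h.
Proof. by rewrite ler_piMl//; case/andP: psi01. Qed.

Ltac bnd H := move: H; rewrite ler_norml => /andP[].

(** The diagonal derivatives of the field are at least [W], up to [psi r], so the commutator is
    positive modulo [psi r] times the kinetic density. First order errors are split by Young with
    weights [s] and [r]. A quarter of the main term is spent on the pairing of [w h] with the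
    multiplier, which leaves [3 / 4]. *)
Lemma virial_bound : 3 / 4 * (W * (K1 + K2)) <=
  virial_density + 11 * (psi * r * (K1 + K2)) + 17 * (s * N) + 3 * (s * k) + 9 * h.
Proof.
have T2 : `|c2x * (A1 * A2 + B1 * B2)| <= psi * r * (K1 + K2).
  apply: (le_trans (norm_mul_le c2xb (young2 A1 A2 B1 B2 (s := 1) ltr01 (mulr1 1)))).
  by rewrite -/K1 -/K2 !mul1r; lra.
have T3a := norm_mul_le c2b J1.
have T3b := norm_mul_le c1b J2.
have T4a := norm_mul_le exb R1.
have T4b := norm_mul_le eyb R2.
have T5 : c1 * N <= 2 * (psi * N).
  have := norm_mul_le c1b (lexx `|N|); rewrite (ger0_norm N0) -mulrA.
  by apply: le_trans; exact: ler_norm.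
have T1a : (W - 2 * (psi * r)) * K1 <= c1x * K1 by rewrite ler_wpM2r.
have T1b : W * K2 <= c2y * K2 by rewrite ler_wpM2r.
have T6a := norm_mul_le c1b J1.
have T6b := norm_mul_le c2b J2.
have T7a := norm_mul_le c1b (young2 k1 A1 k2 B1 r0 sr).
have T7b := norm_mul_le c2b (young2 k1 A2 k2 B2 r0 sr).
have T7c := norm_mul_le eb (young2 k1 a k2 b (s := 1) ltr01 (mulr1 1)).
have h4 : (0 : R) < 4^-1 by lra.
have h44 : 4 * 4^-1 = 1 :> R by lra.
have T8a := norm_mul_le c1b (young2 h1 (w * A1) h2 (w * B1) h4 h44).
have T8b := norm_mul_le c2b (young2 h1 (w * A2) h2 (w * B2) h4 h44).
have T8c := norm_mul_le eb (young2 h1 (w * a) h2 (w * b) (s := 1) ltr01 (mulr1 1)).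
have wN : psi * (w ^+ 2 * N) <= N.
  move/andP: psi01 => [p0 p1]; move/andP: w01 => [w0 w1].
  have : w ^+ 2 * N <= N by rewrite ler_piMl// expr_le1.
  by have : 0 <= w ^+ 2 * N; [ge0|nra].
have T9 : `|nu * (c1 * (a * B1 - b * A1) + c2 * (a * B2 - b * A2))| <=
   psi * (2 * (s * N) + r * (K1 + K2)).
  apply: (@le_trans _ _ (1 * (2 * psi * (2^-1 * (s * N + r * K1)) + 2 * psi * (2^-1 * (s * N + r * K2))))).
    apply: norm_mul_le; first by rewrite ger0_norm; case/andP: nu0.
    by apply: (le_trans (ler_normD _ _)); apply: lerD.
  by rewrite mul1r; lra.
have E : virial_density =
  c1x * K1 + c2y * K2 + c2x * (A1 * A2 + B1 * B2)
  - c2 * (a * B1 - b * A1) + c1 * (a * B2 - b * A2)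
  + 2^-1 * (ex * (a * A1 + b * B1)) + 2^-1 * (ey * (a * A2 + b * B2))
  - 2^-1 * (c1 * N)
  - (c1 * (k1 * A1 + k2 * B1) + c2 * (k1 * A2 + k2 * B2) + 2^-1 * (e * (k1 * a + k2 * b))
    + c1 * (h1 * (w * A1) + h2 * (w * B1)) + c2 * (h1 * (w * A2) + h2 * (w * B2))
    + 2^-1 * (e * (h1 * (w * a) + h2 * (w * b)))
    + nu * (c1 * (a * B1 - b * A1) + c2 * (a * B2 - b * A2))).
  have fr' : hr - lam * a = w * h1 + k1 - nu * b by rewrite -fr; ring.
  have fi' : hi - lam * b = w * h2 + k2 + nu * a by rewrite -fi; ring.
  rewrite /virial_density fr' fi' /K1 /K2 /N; ring.
have EA1 : (w * A1) ^+ 2 + (w * B1) ^+ 2 = w ^+ 2 * K1 by rewrite /K1; ring.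
have EA2 : (w * A2) ^+ 2 + (w * B2) ^+ 2 = w ^+ 2 * K2 by rewrite /K2; ring.
have Ea : (w * a) ^+ 2 + (w * b) ^+ 2 = w ^+ 2 * N by rewrite /N; ring.
rewrite EA1 -/h in T8a; rewrite EA2 -/h in T8b; rewrite Ea -/h in T8c.
rewrite -/K1 -/k in T7a; rewrite -/K2 -/k in T7b; rewrite -/N -/k in T7c.
have WK1 : psi * (w ^+ 2 * K1) = W * K1 by rewrite WE mulrA.
have WK2 : psi * (w ^+ 2 * K2) = W * K2 by rewrite WE mulrA.
rewrite E.
bnd T2; bnd T3a; bnd T3b; bnd T4a; bnd T4b; bnd T7a; bnd T7b; bnd T7c; bnd T8a; bnd T8b; bnd T8c; bnd T9.
have q1 : 0 <= psi * (r * K1) by have := psi01; case/andP => ? _; ge0.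
have q2 : 0 <= psi * (r * K2) by have := psi01; case/andP => ? _; ge0.
move: WK1 WK2 wN q1 q2 T5 T1a T1b psiN psik psiN1 psik1 psih1 sNN skk h0 k0 N0.
move: (c1x * K1) (c2y * K2) (c2x * (_ + _)) (c2 * (a * B1 - b * A1)) (c1 * (a * B2 - b * A2))
  (ex * _) (ey * _) (c1 * N) (c1 * (k1 * A1 + _)) (c2 * (k1 * A2 + _)) (e * (k1 * a + _))
  (c1 * (h1 * _ + _)) (c2 * (h1 * _ + _)) (e * (h1 * _ + _)) (nu * (_ + _)).
clearbody N K1 K2 h k => *.
lra.
Qed.

(** Under the cutoff [|lam - x| psi <= 2 mu], so the energy identity bounds the kinetic energy there
    by order [mu |u|^2]; multiplied by [r = 1 / sqrt mu] it costs no more than [s |u|^2]. *)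
Lemma psi_energy_bound : 3 / 4 * (psi * r * (K1 + K2)) <=
  r * energy_density psi psi1 0 + 4 * (s * N) + h + s * k.
Proof.
have T1 : `|psi1 * (a * A1 + b * B1)| <= psi * (2^-1 * (2 * N + 2^-1 * K1)).
  apply: norm_mul_le => //; apply: young2; lra.
have af : `|a * (w * h1 + k1) + b * (w * h2 + k2)| <= 2^-1 * N + (h + k).
  apply: (le_trans (young2 a (w * h1 + k1) b (w * h2 + k2) (s := 1) ltr01 (mulr1 1))).
  have q u v : (w * u + v) ^+ 2 <= 2 * u ^+ 2 + 2 * v ^+ 2.
    have w2 : w ^+ 2 * u ^+ 2 <= u ^+ 2.
      by rewrite ler_piMl ?sqr_ge0// expr_le1//; case/andP: w01.
    have := sqr_ge0 (w * u - v).
    have -> : (w * u - v) ^+ 2 = w ^+ 2 * u ^+ 2 - 2 * (w * u * v) + v ^+ 2 by ring.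
    have -> : (w * u + v) ^+ 2 = w ^+ 2 * u ^+ 2 + 2 * (w * u * v) + v ^+ 2 by ring.
    lra.
  by have := q h1 k1; have := q h2 k2; rewrite /N /h /k !mul1r; lra.
have T2 : `|psi * (a * (w * h1 + k1) + b * (w * h2 + k2))| <= 1 * (2^-1 * N + (h + k)).
  by apply: norm_mul_le => //; rewrite ger0_norm; case/andP: psi01.
have T3 : `|(lam - x) * psi * N| <= 2 * mu * N.
  rewrite normrM (ger0_norm N0); apply: ler_wpM2r => //.
  rewrite mulrBl; apply: (le_trans (ler_normB _ _)).
  have p0 : `|psi| = psi by rewrite ger0_norm; case/andP: psi01.
  rewrite !normrM p0 lamE normrM sg2 mul1r.
  have mu0 : 0 <= mu by rewrite -smu; ge0.
  rewrite (ger0_norm mu0).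
  have : mu * psi <= mu by rewrite ler_piMr//; case/andP: psi01.
  by move: psix; lra.
have E : energy_density psi psi1 0 = psi1 * (a * A1 + b * B1) + psi * (K1 + K2)
   - psi * (a * (w * h1 + k1) + b * (w * h2 + k2)) - (lam - x) * psi * N.
  have fr' : hr = w * h1 + k1 - nu * b + lam * a by rewrite -fr; ring.
  have fi' : hi = w * h2 + k2 + nu * a + lam * b by rewrite -fi; ring.
  rewrite /energy_density fr' fi' /K1 /K2 /N; ring.
have main : 3 / 4 * (psi * (K1 + K2)) <= energy_density psi psi1 0 + (3 / 2 + 2 * mu) * N + h + k.
  have : 0 <= psi * K2 by rewrite mulr_ge0//; case/andP: psi01.
  bnd T1; bnd T2; bnd T3; rewrite E.
  have : 0 <= psi * K1 by rewrite mulr_ge0//; case/andP: psi01.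
  move: psiN1 N0 h0 k0.
  move: ((lam - x) * psi * N) (psi1 * _) (psi * (a * _ + _)); clearbody N K1 K2 h k => *; lra.
have := ler_wpM2l (ltW r0) main.
have e1 : r * (energy_density psi psi1 0 + (3 / 2 + 2 * mu) * N + h + k) =
  r * energy_density psi psi1 0 + r * (3 / 2 * N + h + k) + 2 * (s * r) * (s * N).
  by rewrite -smu; ring.
have e2 : r * (3 / 2 * N + h + k) <= 3 / 2 * N + h + k.
  by rewrite ler_piMl//; apply: addr_ge0 => //; apply: addr_ge0 => //; apply: mulr_ge0 => //; lra.
rewrite e1 sr => H.
move: H e2 sNN skk N0; move: (energy_density _ _ _); clearbody N K1 K2 h k => *; lra.
Qed.

(** Multiplying the energy identity of weight [W] by the sign of [lam] isolates [mu W |u|^2]; all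
    other terms are estimated in absolute value. Going from [W] back to [w^2] costs one [|u|^2], by
    [Wmu]. *)
Lemma W_energy_bound : mu * w ^+ 2 * N <=
  2 * (W * (K1 + K2)) + 5 * N + h + k - sg * energy_density W Wx Wy.
Proof.
have T1 := norm_mul_le Wxb (young2 a A1 b B1 (s := 1) ltr01 (mulr1 1)).
have T2 := norm_mul_le Wyb (young2 a A2 b B2 (s := 1) ltr01 (mulr1 1)).
have af : `|a * (w * h1 + k1) + b * (w * h2 + k2)| <= 2^-1 * N + (h + k).
  apply: (le_trans (young2 a (w * h1 + k1) b (w * h2 + k2) (s := 1) ltr01 (mulr1 1))).
  have q u v : (w * u + v) ^+ 2 <= 2 * u ^+ 2 + 2 * v ^+ 2.
    have w2 : w ^+ 2 * u ^+ 2 <= u ^+ 2.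
      by rewrite ler_piMl ?sqr_ge0// expr_le1//; case/andP: w01.
    have := sqr_ge0 (w * u - v).
    have -> : (w * u - v) ^+ 2 = w ^+ 2 * u ^+ 2 - 2 * (w * u * v) + v ^+ 2 by ring.
    have -> : (w * u + v) ^+ 2 = w ^+ 2 * u ^+ 2 + 2 * (w * u * v) + v ^+ 2 by ring.
    lra.
  by have := q h1 k1; have := q h2 k2; rewrite /N /h /k !mul1r; lra.
have T3 : `|W * (a * (w * h1 + k1) + b * (w * h2 + k2))| <= 1 * (2^-1 * N + (h + k)).
  by apply: norm_mul_le => //; rewrite ger0_norm; case/andP: W01.
have T4 : `|x * W * N| <= N.
  have W0 : `|W| = W by rewrite ger0_norm; case/andP: W01.
  by rewrite !normrM W0 (ger0_norm N0) ler_piMl.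
have E : energy_density W Wx Wy = Wx * (a * A1 + b * B1) + Wy * (a * A2 + b * B2) + W * (K1 + K2)
   - W * (a * (w * h1 + k1) + b * (w * h2 + k2)) - lam * W * N + x * W * N.
  have fr' : hr = w * h1 + k1 - nu * b + lam * a by rewrite -fr; ring.
  have fi' : hi = w * h2 + k2 + nu * a + lam * b by rewrite -fi; ring.
  rewrite /energy_density fr' fi' /K1 /K2 /N; ring.
have sgsg : sg * sg = 1 by rewrite -expr2 -(real_normK (num_real sg)) sg2 expr1n.
pose X := Wx * (a * A1 + b * B1) + Wy * (a * A2 + b * B2) + W * (K1 + K2)
   - W * (a * (w * h1 + k1) + b * (w * h2 + k2)) + x * W * N.
have E2 : mu * W * N = sg * X - sg * energy_density W Wx Wy.
  rewrite E lamE; have -> : mu * W * N = (sg * sg) * mu * W * N by rewrite sgsg mul1r.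
  rewrite /X; ring.
have Xb : `|sg * X| <= 2 * (W * (K1 + K2)) + 4 * N + h + k.
  rewrite normrM sg2 mul1r /X.
  have WK0 : `|W * (K1 + K2)| = W * (K1 + K2).
    by rewrite ger0_norm//; apply: mulr_ge0; [case/andP: W01|exact: addr_ge0].
  apply: (le_trans (ler_normD _ _)); apply: (le_trans (lerD (ler_normB _ _) (lexx _))).
  apply: (le_trans (lerD (lerD (ler_normD _ _) (lexx _)) (lexx _))).
  apply: (le_trans (lerD (lerD (lerD (ler_normD _ _) (lexx _)) (lexx _)) (lexx _))).
  have WN : W * N <= N by rewrite ler_piMl//; case/andP: W01.
  have q2 : 0 <= W * K2 by rewrite mulr_ge0//; case/andP: W01.
  rewrite WK0; rewrite -/N -/K1 in T1; rewrite -/N -/K2 in T2.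
  move: T1 T2 T3 T4 WN q2.
  exact: W_energy_arith.
have := ler_wpM2r N0 Wmu; move: Xb E2; rewrite ler_norml => /andP[_].
move: (sg * X) (sg * energy_density W Wx Wy); clearbody N K1 K2 h k => *; lra.
Qed.

(** A linear combination in which the kinetic terms cancel: [8 / 3 = 2 * 4 / 3] pays for the [2 W]
    times kinetic density of [W_energy_bound], and [352 / 9 = 8 / 3 * 11 * 4 / 3] removes the
    [psi r] term that [virial_bound] introduces. The number [300] only has to exceed the resulting
    coefficients. *)
Lemma smoothing_pointwise : mu * w ^+ 2 * N <=
  300 * (s * N + s * k + h) + 8 / 3 * virial_density
  + 352 / 9 * (r * energy_density psi psi1 0) - sg * energy_density W Wx Wy.
Proof.
have := virial_bound; have := psi_energy_bound; have := W_energy_bound.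
move: sNN skk h0 k0 N0.
have := mulr_ge0 (ltW s0) N0; have := mulr_ge0 (ltW s0) k0.
move: virial_density (energy_density W Wx Wy) (energy_density psi psi1 0) => V EW Ep.
move: (mu * w ^+ 2 * N) (W * (K1 + K2)) (psi * r * (K1 + K2)) (s * N) (s * k) (r * Ep) (sg * EW).
clearbody N K1 K2 h k => *; lra.
Qed.

End PointwiseInequality.

Section InverseRules.
Context {R : realType}.
Implicit Types (f : R * R -> R).

Lemma dV p v f a : f p != 0 -> isd p v f a -> isd p v (fun q => (f q)^-1) (- (f p)^-1 ^+ 2 * a).
Proof.
move=> f0 fa; apply: (dcomp (h := fun z => z^-1)) fa.
have := is_deriveV (f := id) (x := f p) (v := 1 : R) f0 (is_derive_id _ _).
by apply: is_derive_eqf => //; rewrite exprVn [_ *: _]mulr1.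
Qed.

Lemma contV f : (forall q, f q != 0) -> contf f -> contf (fun q => (f q)^-1).
Proof. by move=> f0 cf q; apply: cvgV => //; exact: cf. Qed.

Lemma datan p v f a : isd p v f a -> isd p v (fun q => atan (f q)) ((1 + f p ^+ 2)^-1 * a).
Proof. by move=> fa; apply: (dcomp (h := atan)) fa; exact: is_derive1_atan. Qed.

Lemma norm_atan_le2 (x : R) : `|atan x| <= 2.
Proof.
have h : pi / 2 <= 2 :> R by apply: ltW; exact: pihalf_lt2.
have := atan_ltpi2 x; have := atan_gtNpi2 x; rewrite ler_norml.
by move: (atan x) (pi / 2) h => A B h h1 h2; apply/andP; split; lra.
Qed.

End InverseRules.

(** * The weights of the virial estimate *)

Section Weights.
Context {R : realType}.
Variables (mu s r eps : R).
Hypotheses (s1 : 1 <= s) (smu : s ^+ 2 = mu) (sr : s * r = 1) (mueps : mu * eps = 1).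
Local Notation cst c := (fun _ : R * R => c).

(** With [eps = 1 / mu], a cutoff to [|x|] of order [mu]. It is rational rather than compactly
    supported, so that its derivatives are bounded by multiples of [cut] itself. *)
Definition cut (p : R * R) := (1 + (eps * p.1) ^+ 2)^-1.
Definition cut1 (p : R * R) := - 2 * eps ^+ 2 * p.1 * cut p ^+ 2.
Definition cut2 (p : R * R) := - 2 * eps ^+ 2 * cut p ^+ 2 + 8 * eps ^+ 4 * p.1 ^+ 2 * cut p ^+ 3.
(** This is [<r>^-2], rational in the coordinates, so that no square root has to be
    differentiated. *)
Definition w2 (p : R * R) := (1 + (p.1 ^+ 2 + p.2 ^+ 2))^-1.
Definition w2x (p : R * R) := - 2 * p.1 * w2 p ^+ 2.
Definition w2y (p : R * R) := - 2 * p.2 * w2 p ^+ 2.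
Definition gX (p : R * R) := (1 + p.1 ^+ 2)^-1.
Definition gY (p : R * R) := (1 + p.2 ^+ 2)^-1.
Definition gX1 (p : R * R) := - 2 * p.1 * gX p ^+ 2.
Definition gY1 (p : R * R) := - 2 * p.2 * gY p ^+ 2.

Let d1 (t : R) : 1 + t ^+ 2 != 0.
Proof. by rewrite gt_eqF// ltr_pwDl// sqr_ge0. Qed.
Let d2 (p : R * R) : 1 + (p.1 ^+ 2 + p.2 ^+ 2) != 0.
Proof. by rewrite gt_eqF// ltr_pwDl// addr_ge0// sqr_ge0. Qed.

Lemma cut_dx p : is_derive p (dir false) cut (cut1 p).
Proof.
apply: isd_eq; first by apply: dV; [exact: d1|deriv].
by rewrite /cut1 -/(cut p) /=; ring.
Qed.

Lemma cut_dy p : is_derive p (dir true) cut 0.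
Proof.
apply: isd_eq; first by apply: dV; [exact: d1|deriv].
by rewrite /=; ring.
Qed.

Lemma cut1_dx p : is_derive p (dir false) cut1 (cut2 p).
Proof.
have := cut_dx p => dcut; apply: isd_eq; first by rewrite /cut1; deriv.
by rewrite /cut2 {1}/cut1 /=; ring.
Qed.

Lemma cut1_dy p : is_derive p (dir true) cut1 0.
Proof.
have := cut_dy p => dcut; apply: isd_eq; first by rewrite /cut1; deriv.
by rewrite /=; ring.
Qed.

Lemma w2_dx p : is_derive p (dir false) w2 (w2x p).
Proof.
apply: isd_eq; first by apply: dV; [exact: d2|deriv].
by rewrite /w2x -/(w2 p) /=; ring.
Qed.

Lemma w2_dy p : is_derive p (dir true) w2 (w2y p).
Proof.
apply: isd_eq; first by apply: dV; [exact: d2|deriv].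
by rewrite /w2y -/(w2 p) /=; ring.
Qed.

Lemma gX_dx p : is_derive p (dir false) gX (gX1 p).
Proof.
apply: isd_eq; first by apply: dV; [exact: d1|deriv].
by rewrite /gX1 -/(gX p) /=; ring.
Qed.

Lemma gX_dy p : is_derive p (dir true) gX 0.
Proof.
apply: isd_eq; first by apply: dV; [exact: d1|deriv].
by rewrite /=; ring.
Qed.

Lemma gY_dx p : is_derive p (dir false) gY 0.
Proof.
apply: isd_eq; first by apply: dV; [exact: d1|deriv].
by rewrite /=; ring.
Qed.

Lemma gY_dy p : is_derive p (dir true) gY (gY1 p).
Proof.
apply: isd_eq; first by apply: dV; [exact: d1|deriv].
by rewrite /gY1 -/(gY p) /=; ring.
Qed.

Definition aX (p : R * R) := atan p.1.
Definition aY (p : R * R) := atan p.2.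

Lemma aX_dx p : is_derive p (dir false) aX (gX p).
Proof. by apply: isd_eq; [apply: datan; exact: dfst|rewrite /gX /= mulr1]. Qed.
Lemma aX_dy p : is_derive p (dir true) aX 0.
Proof. by apply: isd_eq; [apply: datan; exact: dfst|rewrite /= mulr0]. Qed.
Lemma aY_dx p : is_derive p (dir false) aY 0.
Proof. by apply: isd_eq; [apply: datan; exact: dsnd|rewrite /= mulr0]. Qed.
Lemma aY_dy p : is_derive p (dir true) aY (gY p).
Proof. by apply: isd_eq; [apply: datan; exact: dsnd|rewrite /gY /= mulr1]. Qed.

Lemma ccut : contf cut.
Proof. by apply: contV => [q|]; [exact: d1|cont_rec]. Qed.
Lemma cw2 : contf w2.
Proof. by apply: contV => [q|]; [exact: d2|cont_rec]. Qed.
Lemma cgX : contf gX.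
Proof. by apply: contV => [q|]; [exact: d1|cont_rec]. Qed.
Lemma cgY : contf gY.
Proof. by apply: contV => [q|]; [exact: d1|cont_rec]. Qed.
Lemma caX : contf aX.
Proof. by apply: contcomp; [exact: continuous_atan|exact: contfst]. Qed.
Lemma caY : contf aY.
Proof. by apply: contcomp; [exact: continuous_atan|exact: contsnd]. Qed.
Lemma ccut1 : contf cut1.
Proof. by have := ccut => ?; rewrite /cut1; cont_rec. Qed.
Lemma ccut2 : contf cut2.
Proof. by have := ccut => ?; rewrite /cut2; cont_rec. Qed.

Definition Wt (p : R * R) := cut p * w2 p.
Definition Wtx (p : R * R) := cut1 p * w2 p + cut p * w2x p.
Definition Wty (p : R * R) := cut p * w2y p.
Definition b1 (p : R * R) := aX p * cut p.
Definition b1x (p : R * R) := gX p * cut p + aX p * cut1 p.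
Definition b2 (p : R * R) := aY p * cut p.
Definition b2x (p : R * R) := aY p * cut1 p.
Definition b2y (p : R * R) := gY p * cut p.
Definition db (p : R * R) := b1x p + b2y p.
Definition dbx (p : R * R) := gX1 p * cut p + 2 * gX p * cut1 p + aX p * cut2 p + gY p * cut1 p.
Definition dby (p : R * R) := gY1 p * cut p.

Ltac weights p := have := (cut_dx p, cut_dy p, cut1_dx p, cut1_dy p, w2_dx p, w2_dy p);
  have := (gX_dx p, gX_dy p, gY_dx p, gY_dy p, aX_dx p, aX_dy p, aY_dx p, aY_dy p);
  move=> [[[[[[[? ?] ?] ?] ?] ?] ?] ?] [[[[[? ?] ?] ?] ?] ?].

Lemma Wt_dx p : is_derive p (dir false) Wt (Wtx p).
Proof. by weights p; apply: isd_eq; [rewrite /Wt; deriv|rewrite /Wtx; ring]. Qed.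
Lemma Wt_dy p : is_derive p (dir true) Wt (Wty p).
Proof. by weights p; apply: isd_eq; [rewrite /Wt; deriv|rewrite /Wty; ring]. Qed.
Lemma b1_dx p : is_derive p (dir false) b1 (b1x p).
Proof. by weights p; apply: isd_eq; [rewrite /b1; deriv|rewrite /b1x; ring]. Qed.
Lemma b1_dy p : is_derive p (dir true) b1 0.
Proof. by weights p; apply: isd_eq; [rewrite /b1; deriv|ring]. Qed.
Lemma b2_dx p : is_derive p (dir false) b2 (b2x p).
Proof. by weights p; apply: isd_eq; [rewrite /b2; deriv|rewrite /b2x; ring]. Qed.
Lemma b2_dy p : is_derive p (dir true) b2 (b2y p).
Proof. by weights p; apply: isd_eq; [rewrite /b2; deriv|rewrite /b2y; ring]. Qed.
Lemma db_dx p : is_derive p (dir false) db (dbx p).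
Proof. by weights p; apply: isd_eq; [rewrite /db /b1x /b2y; deriv|rewrite /dbx; ring]. Qed.
Lemma db_dy p : is_derive p (dir true) db (dby p).
Proof. by weights p; apply: isd_eq; [rewrite /db /b1x /b2y; deriv|rewrite /dby; ring]. Qed.

Ltac cweights := have := (ccut, ccut1, ccut2, cw2, cgX, cgY, caX, caY) => -[[[[[[[? ?] ?] ?] ?] ?] ?] ?].

Lemma cWt : contf Wt. Proof. by cweights; rewrite /Wt; cont_rec. Qed.
Lemma cWtx : contf Wtx. Proof. by cweights; rewrite /Wtx /w2x; cont_rec. Qed.
Lemma cWty : contf Wty. Proof. by cweights; rewrite /Wty /w2y; cont_rec. Qed.
Lemma cb1 : contf b1. Proof. by cweights; rewrite /b1; cont_rec. Qed.
Lemma cb1x : contf b1x. Proof. by cweights; rewrite /b1x; cont_rec. Qed.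
Lemma cb2 : contf b2. Proof. by cweights; rewrite /b2; cont_rec. Qed.
Lemma cb2x : contf b2x. Proof. by cweights; rewrite /b2x; cont_rec. Qed.
Lemma cb2y : contf b2y. Proof. by cweights; rewrite /b2y; cont_rec. Qed.
Lemma cdb : contf db. Proof. by cweights; rewrite /db /b1x /b2y; cont_rec. Qed.
Lemma cdbx : contf dbx. Proof. by cweights; rewrite /dbx /gX1; cont_rec. Qed.
Lemma cdby : contf dby. Proof. by cweights; rewrite /dby /gY1; cont_rec. Qed.

Let mu1 : 1 <= mu. Proof. by rewrite -smu expr_ge1//; exact: le_trans ler01 s1. Qed.
Let eps01 : 0 < eps <= 1.
Proof.
have mu0 : 0 < mu := lt_le_trans ltr01 mu1.
have -> : eps = mu^-1 by apply: (mulfI (lt0r_neq0 mu0)); rewrite mueps mulfV// lt0r_neq0.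
by rewrite invr_gt0 mu0 invf_le1.
Qed.

Lemma inv1sq (t : R) : [/\ 0 < (1 + t ^+ 2)^-1, (1 + t ^+ 2)^-1 <= 1 & 2 * `|t| * (1 + t ^+ 2)^-1 <= 1].
Proof.
have t0 : 0 < 1 + t ^+ 2 by rewrite ltr_pwDl// sqr_ge0.
split; first by rewrite invr_gt0.
  by rewrite invf_le1// lerDl sqr_ge0.
rewrite ler_pdivrMr// mul1r -(real_normK (num_real t)).
by have := sqr_ge0 (`|t| - 1); rewrite sqrrB1; lra.
Qed.

Let r01 : 0 < r /\ eps <= r.
Proof.
have s0 : 0 < s := lt_le_trans ltr01 s1.
have r0 : 0 < r by have : 0 < s * r; [rewrite sr|rewrite pmulr_rgt0].
split => //; case/andP: eps01 => e0 _.
have e1 : eps = r * r.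
  have mu0 : 0 < mu := lt_le_trans ltr01 mu1.
  apply: (mulfI (lt0r_neq0 mu0)); rewrite mueps -smu.
  by rewrite (_ : s ^+ 2 * (r * r) = (s * r) * (s * r)); [rewrite sr mulr1|ring].
have r1 : r <= 1 by have := ler_wpM2l (ltW r0) s1; rewrite mulr1 mulrC sr.
by rewrite e1 ler_piMl// ltW.
Qed.

Lemma cut01 p : 0 < cut p <= 1.
Proof. by have [h1 h2 _] := inv1sq (eps * p.1); rewrite h1 h2. Qed.

Lemma cut1_le p : `|cut1 p| <= cut p * eps.
Proof.
have [c0 _ h] := inv1sq (eps * p.1); case/andP: eps01 => e0 e1.
rewrite -/(cut p) in c0 h.
have -> : cut1 p = - (eps * cut p * (2 * (eps * p.1) * cut p)) by rewrite /cut1; ring.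
rewrite normrN normrM ger0_norm; last by rewrite mulr_ge0 ?ltW.
rewrite [cut p * eps]mulrC ler_piMr//; first by rewrite mulr_ge0 ?ltW.
by rewrite normrM (gtr0_norm c0) normrM ger0_norm.
Qed.

Lemma cut2_le p : `|cut2 p| <= 6 * cut p.
Proof.
have [c0 c1 _] := inv1sq (eps * p.1); case/andP: eps01 => e0 e1.
(* This identity eliminates the unbounded coordinate and leaves a polynomial in [cut p], a number
   between [0] and [1]. *)
have t1 : (eps * p.1) ^+ 2 * cut p = 1 - cut p.
  by rewrite /cut; field; exact: d1.
rewrite -/(cut p) in c0 c1.
have -> : cut2 p = eps ^+ 2 * cut p * (cut p * (6 - 8 * cut p)).
  have -> : cut2 p = eps ^+ 2 * cut p * (cut p * (8 * ((eps * p.1) ^+ 2 * cut p) - 2)) by rewrite /cut2; ring.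
  by rewrite t1; ring.
move: (cut p) c0 c1 => c c0 c1.
rewrite normrM (_ : `|eps ^+ 2 * c| = eps ^+ 2 * c); last first.
  by rewrite ger0_norm// mulr_ge0 ?sqr_ge0 ?ltW.
have h1 : eps ^+ 2 * c <= c.
  by apply: ler_piMl; [exact: ltW|rewrite expr_le1// ltW].
have h2 : `|c * (6 - 8 * c)| <= 6.
  by rewrite ler_norml; apply/andP; split; nra.
rewrite [6 * c]mulrC; apply: ler_pM => //.
by rewrite mulr_ge0 ?sqr_ge0 ?ltW.
Qed.

Let g01 (t : R) : 0 < (1 + t ^+ 2)^-1 <= 1.
Proof. by have [h1 h2 _] := inv1sq t; rewrite h1 h2. Qed.

Let g1_le (t : R) : `| - 2 * t * (1 + t ^+ 2)^-1 ^+ 2| <= 1.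
Proof.
have [h1 h2 h3] := inv1sq t.
have -> : - 2 * t * (1 + t ^+ 2)^-1 ^+ 2 = - (2 * t * (1 + t ^+ 2)^-1) * (1 + t ^+ 2)^-1 by ring.
rewrite normrM normrN !normrM (gtr0_norm h1) ger0_norm//.
by apply: mulr_ile1 => //; rewrite ?mulr_ge0// ltW.
Qed.

Lemma w2_01 p : 0 < w2 p <= 1.
Proof.
have h : 0 < 1 + (p.1 ^+ 2 + p.2 ^+ 2) by rewrite ltr_pwDl// addr_ge0// sqr_ge0.
by rewrite /w2 invr_gt0 h invf_le1// lerDl addr_ge0// sqr_ge0.
Qed.

Let w2_lin p : (2 * `|p.1| * w2 p <= 1) /\ (2 * `|p.2| * w2 p <= 1).
Proof.
have h : 0 < 1 + (p.1 ^+ 2 + p.2 ^+ 2) by rewrite ltr_pwDl// addr_ge0// sqr_ge0.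
rewrite /w2 !ler_pdivrMr// !mul1r.
rewrite -(real_normK (num_real p.1)) -(real_normK (num_real p.2)).
have := sqr_ge0 (`|p.1| - 1); have := sqr_ge0 (`|p.2| - 1).
have := sqr_ge0 `|p.1|; have := sqr_ge0 `|p.2|.
by rewrite !sqrrB1; move: `|p.1| `|p.2| => u v *; split; lra.
Qed.

Let w2_le_g p : w2 p <= gX p /\ w2 p <= gY p.
Proof.
have h : 0 < 1 + (p.1 ^+ 2 + p.2 ^+ 2) by rewrite ltr_pwDl// addr_ge0// sqr_ge0.
have h1 : 0 < 1 + p.1 ^+ 2 by rewrite ltr_pwDl// sqr_ge0.
have h2 : 0 < 1 + p.2 ^+ 2 by rewrite ltr_pwDl// sqr_ge0.
rewrite /w2 /gX /gY !lef_pV2//; have := sqr_ge0 p.1; have := sqr_ge0 p.2.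
by move: (p.1 ^+ 2) (p.2 ^+ 2) => u v *; split; lra.
Qed.

(** The arctangents have derivatives [gX] and [gY], both at least [w2], so the field [(b1, b2)] has
    the growth [Wt] required at each point; differentiating the cutoff costs at most [2 * cut * r]
    because [eps <= r]. *)
Lemma smoothing_density lam nu sg a b A1 B1 A2 B2 hr hi h1 h2 k1 k2 w p :
  lam = sg * mu -> `|sg| = 1 -> 0 <= nu <= 1 ->
  hr - lam * a + nu * b = w * h1 + k1 -> hi - lam * b - nu * a = w * h2 + k2 ->
  0 <= w <= 1 -> w ^+ 2 = w2 p ->
  mu * w ^+ 2 * (a ^+ 2 + b ^+ 2) <=
    300 * (s * (a ^+ 2 + b ^+ 2) + s * (k1 ^+ 2 + k2 ^+ 2) + (h1 ^+ 2 + h2 ^+ 2))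
    + 8 / 3 * virial_density a b A1 B1 A2 B2 hr hi lam (b1 p) (b2 p) (b1x p) (b2x p) (b2y p)
                (db p) (dbx p) (dby p)
    + 352 / 9 * (r * energy_density a b A1 B1 A2 B2 hr hi p.1 (cut p) (cut1 p) 0)
    - sg * energy_density a b A1 B1 A2 B2 hr hi p.1 (Wt p) (Wtx p) (Wty p).
Proof.
move=> lamE sg1 nu01 fr fi w01 wE.
have /andP[c0 c1] := cut01 p; have /andP[q0 q1] := w2_01 p.
have [x1 x2] := w2_lin p; have [gx gy] := w2_le_g p.
have /andP[e0 e1] := eps01; have [r0 er] := r01.
have c1le := cut1_le p; have c2le := cut2_le p.
have c1r : `|cut1 p| <= cut p * r by apply: (le_trans c1le); rewrite ler_pM2l.
have c1c : `|cut1 p| <= cut p by apply: (le_trans c1le); rewrite ler_piMr// ltW.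
have /andP[gX0 gX1'] : 0 < gX p <= 1 := g01 p.1.
have /andP[gY0 gY1'] : 0 < gY p <= 1 := g01 p.2.
have gX1le : `|gX1 p| <= 1 := g1_le p.1.
have gY1le : `|gY1 p| <= 1 := g1_le p.2.
have aX2 : `|aX p| <= 2 := norm_atan_le2 p.1.
have aY2 : `|aY p| <= 2 := norm_atan_le2 p.2.
have cn : `|cut p| <= cut p by rewrite gtr0_norm.
have [_ _ xc] := inv1sq (eps * p.1); rewrite -/(cut p) in xc.
have gXn : `|gX p| <= 1 by rewrite gtr0_norm.
have gYn : `|gY p| <= 1 by rewrite gtr0_norm.
have b1xe : `|aX p * cut1 p| <= 2 * (cut p * r) by exact: norm_mul_le.
have mu0 : 0 < mu := lt_le_trans ltr01 mu1.
apply: (@smoothing_pointwise _ a b A1 B1 A2 B2 hr hi h1 h2 k1 k2 lam nu mu s r sg p.1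
  (cut p) (cut1 p) (Wt p) (Wtx p) (Wty p) w) => //.
- by rewrite c1 ltW.
- have -> : `|p.1| * cut p = mu * (`|eps * p.1| * cut p).
    by rewrite normrM (gtr0_norm e0) !mulrA mueps mul1r.
  rewrite ler_piMr// 1?ltW//; have : 0 <= `|eps * p.1| * cut p by rewrite mulr_ge0// ltW.
  by move: xc; rewrite -mulrA; lra.
- by rewrite wE.
- rewrite /Wtx /Wt /w2x.
  have E1 : `|cut1 p * w2 p| <= cut p * w2 p.
    by apply: norm_mul_le => //; rewrite gtr0_norm.
  have E2 : `|cut p * (- 2 * p.1 * w2 p ^+ 2)| <= cut p * w2 p.
    apply: norm_mul_le => //.
    have -> : - 2 * p.1 * w2 p ^+ 2 = - (2 * p.1 * w2 p) * w2 p by ring.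
    rewrite normrM normrN !normrM (gtr0_norm q0) (ger0_norm (ler0n _ 2)).
    by rewrite ler_piMl// ltW.
  by apply: (le_trans (ler_normD _ _)); lra.
- rewrite /Wty /Wt /w2y; apply: norm_mul_le => //.
  have -> : - 2 * p.2 * w2 p ^+ 2 = - (2 * p.2 * w2 p) * w2 p by ring.
  rewrite normrM normrN !normrM (gtr0_norm q0) (ger0_norm (ler0n _ 2)).
  by rewrite ler_piMl// ltW.
- rewrite /Wt mulrA [`|_| * _]mulrC -mulrA.
  apply: mulr_ile1; [exact: ltW|by apply: mulr_ge0 => //; exact: ltW|exact: c1|].
  have : 0 <= `|p.1| * w2 p by rewrite mulr_ge0// ltW.
  by move: x1; rewrite -mulrA; lra.
(* Since [1 - cut = (eps x)^2 cut] and [x^2 w2 <= 1], the defect [mu (1 - cut) w2] is at most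
   [mu eps^2 = eps]. *)
- rewrite wE /Wt -lerBlDl -mulrBr.
  have -> : w2 p - cut p * w2 p = (1 - cut p) * w2 p by ring.
  have -> : 1 - cut p = (eps * p.1) ^+ 2 * cut p by rewrite /cut; field; exact: d1.
  have -> : mu * ((eps * p.1) ^+ 2 * cut p * w2 p) = (mu * eps) * (eps * (cut p * (p.1 ^+ 2 * w2 p))) by ring.
  rewrite mueps mul1r; apply: mulr_ile1; [exact: ltW| |exact: e1|].
    by apply: mulr_ge0; [exact: ltW|apply: mulr_ge0; [exact: sqr_ge0|exact: ltW]].
  apply: mulr_ile1; [exact: ltW|by apply: mulr_ge0; [exact: sqr_ge0|exact: ltW]|exact: c1|].
  have h : 0 < 1 + (p.1 ^+ 2 + p.2 ^+ 2) by rewrite ltr_pwDl// addr_ge0// sqr_ge0.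
  rewrite /w2 ler_pdivrMr// mul1r.
  by have := sqr_ge0 p.1; have := sqr_ge0 p.2; lra.
- exact: norm_mul_le.
- exact: norm_mul_le.
- rewrite /db /b1x /b2y; apply: (le_trans (ler_normD _ _)).
  have E1 : `|gX p * cut p| <= 1 * cut p by exact: norm_mul_le.
  have E2 : `|aX p * cut1 p| <= 2 * cut p by exact: norm_mul_le.
  have E3 : `|gY p * cut p| <= 1 * cut p by exact: norm_mul_le.
  by have := ler_normD (gX p * cut p) (aX p * cut1 p); lra.
- have E1 : `|gX1 p * cut p| <= 1 * cut p by exact: norm_mul_le.
  have E2 : `|2 * gX p * cut1 p| <= (2 * 1) * cut p.
    by apply: norm_mul_le => //; apply: norm_mul_le => //; rewrite ger0_norm.
  have E3 : `|aX p * cut2 p| <= 2 * (6 * cut p) by exact: norm_mul_le.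
  have E4 : `|gY p * cut1 p| <= 1 * cut p by exact: norm_mul_le.
  rewrite /dbx; apply: (le_trans (ler_normD _ _)).
  apply: (le_trans (lerD (ler_normD _ _) (lexx _))).
  apply: (le_trans (lerD (lerD (ler_normD _ _) (lexx _)) (lexx _))).
  by move: E1 E2 E3 E4; move: `|_| `|_| `|_| `|_| => n1 n2 n3 n4 *; lra.
- by rewrite /dby -[leRHS]mul1r; exact: norm_mul_le.
- rewrite /b1x /Wt.
  have : cut p * w2 p <= gX p * cut p by rewrite [gX p * _]mulrC ler_pM2l.
  by move: b1xe; rewrite ler_norml => /andP[]; move: (aX p * cut1 p) => z *; lra.
- by rewrite /b2y /Wt [gY p * _]mulrC ler_pM2l.
- exact: norm_mul_le.
Qed.

End Weights.

(** * Dissipation, coercivity and smoothing on test functions *)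

Section Estimates.
Context {R : realType}.
Implicit Types (u f g h : R * R -> R[i]) (a b : R * R -> R) (lam nu : R).
Local Notation mu := (@leb2 R).
Local Notation I2 := (Rintegral (@leb2 R) setT).
Local Notation Re := complex.Re.
Local Notation Im := complex.Im.
Local Notation csq := (@csq_on _ _ _ (@leb2 R)).
Local Notation cip := (@cip_on _ _ _ (@leb2 R)).
Local Notation cL2 := (@cL2_on _ _ _ (@leb2 R)).

Lemma sqitg_in_box M (a : R * R -> R) : continuous a -> in_box M a -> sqitg mu a.
Proof.
move=> ca ba; split; first exact: continuous_measurable2.
have c2 : contf (fun p => a p ^+ 2) by apply: contX.
apply: (@itg_in_box R M (fun p => a p ^+ 2) c2).
by move=> p pM; rewrite (ba p pM) expr0n.
Qed.

Definition shifted lam nu u p := H0_expr u p - (lam +i* nu) * u p.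

Lemma contf_HR a b : smooth a -> smooth b -> contf (HR a b).
Proof.
move=> sa sb.
have ca : contf _ := smooth_continuous sa.
have cbx : contf _ := smooth_continuous (smooth_partial false sb).
have caxx : contf _ := smooth_continuous (smooth_partial false (smooth_partial false sa)).
have cayy : contf _ := smooth_continuous (smooth_partial true (smooth_partial true sa)).
by rewrite /HR; cont_rec.
Qed.

Lemma contf_HI a b : smooth a -> smooth b -> contf (HI a b).
Proof.
move=> sa sb.
have cb : contf _ := smooth_continuous sb.
have cax : contf _ := smooth_continuous (smooth_partial false sa).
have cbxx : contf _ := smooth_continuous (smooth_partial false (smooth_partial false sb)).
have cbyy : contf _ := smooth_continuous (smooth_partial true (smooth_partial true sb)).
by rewrite /HI; cont_rec.
Qed.

Lemma H0_in_box M a b : smooth a -> smooth b -> in_box M a -> in_box M b ->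
  in_box M (HR a b) /\ in_box M (HI a b).
Proof.
move=> sa sb ba bb; split => p pM; rewrite /HR /HI ?(ba p pM) ?(bb p pM).
  rewrite (in_box_partial false (smooth_partial false sa) (in_box_partial false sa ba) pM).
  rewrite (in_box_partial true (smooth_partial true sa) (in_box_partial true sa ba) pM).
  by rewrite (in_box_partial false sb bb pM); ring.
rewrite (in_box_partial false (smooth_partial false sb) (in_box_partial false sb bb) pM).
rewrite (in_box_partial true (smooth_partial true sb) (in_box_partial true sb bb) pM).
by rewrite (in_box_partial false sa ba pM); ring.
Qed.

Lemma csq_rot f : csq (fun p => (0 -i* 1) * f p) = csq f.
Proof. by apply: I_ext => p; rewrite !reimE /=; ring. Qed.

Definition jinv (p : R * R) : R := (jap p)^-1.

Lemma jinv_sqr p : jinv p ^+ 2 = w2 p.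
Proof. by rewrite /jinv exprVn sqr_sqrtr// !addr_ge0// sqr_ge0. Qed.

Lemma jap_ge1 (p : R * R) : 1 <= jap p.
Proof. by rewrite /jap -{1}sqrtr1 ler_sqrt// ?lerDl !addr_ge0// sqr_ge0. Qed.

Lemma jinv01 p : 0 < jinv p <= 1.
Proof.
have h := jap_ge1 p; have h0 : 0 < jap p := lt_le_trans ltr01 h.
by rewrite /jinv invr_gt0 h0 invf_le1.
Qed.

Lemma cjinv : contf jinv.
Proof.
apply: contV => [q|]; first by rewrite gt_eqF// (lt_le_trans ltr01 (jap_ge1 q)).
by apply: contcomp; [exact: sqrt_continuous|cont_rec].
Qed.

Lemma jinv_cL2 f : cL2 f -> cL2 (fun p => (jinv p)%:C * f p).
Proof.
move=> [f1 f2]; have cj := continuous_measurable2 cjinv.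
split.
  apply: (sqitg_le _ f1) => [|p].
    have -> : (fun p => Re ((jinv p)%:C * f p)) = (fun p => jinv p * Re (f p)).
      by apply/funext => p; rewrite !reimE /=; ring.
    by apply: measurable_funM => //; case: f1.
  rewrite !reimE /= mul0r subr0 normrM ler_piMl//.
  by have /andP[h1 h2] := jinv01 p; rewrite gtr0_norm.
apply: (sqitg_le _ f2) => [|p].
  have -> : (fun p => Im ((jinv p)%:C * f p)) = (fun p => jinv p * Im (f p)).
    by apply/funext => p; rewrite !reimE /=; ring.
  by apply: measurable_funM => //; case: f2.
rewrite !reimE /= mul0r addr0 normrM ler_piMl//.
by have /andP[h1 h2] := jinv01 p; rewrite gtr0_norm.
Qed.

Section TestFunction.
Variables (u : R * R -> R[i]) (lam nu M : R) (a b : R * R -> R).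
Hypotheses (ua : forall q, Re (u q) = a q) (ub : forall q, Im (u q) = b q)
  (sa : smooth a) (sb : smooth b) (ba : in_box M a) (bb : in_box M b).

Lemma parts_cL2 : cL2 u.
Proof.
rewrite /cL2_on (funext ua) (funext ub).
by split; [exact: sqitg_in_box (smooth_continuous sa) ba|exact: sqitg_in_box (smooth_continuous sb) bb].
Qed.

Lemma shiftedE p : shifted lam nu u p =
  (HR a b p - lam * a p + nu * b p) +i* (HI a b p - lam * b p - nu * a p).
Proof.
rewrite /shifted (H0_exprE _ ua ub sa sb).
by apply: complex_ext; rewrite !reimE /= ua ub; ring.
Qed.

Lemma H0_cL2 : cL2 (H0_expr u).
Proof.
have [bR bI] := H0_in_box sa sb ba bb.
have E p : H0_expr u p = HR a b p +i* HI a b p by exact: H0_exprE.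
have -> : H0_expr u = (fun p => HR a b p +i* HI a b p) by apply/funext => p.
by split; [exact: sqitg_in_box (contf_HR sa sb) bR|exact: sqitg_in_box (contf_HI sa sb) bI].
Qed.

Lemma shifted_cL2 : cL2 (shifted lam nu u).
Proof. by apply: cL2B; [exact: H0_cL2|exact: cL2Z parts_cL2]. Qed.

(* Symmetry of [H0] on test functions: [nu |u|^2 = - Im <(H0 - lam - i nu) u, u>]. *)
Lemma dissipation : nu * csq u = cip (fun p => (0 -i* 1) * u p) (shifted lam nu u).
Proof.
have [iH H0'] := current_divergence sa sb ba bb.
have uL2 := parts_cL2.
rewrite /csq /csq_on -IZ; last exact: cip_itg.
rewrite -[LHS]subr0 -[X in _ - X = _]H0' -IB//; last by apply: itgZ; exact: cip_itg.
apply: I_ext => p; rewrite shiftedE !reimE /= ua ub; ring.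
Qed.

Lemma coercive : 0 < nu -> nu ^+ 2 * csq u <= csq (shifted lam nu u).
Proof.
move=> nu0; have uL2 := parts_cL2.
have := cauchy_schwarz (cL2Z (0 -i* 1) uL2) shifted_cL2.
rewrite -dissipation csq_rot => h.
have [c0|c0] := ltP 0 (csq u); last first.
  have -> : csq u = 0 by apply/eqP; rewrite eq_le c0 csq_ge0.
  by rewrite mulr0 csq_ge0.
have : csq u * (nu ^+ 2 * csq u) <= csq u * csq (shifted lam nu u).
  by rewrite (_ : csq u * (nu ^+ 2 * csq u) = (nu * csq u) ^+ 2)//; ring.
by rewrite ler_pM2l.
Qed.

(** Integrating [smoothing_density] leaves only norms, because the virial density and the two energy
    densities have zero integral. The function [h] is free, and [k] is what remains of [(H0 - z) u]
    after subtracting [w h]. *)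
Lemma smoothing_estimate h : cL2 h -> 1 <= `|lam| -> 0 <= nu <= 1 ->
  `|lam| * csq (fun p => (jinv p)%:C * u p) <=
  300 * (Num.sqrt `|lam| * csq u
         + Num.sqrt `|lam| * csq (fun p => shifted lam nu u p - (jinv p)%:C * h p) + csq h).
Proof.
move=> hL2 lam1 nu01.
set m := `|lam| in lam1 *; set s := Num.sqrt m.
have m0 : 0 < m := lt_le_trans ltr01 lam1.
have s1 : 1 <= s by rewrite /s -{1}sqrtr1 ler_sqrt// ltW.
have s0 : 0 < s := lt_le_trans ltr01 s1.
have smu : s ^+ 2 = m by rewrite sqr_sqrtr// ltW.
have sr : s * s^-1 = 1 by rewrite mulfV// gt_eqF.
have mueps : m * m^-1 = 1 by rewrite mulfV// gt_eqF.
have sg1 : `|Num.sg lam| = 1.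
  by rewrite normr_sg; have := m0; rewrite normr_gt0 => ->.
have lamE : lam = Num.sg lam * m := numEsg lam.
pose k p := shifted lam nu u p - (jinv p)%:C * h p.
have uL2 := parts_cL2.
have kL2 : cL2 k by apply: cL2B; [exact: shifted_cL2|exact: jinv_cL2].
have [iV IV] := @virial_divergence R M a b sa sb ba bb _ _ _ _ _ _ _ _ _ lam
  (b1_dx m^-1) (b1_dy m^-1) (b2_dx m^-1) (b2_dy m^-1) (db_dx m^-1) (db_dy m^-1)
  (fun p => erefl) (@cb1 R m^-1) (@cb2 R m^-1) (@cb1x R m^-1) (@contC R 0) (@cb2x R m^-1) (@cb2y R m^-1)
  (@cdb R m^-1) (@cdbx R m^-1) (@cdby R m^-1).
have [iE IE] := energy_divergence sa sb ba bb (cut_dx m^-1) (cut_dy m^-1) (@ccut R m^-1) (@ccut1 R m^-1) (@contC R 0).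
have [iW IW] := energy_divergence sa sb ba bb (Wt_dx m^-1) (Wt_dy m^-1) (@cWt R m^-1) (@cWtx R m^-1) (@cWty R m^-1).
have ik := cip_itg kL2 kL2; have ih := cip_itg hL2 hL2; have iu := cip_itg uL2 uL2.
have ij : itg mu (fun p => Re ((jinv p)%:C * u p) * Re ((jinv p)%:C * u p)
                         + Im ((jinv p)%:C * u p) * Im ((jinv p)%:C * u p)).
  by apply: cip_itg; exact: jinv_cL2.
rewrite /csq /csq_on /cip_on.
have C1 : itg mu (fun p => s * (Re (u p) * Re (u p) + Im (u p) * Im (u p)) + s * (Re (k p) * Re (k p) + Im (k p) * Im (k p))).
  by apply: itgD; apply: itgZ.
have C2 := itgD C1 ih.
have D1 := itgD (itgZ 300 C2) (itgZ (8 / 3) iV).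
have D2 := itgD D1 (itgZ (352 / 9) (itgZ s^-1 iE)).
have D3 := itgB D2 (itgZ (Num.sg lam) iW).
have B := I_le (itgZ m ij) D3; rewrite IZ// in B; apply: le_trans (B _) _ => {B}.
  move=> p.
  have w01 : 0 <= jinv p <= 1 by have /andP[j0 ->] := jinv01 p; rewrite ltW.
  have e1 : HR a b p - lam * a p + nu * b p = jinv p * Re (h p) + Re (k p).
    by rewrite /k shiftedE !reimE /=; ring.
  have e2 : HI a b p - lam * b p - nu * a p = jinv p * Im (h p) + Im (k p).
    by rewrite /k shiftedE !reimE /=; ring.
  have := @smoothing_density R m s s^-1 m^-1 s1 smu sr mueps lam nu (Num.sg lam) (a p) (b p)
    (A1 a b p) (B1 a b p) (A2 a p) (B2 b p) (HR a b p) (HI a b p)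
    (Re (h p)) (Im (h p)) (Re (k p)) (Im (k p)) (jinv p) p lamE sg1 nu01 e1 e2 w01 (jinv_sqr p).
  rewrite [X in X <= _ -> _](_ : _ = m * (Re ((jinv p)%:C * u p) * Re ((jinv p)%:C * u p) + Im ((jinv p)%:C * u p) * Im ((jinv p)%:C * u p))); last first.
    by rewrite !reimE /= ua ub; ring.
  move=> H; apply: (le_trans H); rewrite le_eqVlt; apply/orP; left; apply/eqP.
  rewrite /virial_density /energy_density /PR /PI /grad2 ua ub !expr2.
  by gen_partial; ring.
rewrite (IB D2 (itgZ (Num.sg lam) iW)) (ID D1 (itgZ (352 / 9) (itgZ s^-1 iE))).
rewrite (ID (itgZ 300 C2) (itgZ (8 / 3) iV)) (IZ _ C2) (IZ _ iV) (IZ _ (itgZ s^-1 iE)) (IZ _ iE) (IZ _ iW).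
rewrite [X in 8 / 3 * X]IV [X in s^-1 * X]IE [X in Num.sg lam * X]IW.
rewrite (ID C1 ih) (ID (itgZ s iu) (itgZ s ik)) (IZ _ iu) (IZ _ ik).
by rewrite !mulr0 !addr0 subr0.
Qed.

End TestFunction.
End Estimates.

Lemma ncvg_unique (R : realType) (u : nat -> R) (a b : R) :
  u n @[n --> \oo] --> a -> u n @[n --> \oo] --> b -> a = b.
Proof. by move=> ua; apply: cvg_unique ua; exact: norm_hausdorff. Qed.

(** * The resolvent of the closed operator *)

Section ComplexL2Limits.
Context d (T : measurableType d) (R : realType) (mu : {measure set T -> \bar R}).
Implicit Types f g h : T -> R[i].
Local Notation Re := complex.Re.
Local Notation Im := complex.Im.
Local Notation csq := (@csq_on _ _ _ mu).
Local Notation cip := (@cip_on _ _ _ mu).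
Local Notation cL2 := (@cL2_on _ _ _ mu).

Lemma csqZc (z : R[i]) f : cL2 f ->
  csq (fun x => z * f x) = (Re z ^+ 2 + Im z ^+ 2) * csq f.
Proof.
move=> hf; rewrite /csq_on /cip_on -IZ; last exact: cip_itg.
by apply: I_ext => x; rewrite !reimE; ring.
Qed.

Lemma ae_mono (P Q : T -> Prop) : (forall x, P x -> Q x) ->
  {ae mu, forall x, P x} -> {ae mu, forall x, Q x}.
Proof. by move=> PQ; apply: filterS. Qed.

Lemma cip_ae f f' g : cL2 f -> cL2 f' -> cL2 g -> (\forall x \ae mu, f x = f' x) ->
  cip f g = cip f' g.
Proof.
move=> hf hf' hg ff'.
rewrite /cip_on; have [||_ ->//] := @itg_ae _ _ _ mu _ (fun x => Re (f x) * Re (g x) + Im (f x) * Im (g x)) _ _ (cip_itg hf' hg).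
- exact: itg_measurable (cip_itg hf hg).
- by apply: filterS ff' => x ->.
Qed.

Lemma csq_ae f f' : cL2 f -> cL2 f' -> (\forall x \ae mu, f x = f' x) -> csq f = csq f'.
Proof.
by move=> hf hf' ff'; rewrite /csq_on (cip_ae hf hf' hf ff') cipC (cip_ae hf hf' hf' ff').
Qed.

Lemma csq_eq0_ae f : cL2 f -> csq f = 0 -> \forall x \ae mu, f x = 0.
Proof.
move=> hf f0; have := I_eq0 (cip_itg hf hf) _ f0.
have h x : 0 <= Re (f x) * Re (f x) + Im (f x) * Im (f x) by rewrite -!expr2; ge0.
move=> /(_ h); apply: filterS => x; rewrite -!expr2 => /eqP.
by rewrite paddr_eq0 ?sqr_ge0// !sqrf_eq0 => /andP[/eqP h1 /eqP h2]; exact: complex_ext.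
Qed.

Lemma cip_cvg (f : nat -> T -> R[i]) g h : (forall n, cL2 (f n)) -> cL2 g -> cL2 h ->
  csq (fun x => f n x - g x) @[n --> \oo] --> 0 -> cip (f n) h @[n --> \oo] --> cip g h.
Proof.
move=> fL2 gL2 hL2 fg.
have E n : cip (fun x => f n x - g x) h + cip g h = cip (f n) h.
  by rewrite -cipDl//; [congr (cip _ h); apply/funext => x; rewrite subrK|exact: cL2B].
apply: (ncvg_ext E (add0r _)); apply: ncvgD; last exact: cvg_cst.
apply: ncvg_sqr0; apply: (@ncvg_squeeze0 _ _ (fun n => csq h * csq (fun x => f n x - g x))).
  by move=> n; rewrite sqr_ge0 /= mulrC; apply: cauchy_schwarz => //; exact: cL2B.
by rewrite -(mulr0 (csq h)); apply: ncvgZ.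
Qed.

Lemma csq_cvg (f : nat -> T -> R[i]) g : (forall n, cL2 (f n)) -> cL2 g ->
  csq (fun x => f n x - g x) @[n --> \oo] --> 0 -> csq (f n) @[n --> \oo] --> csq g.
Proof.
move=> fL2 gL2 fg.
have E n : csq (fun x => f n x - g x) + (2 * cip (f n) g - csq g) = csq (f n).
  have -> : csq (fun x => f n x - g x) = csq (fun x => f n x + (-1)%:C * g x).
    by apply: csq_ext => x; rewrite rmorphN1 mulN1r.
  by rewrite csq_lin//; ring.
have L : 0 + (2 * cip g g - csq g) = csq g by rewrite /csq_on; ring.
apply: (ncvg_ext E L); apply: ncvgD => //; apply: cvgB; last exact: cvg_cst.
by apply: ncvgZ; exact: cip_cvg.
Qed.

Lemma cip_cvg2 (f g : nat -> T -> R[i]) f0 g0 : (forall n, cL2 (f n)) -> (forall n, cL2 (g n)) ->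
  cL2 f0 -> cL2 g0 -> csq (fun x => f n x - f0 x) @[n --> \oo] --> 0 ->
  csq (fun x => g n x - g0 x) @[n --> \oo] --> 0 -> cip (f n) (g n) @[n --> \oo] --> cip f0 g0.
Proof.
move=> fL2 gL2 f0L2 g0L2 ff gg.
have E n : cip (fun x => g n x - g0 x) (f n) + cip (f n) g0 = cip (f n) (g n).
  rewrite cipBl// [cip (g n) _]cipC [cip g0 _]cipC; ring.
apply: (ncvg_ext E (add0r _)); apply: ncvgD; last exact: cip_cvg.
apply: ncvg_sqr0; apply: (@ncvg_squeeze0 _ _ (fun n => csq (fun x => g n x - g0 x) * csq (f n))).
  by move=> n; rewrite sqr_ge0 /=; apply: cauchy_schwarz => //; exact: cL2B.
by rewrite -(mul0r (csq f0)); apply: ncvgM => //; exact: csq_cvg.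
Qed.

Lemma csq_cvgB (a b : nat -> T -> R[i]) a0 b0 :
  (forall n, cL2 (a n)) -> (forall n, cL2 (b n)) -> cL2 a0 -> cL2 b0 ->
  csq (fun x => a n x - a0 x) @[n --> \oo] --> 0 ->
  csq (fun x => b n x - b0 x) @[n --> \oo] --> 0 ->
  csq (fun x => (a n x - b n x) - (a0 x - b0 x)) @[n --> \oo] --> 0.
Proof.
move=> aL2 bL2 a0L2 b0L2 la lb.
apply: (@ncvg_squeeze0 _ _ (fun n => 2 * csq (fun x => a n x - a0 x) + 2 * csq (fun x => b n x - b0 x))).
  move=> n; rewrite csq_ge0 /=.
  have dbL2 : cL2 (fun x => b n x - b0 x) by exact: cL2B.
  have E : csq (fun x => (-1)%:C * (b n x - b0 x)) = csq (fun x => b n x - b0 x).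
    by rewrite csqZ// sqrrN expr1n mul1r.
  have -> : csq (fun x => (a n x - b n x) - (a0 x - b0 x)) =
      csq (fun x => (a n x - a0 x) + (-1)%:C * (b n x - b0 x)).
    by apply: csq_ext => x; rewrite rmorphN1 mulN1r; ring.
  by rewrite -E; apply: csq_sum_le; [exact: cL2B|exact: cL2Z].
rewrite -[X in _ --> X](_ : 2 * 0 + 2 * 0 = 0); last by ring.
by apply: ncvgD; apply: ncvgZ.
Qed.

Lemma cL2_bounded (m : T -> R) f : measurable_fun setT m -> (forall x, 0 <= m x <= 1) ->
  cL2 f -> cL2 (fun x => (m x)%:C * f x) /\ csq (fun x => (m x)%:C * f x) <= csq f.
Proof.
move=> mm m01 [f1 f2].
have E1 : (fun x => Re ((m x)%:C * f x)) = (fun x => m x * Re (f x)).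
  by apply/funext => x; rewrite !reimE /=; ring.
have E2 : (fun x => Im ((m x)%:C * f x)) = (fun x => m x * Im (f x)).
  by apply/funext => x; rewrite !reimE /=; ring.
have mle (x : T) (t : R) : `|m x * t| <= `|t|.
  by rewrite normrM ler_piMl//; have /andP[h1 h2] := m01 x; rewrite ger0_norm.
have mL2 : cL2 (fun x => (m x)%:C * f x).
  rewrite /cL2_on E1 E2; split.
    by apply: (sqitg_le _ f1) => // ; apply: measurable_funM => //; case: f1.
  by apply: (sqitg_le _ f2) => // ; apply: measurable_funM => //; case: f2.
split => //; apply: I_le; [exact: cip_itg|exact: cip_itg|move=> x].
have -> : Re ((m x)%:C * f x) = m x * Re (f x) by rewrite !reimE /=; ring.
have -> : Im ((m x)%:C * f x) = m x * Im (f x) by rewrite !reimE /=; ring.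
rewrite -!expr2 !exprMn; have /andP[h1 h2] := m01 x.
have h3 : m x ^+ 2 <= 1 by rewrite expr_le1.
by apply: lerD; rewrite ler_piMl// sqr_ge0.
Qed.

End ComplexL2Limits.

(** * From test functions to the closed operator *)

Section Resolvent.
Context {R : realType}.
Implicit Types (u f g h : R * R -> R[i]) (lam nu : R).
Local Notation mu := (@leb2 R).
Local Notation Re := complex.Re.
Local Notation Im := complex.Im.
Local Notation csq := (@csq_on _ _ _ (@leb2 R)).
Local Notation cip := (@cip_on _ _ _ (@leb2 R)).
Local Notation cL2 := (@cL2_on _ _ _ (@leb2 R)).

Lemma L2P f : L2 f <-> cL2 f.
Proof. by rewrite /L2 /cL2_on !Lfun2P. Qed.

Lemma L2normE f : cL2 f -> L2norm f = (Num.sqrt (csq f))%:E.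
Proof.
move=> fL2; rewrite /L2norm unlock.
rewrite (eq_integral (fun p : measurableTypeR R * measurableTypeR R =>
  (Re (f p) * Re (f p) + Im (f p) * Im (f p))%:E)); last first.
  move=> p _; rewrite /= ger0_norm; last by case: (f p) => a b; exact: sqrtr_ge0.
  rewrite powR_mulrn; last by case: (f p) => a b; exact: sqrtr_ge0.
  by case: (f p) => a b /=; rewrite sqr_sqrtr ?addr_ge0 ?sqr_ge0// !expr2.
by rewrite itg_EFin ?poweR_EFin ?powR12_sqrt ?csq_ge0//; exact: cip_itg.
Qed.

Lemma L2norm_cvg0 (f : nat -> R * R -> R[i]) : (forall n, cL2 (f n)) ->
  (L2norm (f n) @[n --> \oo] --> 0%E <-> csq (f n) @[n --> \oo] --> 0).
Proof.
move=> fL2; have -> : (fun n => L2norm (f n)) = (fun n => (Num.sqrt (csq (f n)))%:E).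
  by apply/funext => n; rewrite L2normE.
split.
  move=> /fine_cvg /= h.
  apply: (@ncvg_ext _ (fun n => Num.sqrt (csq (f n)) * Num.sqrt (csq (f n))) _ (0 * 0)) => [n||].
  - by rewrite -expr2 sqr_sqrtr// csq_ge0.
  - by rewrite mulr0.
  - exact: ncvgM.
move=> h; apply: cvg_EFin; first exact: nearW.
apply: ncvg_sqr0; apply: (ncvg_ext _ _ h) => // n.
by rewrite /= sqr_sqrtr// csq_ge0.
Qed.

Lemma partial_lin s a b (t : R) p : smooth a -> smooth b ->
  partial s (fun q => a q + t * b q) p = partial s a p + t * partial s b p.
Proof.
move=> sa sb; apply: partialE.
have da := smooth_is_derive s p sa; have db := smooth_is_derive s p sb.
by apply: isd_eq; [deriv|rewrite mul0r add0r].
Qed.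

Lemma partial_lin2 s s' a b (t : R) p : smooth a -> smooth b ->
  partial s (partial s' (fun q => a q + t * b q)) p =
  partial s (partial s' a) p + t * partial s (partial s' b) p.
Proof.
move=> sa sb.
have -> : partial s' (fun q => a q + t * b q) = (fun q => partial s' a q + t * partial s' b q).
  by apply/funext => q; exact: partial_lin.
apply: partial_lin; exact: smooth_partial.
Qed.

Lemma HR_lin a b c d (t : R) p : smooth a -> smooth b -> smooth c -> smooth d ->
  HR (fun q => a q + t * c q) (fun q => b q + t * d q) p = HR a b p + t * HR c d p.
Proof.
move=> sa sb sc sd; rewrite /HR (partial_lin2 false false t p sa sc).
by rewrite (partial_lin2 true true t p sa sc) (partial_lin false t p sb sd); gen_partial; ring.
Qed.

Lemma HI_lin a b c d (t : R) p : smooth a -> smooth b -> smooth c -> smooth d ->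
  HI (fun q => a q + t * c q) (fun q => b q + t * d q) p = HI a b p + t * HI c d p.
Proof.
move=> sa sb sc sd; rewrite /HI (partial_lin2 false false t p sb sd).
by rewrite (partial_lin2 true true t p sb sd) (partial_lin false t p sa sc); gen_partial; ring.
Qed.

Lemma test_lin u v (t : R) : test_function u -> test_function v ->
  test_function (fun p => u p + t%:C * v p).
Proof.
move=> tu tv; have [M [ua ub]] := test_in_box tu; have [N [va vb]] := test_in_box tv.
case: tu tv => sua sub _ [sva svb _].
have E1 : (fun q => Re (u q + t%:C * v q)) = (fun q => Re (u q) + t * Re (v q)).
  by apply/funext => q; rewrite !reimE /=; ring.
have E2 : (fun q => Im (u q + t%:C * v q)) = (fun q => Im (u q) + t * Im (v q)).
  by apply/funext => q; rewrite !reimE /=; ring.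
apply: (@in_box_test _ _ (Num.max M N)).
- by rewrite E1; exact: smooth_lin.
- by rewrite E2; exact: smooth_lin.
move=> p pM.
have pMM : M < `|p.1| \/ M < `|p.2| by case: pM; rewrite gt_max => /andP[h1 h2]; [left|right].
have pMN : N < `|p.1| \/ N < `|p.2| by case: pM; rewrite gt_max => /andP[h1 h2]; [left|right].
have {}ua : Re (u p) = 0 := ua p pMM; have {}ub : Im (u p) = 0 := ub p pMM.
have {}va : Re (v p) = 0 := va p pMN; have {}vb : Im (v p) = 0 := vb p pMN.
by apply: complex_ext; rewrite !reimE /= ?ua ?ub ?va ?vb; ring.
Qed.

Lemma shifted_lin u v (t lam nu : R) p : test_function u -> test_function v ->
  shifted lam nu (fun p => u p + t%:C * v p) p = shifted lam nu u p + t%:C * shifted lam nu v p.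
Proof.
move=> [sua sub _] [sva svb _].
rewrite /shifted (H0_exprE (b := fun q => Im (u q) + t * Im (v q)) (a := fun q => Re (u q) + t * Re (v q))); last 4 first.
- by move=> q; rewrite !reimE /=; ring.
- by move=> q; rewrite !reimE /=; ring.
- exact: smooth_lin.
- exact: smooth_lin.
rewrite (H0_exprE _ (fun q => erefl (Re (u q))) (fun q => erefl (Im (u q))))//.
rewrite (H0_exprE _ (fun q => erefl (Re (v q))) (fun q => erefl (Im (v q))))//.
rewrite HR_lin// HI_lin//.
by apply: complex_ext; rewrite !reimE /=; ring.
Qed.

Section Test.
Variables (u : R * R -> R[i]) (lam nu : R).
Hypothesis tu : test_function u.

Lemma test_cL2 : cL2 u.
Proof.
have [M [ba bb]] := test_in_box tu; case: tu => sa sb _.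
exact: (parts_cL2 (fun q => erefl) (fun q => erefl) sa sb ba bb).
Qed.

Lemma test_H0_cL2 : cL2 (H0_expr u).
Proof.
have [M [ba bb]] := test_in_box tu; case: tu => sa sb _.
exact: (H0_cL2 (fun q => erefl) (fun q => erefl) sa sb ba bb).
Qed.

Lemma test_shifted_cL2 : cL2 (shifted lam nu u).
Proof. by apply: cL2B; [exact: test_H0_cL2|apply: cL2Z; exact: test_cL2]. Qed.

Lemma test_dissipation : nu * csq u = cip (fun p => (0 -i* 1) * u p) (shifted lam nu u).
Proof.
have [M [ba bb]] := test_in_box tu; case: tu => sa sb _.
exact: (dissipation lam nu (fun q => erefl) (fun q => erefl) sa sb ba bb).
Qed.

Lemma test_coercive : 0 < nu -> nu ^+ 2 * csq u <= csq (shifted lam nu u).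
Proof.
have [M [ba bb]] := test_in_box tu; case: tu => sa sb _.
exact: (coercive lam (fun q => erefl) (fun q => erefl) sa sb ba bb).
Qed.

Lemma test_smoothing h : cL2 h -> 1 <= `|lam| -> 0 <= nu <= 1 ->
  `|lam| * csq (fun p => (jinv p)%:C * u p) <=
  300 * (Num.sqrt `|lam| * csq u
         + Num.sqrt `|lam| * csq (fun p => shifted lam nu u p - (jinv p)%:C * h p) + csq h).
Proof.
have [M [ba bb]] := test_in_box tu; case: tu => sa sb _.
exact: (smoothing_estimate (fun q => erefl) (fun q => erefl) sa sb ba bb).
Qed.

End Test.

Lemma measurable_jinv : measurable_fun setT (@jinv R).
Proof. exact: continuous_measurable2 cjinv. Qed.

(** The closure is taken for [H0], but subtracting the scalar [z] is continuous, so the same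
    sequences serve for [H0 - z]. Every estimate can then be proved on test functions and passed to
    the limit. *)
Lemma resolventP lam nu f u : resolvent H0 (lam +i* nu) f u <->
  [/\ cL2 f, cL2 u & exists un : nat -> R * R -> R[i],
    [/\ forall n, test_function (un n), csq (fun p => un n p - u p) @[n --> \oo] --> 0
      & csq (fun p => shifted lam nu (un n) p - f p) @[n --> \oo] --> 0]].
Proof.
pose z := lam +i* nu; rewrite -/z; pose zz := Re z ^+ 2 + Im z ^+ 2.
split.
  move=> [/L2P fL2 [v [/L2P uL2 /L2P vL2 [un [gn [H ucvg gcvg]]]] fE]].
  have tun n : test_function (un n) by case: (H n).
  have gE n : gn n = H0_expr (un n) by case: (H n).
  have duL2 n : cL2 (fun p => un n p - u p) by apply: cL2B; [exact: test_cL2|].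
  have dgL2 n : cL2 (fun p => gn n p - v p) by rewrite gE; apply: cL2B; [exact: test_H0_cL2|].
  move/(L2norm_cvg0 duL2): ucvg => ucvg; move/(L2norm_cvg0 dgL2): gcvg => gcvg.
  split => //; exists un; split => //.
  apply: (@ncvg_squeeze0 _ _ (fun n => 2 * csq (fun p => gn n p - v p) + (2 * zz) * csq (fun p => un n p - u p))).
    move=> n; rewrite csq_ge0 /=.
    have zL2 : cL2 (fun p => (- z) * (un n p - u p)) by apply: cL2Z.
    have -> : csq (fun p => shifted lam nu (un n) p - f p) =
       csq (fun p => (gn n p - v p) + (- z) * (un n p - u p)).
      apply: csq_ae.
      - by apply: cL2B; [exact: test_shifted_cL2|].
      - exact: cL2D.
      - move: fE; apply: ae_mono => p ->; rewrite /shifted gE -/z; ring.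
    apply: (le_trans (csq_sum_le (dgL2 n) zL2)); rewrite csqZc// !reimE !sqrrN -/zz; lra.
  rewrite -[X in _ --> X](_ : 2 * 0 + (2 * zz) * 0 = 0); last by ring.
  by apply: ncvgD; apply: ncvgZ.
move=> [fL2 uL2 [un [tun ucvg fcvg]]].
have zuL2 : cL2 (fun p => z * u p) by exact: cL2Z.
have vL2 : cL2 (fun p => f p + z * u p) by exact: cL2D.
have duL2 n : cL2 (fun p => un n p - u p) by apply: cL2B; [exact: test_cL2|].
have dfL2 n : cL2 (fun p => shifted lam nu (un n) p - f p).
  by apply: cL2B; [exact: test_shifted_cL2|].
split; first exact/L2P.
exists (fun p => f p + z * u p); last by apply: aeW => p; rewrite addrK.
split; [exact/L2P|exact/L2P|].
exists un, (fun n => H0_expr (un n)); split => //.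
  by apply/(L2norm_cvg0 duL2).
have dgL2 n : cL2 (fun p => H0_expr (un n) p - (f p + z * u p)).
  by apply: cL2B; [exact: test_H0_cL2|].
apply/(L2norm_cvg0 dgL2).
apply: (@ncvg_squeeze0 _ _ (fun n => 2 * csq (fun p => shifted lam nu (un n) p - f p) + (2 * zz) * csq (fun p => un n p - u p))).
  move=> n; rewrite csq_ge0 /=.
  have zL2 : cL2 (fun p => z * (un n p - u p)) by apply: cL2Z.
  have -> : csq (fun p => H0_expr (un n) p - (f p + z * u p)) =
     csq (fun p => (shifted lam nu (un n) p - f p) + z * (un n p - u p)).
    by apply: csq_ext => p; rewrite /shifted -/z; ring.
  by apply: (le_trans (csq_sum_le (dfL2 n) zL2)); rewrite csqZc// -/zz; lra.
rewrite -[X in _ --> X](_ : 2 * 0 + (2 * zz) * 0 = 0); last by ring.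
by apply: ncvgD; apply: ncvgZ.
Qed.

Section ResolventBounds.
Variables (lam nu : R) (f u : R * R -> R[i]).
Hypothesis fu : resolvent H0 (lam +i* nu) f u.

Lemma resolvent_coercive : 0 < nu -> nu ^+ 2 * csq u <= csq f.
Proof.
move=> nu0; have /resolventP[fL2 uL2 [un [tun ucvg fcvg]]] := fu.
apply: (@ncvg_le _ (fun n => nu ^+ 2 * csq (un n)) (fun n => csq (shifted lam nu (un n)))).
- by move=> n; exact: test_coercive.
- by apply: ncvgZ; apply: csq_cvg ucvg; [move=> n; exact: test_cL2|].
- by apply: csq_cvg fcvg; [move=> n; exact: test_shifted_cL2|].
Qed.

Lemma resolvent_dissipation : nu * csq u = cip (fun p => (0 -i* 1) * u p) f.
Proof.
have /resolventP[fL2 uL2 [un [tun ucvg fcvg]]] := fu.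
have unL2 n : cL2 (un n) by exact: test_cL2.
have snL2 n : cL2 (shifted lam nu (un n)) by exact: test_shifted_cL2.
pose rot g p := (0 -i* 1) * g p : R[i].
have rotL2 g : cL2 g -> cL2 (rot g) by exact: cL2Z.
have l1 : nu * csq (un n) @[n --> \oo] --> nu * csq u by apply: ncvgZ; exact: csq_cvg.
have l2 : cip (rot (un n)) (shifted lam nu (un n)) @[n --> \oo] --> cip (rot u) f.
  apply: (cip_cvg2 _ snL2 _ fL2 _ fcvg); [by move=> n; exact: rotL2|exact: rotL2|].
  apply: (ncvg_ext _ _ ucvg) => // n.
  rewrite -[LHS]csq_rot; apply: csq_ext => p; rewrite /rot; apply: complex_ext; rewrite !reimE /=; ring.
apply: (ncvg_unique l1); apply: (ncvg_ext _ (erefl _) l2) => n.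
by rewrite (test_dissipation lam nu (tun n)).
Qed.

Lemma resolvent_smoothing h : cL2 h -> 1 <= `|lam| -> 0 <= nu <= 1 ->
  `|lam| * csq (fun p => (jinv p)%:C * u p) <=
  300 * (Num.sqrt `|lam| * csq u
         + Num.sqrt `|lam| * csq (fun p => f p - (jinv p)%:C * h p) + csq h).
Proof.
move=> hL2 lam1 nu01.
have /resolventP[fL2 uL2 [un [tun ucvg fcvg]]] := fu.
have unL2 n : cL2 (un n) by exact: test_cL2.
have snL2 n : cL2 (shifted lam nu (un n)) by exact: test_shifted_cL2.
have j01 (p : R * R) : 0 <= jinv p <= 1 by have /andP[h1 ->] := jinv01 p; rewrite ltW.
have jL2 g : cL2 g -> cL2 (fun p => (jinv p)%:C * g p) by exact: jinv_cL2.
apply: (@ncvg_le _ (fun n => `|lam| * csq (fun p => (jinv p)%:C * un n p))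
  (fun n => 300 * (Num.sqrt `|lam| * csq (un n)
     + Num.sqrt `|lam| * csq (fun p => shifted lam nu (un n) p - (jinv p)%:C * h p) + csq h))).
- by move=> n; exact: test_smoothing.
- apply: ncvgZ; apply: csq_cvg => [n||]; [exact: jL2|exact: jL2|].
  apply: (ncvg_squeeze0 _ ucvg) => n; rewrite csq_ge0 /=.
  have [_] := @cL2_bounded _ _ _ mu _ _ measurable_jinv j01 (cL2B (unL2 n) uL2).
  by apply: le_trans; rewrite le_eqVlt; apply/orP; left; apply/eqP; apply: csq_ext => p; rewrite mulrBr.
- apply: ncvgZ; apply: ncvgD; last exact: cvg_cst.
  apply: ncvgD; apply: ncvgZ; first exact: csq_cvg ucvg.
  apply: csq_cvg.
  + by move=> n; apply: cL2B; [|exact: jL2].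
  + by apply: cL2B; [|exact: jL2].
  + by apply: (ncvg_ext _ _ fcvg) => // n; apply: csq_ext => p; ring.
Qed.

(** Coercivity for the differences of the two approximating sequences, which are again test
    functions and whose images tend to [f - f]. *)
Lemma resolvent_unique u' : 0 < nu -> resolvent H0 (lam +i* nu) f u' -> ae_equal u u'.
Proof.
move=> nu0 fu'.
have /resolventP[fL2 uL2 [un [tun ucvg fcvg]]] := fu.
have /resolventP[_ u'L2 [vn [tvn vcvg gcvg]]] := fu'.
have dL2 : cL2 (fun p => u p - u' p) by exact: cL2B.
have unL2 n := test_cL2 (tun n); have vnL2 n := test_cL2 (tvn n).
have suL2 n := test_shifted_cL2 lam nu (tun n); have svL2 n := test_shifted_cL2 lam nu (tvn n).
suff : csq (fun p => u p - u' p) = 0.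
  by move=> /(csq_eq0_ae dL2); apply: ae_mono => p /eqP; rewrite subr_eq0 => /eqP.
have l1 := csq_cvgB unL2 vnL2 uL2 u'L2 ucvg vcvg.
have l2 := csq_cvgB suL2 svL2 fL2 fL2 fcvg gcvg.
have c1 : nu ^+ 2 * csq (fun p => un n p - vn n p) @[n --> \oo] --> nu ^+ 2 * csq (fun p => u p - u' p).
  by apply: ncvgZ; apply: csq_cvg => // n; exact: cL2B.
have c2 : csq (fun p => shifted lam nu (un n) p - shifted lam nu (vn n) p) @[n --> \oo] --> csq (fun p => f p - f p).
  by apply: csq_cvg l2; [move=> n; exact: cL2B|exact: cL2B].
have h : nu ^+ 2 * csq (fun p => u p - u' p) <= csq (fun p => f p - f p).
  apply: ncvg_le c1 c2 => n.
  pose w p := un n p + (-1)%:C * vn n p.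
  have tw : test_function w by exact: test_lin.
  have E1 p : un n p - vn n p = w p by rewrite /w rmorphN1 mulN1r.
  have E2 p : shifted lam nu (un n) p - shifted lam nu (vn n) p = shifted lam nu w p.
    by rewrite shifted_lin// rmorphN1 mulN1r.
  have -> : csq (fun p => un n p - vn n p) = csq w by exact: csq_ext.
  have -> : csq (fun p => shifted lam nu (un n) p - shifted lam nu (vn n) p) = csq (shifted lam nu w).
    exact: csq_ext.
  exact: test_coercive.
have f0 : csq (fun p => f p - f p) = 0.
  rewrite (_ : csq _ = csq (fun p => (0 : R)%:C * f p)).
    by rewrite csqZ// expr0n mul0r.
  by apply: csq_ext => p; rewrite subrr mul0r.
have := csq_ge0 mu (fun p => u p - u' p).
by move: h; rewrite f0 pmulr_rle0 ?exprn_gt0// => h1 h2; apply/eqP; rewrite eq_le h1 h2.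
Qed.

End ResolventBounds.
End Resolvent.

(** * The weighted resolvent *)

(** Here [X = |w u|^2], [U = |u|^2] and [H = |h|^2]. Dissipation bounds [s U] by
    [sqrt (mu X H) / nu], and the arithmetic-geometric mean inequality lets half of [mu X] be
    absorbed on the left. What is left over is [300^2 + 600], below [302^2]. *)
Lemma quadratic_absorb (R : realFieldType) (X U s mu H nu : R) : 0 <= X -> 0 <= H -> 0 < nu <= 1 ->
  s ^+ 2 = mu -> 0 <= s -> 0 <= U -> 0 <= mu ->
  (nu * U) ^+ 2 <= X * H -> mu * X <= 300 * (s * U + H) -> nu ^+ 2 * (mu * X) <= 302 ^+ 2 * H.
Proof.
move=> X0 H0 /andP[nu0 nu1] smu s0 U0 mu0 h1 h2.
have m0 : 0 <= mu * X by exact: mulr_ge0.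
have k : (600 * s * (nu * U)) ^+ 2 <= (nu * (mu * X) + 300 ^+ 2 * H / nu) ^+ 2.
  apply: le_trans (_ : 4 * (mu * X) * (300 ^+ 2 * H) <= _).
    have : s ^+ 2 * ((nu * U) ^+ 2) <= s ^+ 2 * (X * H) by apply: ler_wpM2l; rewrite ?sqr_ge0.
    rewrite [X in _ <= X -> _](_ : _ = mu * X * H); last by rewrite smu; ring.
    move=> h; rewrite (_ : (600 * s * (nu * U)) ^+ 2 = 600 ^+ 2 * (s ^+ 2 * (nu * U) ^+ 2)); last by ring.
    lra.
  have -> : 4 * (mu * X) * (300 ^+ 2 * H) = 4 * (nu * (mu * X)) * (300 ^+ 2 * H / nu).
    by field; rewrite gt_eqF.
  have := sqr_ge0 (nu * (mu * X) - 300 ^+ 2 * H / nu); lra.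
have k2 : 600 * s * (nu * U) <= nu * (mu * X) + 300 ^+ 2 * H / nu.
  have Y0 : 0 <= 600 * s * (nu * U).
    by apply: mulr_ge0; apply: mulr_ge0; [exact: ler0n|exact: s0|exact: ltW|exact: U0].
  have V0 : 0 <= nu * (mu * X) + 300 ^+ 2 * H / nu.
    apply: addr_ge0; first by apply: mulr_ge0; [exact: ltW|exact: m0].
    by apply: divr_ge0; [apply: mulr_ge0; [exact: sqr_ge0|exact: H0]|exact: ltW].
  by move: k; rewrite (@ler_pXn2r _ 2 isT _ _ Y0 V0).
have k3 : nu * (mu * X) <= nu * (300 * (s * U + H)) by apply: ler_wpM2l => //; exact: ltW.
have k4 : nu * (mu * X) <= 300 ^+ 2 * H / nu + 600 * (nu * H) by lra.
have k5 : nu * (nu * (mu * X)) <= nu * (300 ^+ 2 * H / nu + 600 * (nu * H)).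
  by apply: ler_wpM2l => //; exact: ltW.
have k6 : nu * (300 ^+ 2 * H / nu + 600 * (nu * H)) = 300 ^+ 2 * H + 600 * (nu * nu * H).
  by field; rewrite gt_eqF.
have k7 : nu * nu * H <= 1 * H.
  by apply: ler_wpM2r => //; rewrite -expr2; apply: exprn_ile1 => //; exact: ltW.
by rewrite k6 in k5; rewrite expr2; lra.
Qed.

Lemma absorb_ge1 (R : realFieldType) (n c s2 e Z H F G : R) : 0 <= n -> 0 <= c ->
  0 <= Z -> 0 <= e -> n * (s2 * Z) <= c * H -> G <= Z -> 1 <= s2 * e -> H <= F ->
  n * G <= c * e * F.
Proof.
move=> n0 c0 Z0 e0 h1 h2 h3 h4.
apply: (le_trans (ler_wpM2l n0 h2)).
apply: (@le_trans _ _ (n * (s2 * e * Z))).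
  by apply: ler_wpM2l => //; rewrite -[X in X <= _]mul1r; exact: ler_wpM2r.
have -> : n * (s2 * e * Z) = e * (n * (s2 * Z)) by ring.
rewrite (mulrC c) -mulrA; apply: ler_wpM2l => //.
by apply: (le_trans h1); exact: ler_wpM2l.
Qed.

(** Here [Z = |w u|^2], [U = |u|^2], [F1] is the squared norm of the right-hand side and
    [e = s^(-delta)]. With [h = 0] every term of the smoothing bound carries a factor [s], so [s Z]
    is at most [300 (U + F1)], and coercivity exchanges [U] for [F1 / nu^2]. *)
Lemma absorb_le1 (R : realFieldType) (nu s e Z U F1 F G : R) : 0 < nu <= 1 -> 0 < s ->
  0 <= U -> 0 <= F1 -> 0 <= e -> s ^+ 2 * Z <= 300 * (s * U + s * F1) ->
  nu ^+ 2 * U <= F1 -> G <= s * e * Z + e * U -> F1 <= F ->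
  nu ^+ 2 * G <= 302 ^+ 2 * e * F.
Proof.
move=> /andP[n0 n1] s0 U0 F0 e0 h1 h2 h3 h4.
have h5 : s * Z <= 300 * (U + F1).
  rewrite -(ler_pM2l s0); apply: le_trans (le_trans h1 _).
    by rewrite mulrA -expr2.
  by rewrite le_eqVlt; apply/orP; left; apply/eqP; ring.
have n2 : 0 <= nu ^+ 2 by exact: sqr_ge0.
have n21 : nu ^+ 2 <= 1 by apply: exprn_ile1 => //; exact: ltW.
have h6 : nu ^+ 2 * (s * Z + U) <= nu ^+ 2 * (300 * (U + F1) + U).
  by apply: ler_wpM2l => //; lra.
have h7 : nu ^+ 2 * F1 <= 1 * F1 by exact: ler_wpM2r.
have h8 : nu ^+ 2 * (s * Z + U) <= 302 ^+ 2 * F.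
  apply: (le_trans h6); rewrite (_ : nu ^+ 2 * (300 * (U + F1) + U) = 301 * (nu ^+ 2 * U) + 300 * (nu ^+ 2 * F1)); last by ring.
  lra.
apply: (le_trans (ler_wpM2l n2 h3)).
rewrite (_ : nu ^+ 2 * (s * e * Z + e * U) = e * (nu ^+ 2 * (s * Z + U))); last by ring.
by rewrite (_ : 302 ^+ 2 * e * F = e * (302 ^+ 2 * F)); [exact: ler_wpM2l|ring].
Qed.

(** The weight [w] gains [1 / mu = s^-2] in squared norm, and for [delta <= 2] this is at most the
    [s^(-delta)] to be reached. *)
Lemma sqr_powR_ge1 (R : realType) (s delta : R) : 1 <= s -> delta <= 2 ->
  1 <= s ^+ 2 * s `^ (- delta).
Proof.
move=> s1 d2; have s0 : 0 < s by exact: lt_le_trans ltr01 s1.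
have -> : s ^+ 2 = s `^ 2 by rewrite -powR_mulrn// ltW.
rewrite -powRD; last by rewrite (gt_eqF s0) implybT.
by rewrite -[leLHS](powRr0 s); apply: ler_powR; rewrite // subr_ge0.
Qed.

Section WeightedResolvent.
Context {R : realType}.
Implicit Types (u f g h : R * R -> R[i]) (delta lam nu s : R).
Local Notation mu := (@leb2 R).
Local Notation Re := complex.Re.
Local Notation Im := complex.Im.
Local Notation csq := (@csq_on _ _ _ (@leb2 R)).
Local Notation cip := (@cip_on _ _ _ (@leb2 R)).
Local Notation cL2 := (@cL2_on _ _ _ (@leb2 R)).

Lemma weightE delta p : weight delta p = @jinv R p `^ delta.
Proof.
rewrite /weight /jinv -powR_inv1; last exact: le_trans ler01 (jap_ge1 p).
by rewrite -powRrM mulN1r.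
Qed.

Lemma measurable_weight delta : measurable_fun setT (@weight R delta).
Proof.
have -> : @weight R delta = (fun p => jinv p `^ delta).
  by apply/funext => p; rewrite weightE.
exact: (measurableT_comp (measurable_powR delta) measurable_jinv).
Qed.

Lemma weight01 delta (p : R * R) : 0 <= delta -> 0 <= weight delta p <= 1.
Proof.
move=> d0; have /andP[j0 j1] := jinv01 p.
have E : (1 : R) `^ delta = 1 by rewrite powR1.
rewrite weightE powR_ge0 /= -[leRHS]E.
by apply: ge0_ler_powR; rewrite ?nnegrE ?ler01// ltW.
Qed.

Lemma jap_weight01 delta (p : R * R) : 1 <= delta -> 0 <= jap p * weight delta p <= 1.
Proof.
move=> d1; have jp := jap_ge1 p; have /andP[w0 _] := weight01 p (le_trans ler01 d1).
have j0 : 0 < jap p by exact: lt_le_trans ltr01 jp.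
apply/andP; split; first by apply: mulr_ge0 => //; exact: ltW.
have -> : jap p * weight delta p = jap p `^ (1 - delta).
  by rewrite powRD ?(gt_eqF j0) ?implybT// powRr1 ?ltW.
rewrite -[leRHS](powRr0 (jap p)); apply: ler_powR => //; lra.
Qed.

(** The threshold is [w^2 = 1 / s]: below it [w^(2 delta) <= s^(-delta)], above it
    [w^(2 delta - 2) <= s^(1 - delta)]. With [s = sqrt mu] this balances the bounds available for
    [|w u|^2] and [|u|^2]. *)
Lemma weight_split delta s (p : R * R) : 0 <= delta <= 1 -> 1 <= s ->
  weight delta p ^+ 2 <= s `^ (1 - delta) * jinv p ^+ 2 + s `^ (- delta).
Proof.
move=> /andP[d0 d1] s1; have /andP[j0 j1] := jinv01 p.
have s0 : 0 < s by exact: lt_le_trans ltr01 s1.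
set t := jinv p ^+ 2; have t0 : 0 < t by rewrite exprn_gt0.
have -> : weight delta p ^+ 2 = t `^ delta.
  have E (a : R) : 0 <= a -> a ^+ 2 = a `^ 2 by move=> a0; rewrite -powR_mulrn.
  by rewrite weightE /t (E _ (powR_ge0 _ _)) (E _ (ltW j0)) -!powRrM mulrC.
have sd0 : 0 <= s `^ (- delta) by exact: powR_ge0.
have se0 : 0 <= s `^ (1 - delta) by exact: powR_ge0.
have [ts|st] := leP t s^-1.
  apply: le_trans (_ : s `^ (- delta) <= _); last by rewrite lerDr mulr_ge0// ltW.
  have -> : s `^ (- delta) = s^-1 `^ delta.
    by rewrite -powR_inv1 ?(ltW s0)// -powRrM mulN1r.
  by apply: ge0_ler_powR => //; rewrite ?nnegrE ?invr_ge0 ltW.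
apply: le_trans (_ : s `^ (1 - delta) * t <= _); last by rewrite lerDl.
have -> : t `^ delta = t `^ (delta - 1) * t.
  by rewrite -[X in _ * X](powRr1 (ltW t0)) -powRD ?subrK// (gt_eqF t0) implybT.
rewrite ler_pM2r//.
have -> : t `^ (delta - 1) = t^-1 `^ (1 - delta).
  by rewrite -(powR_inv1 (ltW t0)) -powRrM mulN1r opprB.
apply: ge0_ler_powR; rewrite ?nnegrE ?invr_ge0 ?subr_ge0// ?ltW//.
by rewrite -[s]invrK ltf_pV2 ?posrE// invr_gt0.
Qed.

Lemma csq_mul_le (m m' : R * R -> R) f : (forall p, m p ^+ 2 <= m' p ^+ 2) ->
  cL2 (fun p => (m p)%:C * f p) -> cL2 (fun p => (m' p)%:C * f p) ->
  csq (fun p => (m p)%:C * f p) <= csq (fun p => (m' p)%:C * f p).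
Proof.
move=> mm' h h'; apply: I_le; [exact: cip_itg|exact: cip_itg|move=> p].
have E (t : R) z : Re (t%:C * z) * Re (t%:C * z) + Im (t%:C * z) * Im (t%:C * z) =
  t ^+ 2 * (Re z ^+ 2 + Im z ^+ 2) by rewrite !reimE /=; ring.
by rewrite !E; apply: ler_wpM2r => //; apply: addr_ge0; exact: sqr_ge0.
Qed.

Lemma csq_mul2 (m m1 m2 : R * R -> R) (a1 a2 : R) f :
  (forall p, m p ^+ 2 <= a1 * m1 p ^+ 2 + a2 * m2 p ^+ 2) ->
  cL2 (fun p => (m p)%:C * f p) -> cL2 (fun p => (m1 p)%:C * f p) ->
  cL2 (fun p => (m2 p)%:C * f p) ->
  csq (fun p => (m p)%:C * f p) <=
  a1 * csq (fun p => (m1 p)%:C * f p) + a2 * csq (fun p => (m2 p)%:C * f p).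
Proof.
move=> mm h h1 h2; have i1 := cip_itg h1 h1; have i2 := cip_itg h2 h2.
rewrite /csq_on /cip_on -(IZ _ i1) -(IZ _ i2) -ID; [|exact: itgZ|exact: itgZ].
apply: I_le; [exact: cip_itg|by apply: itgD; exact: itgZ|move=> p].
have E (t : R) z : Re (t%:C * z) * Re (t%:C * z) + Im (t%:C * z) * Im (t%:C * z) =
  t ^+ 2 * (Re z ^+ 2 + Im z ^+ 2) by rewrite !reimE /=; ring.
rewrite !E; set z := Re _ ^+ 2 + _; have z0 : 0 <= z by apply: addr_ge0; exact: sqr_ge0.
by have := ler_wpM2r z0 (mm p); rewrite mulrDl !mulrA.
Qed.

Section SandwichBound.
Variables (delta lam nu : R) (f f1 u : R * R -> R[i]).
Hypotheses (nu01 : 0 < nu <= 1) (lam1 : 1 <= `|lam|)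
  (fL2 : cL2 f) (f1L2 : cL2 f1) (ff1 : ae_equal f1 (fun p => (weight delta p)%:C * f p))
  (f1u : resolvent H0 (lam +i* nu) f1 u).

Let uL2 : cL2 u. Proof. by have /resolventP[] := f1u. Qed.
Let wL2 (d : R) g : 0 <= d -> cL2 g -> cL2 (fun p => (weight d p)%:C * g p) /\
  csq (fun p => (weight d p)%:C * g p) <= csq g.
Proof. by move=> d0; apply: cL2_bounded; [exact: measurable_weight|move=> p; exact: weight01]. Qed.
Let nu0 : 0 < nu. Proof. by case/andP: nu01. Qed.
Let nu01' : 0 <= nu <= 1. Proof. by case/andP: nu01 => h ->; rewrite ltW. Qed.
Let s := Num.sqrt `|lam|.
Let s2 : s ^+ 2 = `|lam|. Proof. by rewrite sqr_sqrtr. Qed.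
Let s1 : 1 <= s. Proof. by rewrite -sqrtr1; apply: ler_wsqrtr. Qed.
Let s0 : 0 < s. Proof. exact: lt_le_trans ltr01 s1. Qed.

Let zero_L2 : cL2 (fun=> 0).
Proof. by split; (split; [exact: measurable_cst|rewrite /= expr0n; exact: itg0]). Qed.

Let csq0 : csq (fun=> 0) = 0.
Proof.
rewrite /csq_on /cip_on -[RHS](mul0r (\int[mu]_p 0)) -IZ; last exact: itg0.
by apply: I_ext => p; rewrite /= !mul0r addr0.
Qed.

Lemma sandwich_ge1 : 1 <= delta -> delta <= 2 ->
  nu ^+ 2 * csq (fun p => (weight delta p)%:C * u p) <= 302 ^+ 2 * s `^ (- delta) * csq f.
Proof.
move=> d1 d2; have d0 := le_trans ler01 d1.
pose m p := jap p * weight delta p : R.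
have mm : measurable_fun setT m.
  apply: measurable_funM; last exact: measurable_weight.
  have -> : @jap R = fun p => (jinv p)^-1 by apply/funext => p; rewrite /jinv invrK.
  apply: continuous_measurable2; apply: contV; last exact: cjinv.
  by move=> q; rewrite gt_eqF//; case/andP: (jinv01 q).
have jm p : jinv p * m p = weight delta p.
  by rewrite /m /jinv mulKf// gt_eqF//; exact: lt_le_trans ltr01 (jap_ge1 p).
pose h p := (m p)%:C * f p.
have [hL2 hf] : cL2 h /\ csq h <= csq f.
  by apply: cL2_bounded => // p; exact: jap_weight01.
have f1h : ae_equal f1 (fun p => (jinv p)%:C * h p).
  by move: ff1; apply: ae_mono => p ->; rewrite /h mulrA -rmorphM/= jm.
have jhL2 : cL2 (fun p => (jinv p)%:C * h p) by exact: jinv_cL2.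
have juL2 : cL2 (fun p => (jinv p)%:C * u p) by exact: jinv_cL2.
have rL2 : cL2 (fun p => (0 -i* 1) * u p) by exact: cL2Z.
have := resolvent_smoothing f1u hL2 lam1 nu01'.
rewrite -/s (_ : csq (fun p => f1 p - _) = 0); last first.
  rewrite -csq0; apply: csq_ae => //; first exact: cL2B.
  by move: f1h; apply: ae_mono => p ->; rewrite subrr.
rewrite mulr0 addr0 => sm.
have ds := resolvent_dissipation f1u.
rewrite cipC (cip_ae f1L2 jhL2 rL2 f1h) in ds.
(* Moving the weight from [h] onto [u] makes Cauchy-Schwarz produce [|w u|], the quantity that is
   small, instead of [|u|]. *)
have E : cip (fun p => (jinv p)%:C * h p) (fun p => (0 -i* 1) * u p) =
   cip (fun p => (0 -i* 1) * ((jinv p)%:C * u p)) h.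
  by apply: I_ext => p; rewrite !reimE /=; ring.
have cs : (nu * csq u) ^+ 2 <= csq (fun p => (jinv p)%:C * u p) * csq h.
  rewrite ds E -(csq_rot (fun p => (jinv p)%:C * u p)).
  by apply: cauchy_schwarz => //; exact: cL2Z.
have key := quadratic_absorb (csq_ge0 _ _) (csq_ge0 _ _) nu01 s2 (ltW s0) (csq_ge0 _ _)
   (normr_ge0 lam) cs sm.
have wle : csq (fun p => (weight delta p)%:C * u p) <= csq (fun p => (jinv p)%:C * u p).
  apply: csq_mul_le => //; last by have [] := wL2 d0 uL2.
  move=> p; have /andP[j0 _] := jinv01 p; have /andP[w0 _] := weight01 p d0.
  rewrite ler_pXn2r ?nnegrE ?(ltW j0)// -jm ler_piMr ?(ltW j0)//.
  by case/andP: (jap_weight01 p d1).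
have sd := sqr_powR_ge1 s1 d2; rewrite s2 in sd.
have c0 : 0 <= 302 ^+ 2 :> R by exact: sqr_ge0.
exact: absorb_ge1 (sqr_ge0 _) c0 (csq_ge0 _ _) (powR_ge0 _ _) key wle sd hf.
Qed.

Lemma sandwich_le1 : 0 <= delta <= 1 ->
  nu ^+ 2 * csq (fun p => (weight delta p)%:C * u p) <= 302 ^+ 2 * s `^ (- delta) * csq f.
Proof.
move=> /andP[d0 d1].
have [wuL2 _] := wL2 d0 uL2; have [wfL2 wfle] := wL2 d0 fL2.
have f1f : csq f1 <= csq f by rewrite (csq_ae f1L2 wfL2 ff1).
have juL2 : cL2 (fun p => (jinv p)%:C * u p) by exact: jinv_cL2.
have u1L2 : cL2 (fun p => (1 : R)%:C * u p) by exact: cL2Z.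
have sm := resolvent_smoothing f1u zero_L2 lam1 nu01'.
have co := resolvent_coercive f1u nu0.
have E0 : csq (fun p => f1 p - (jinv p)%:C * 0) = csq f1.
  by apply: csq_ext => p; rewrite mulr0 subr0.
rewrite csq0 addr0 E0 -/s -s2 in sm.
have sp : csq (fun p => (weight delta p)%:C * u p) <=
   s `^ (1 - delta) * csq (fun p => (jinv p)%:C * u p) + s `^ (- delta) * csq (fun p => (1 : R)%:C * u p).
  apply: csq_mul2 => // p; rewrite expr1n mulr1; apply: weight_split => //.
  by rewrite d0.
have sd : s `^ (1 - delta) = s * s `^ (- delta).
  by rewrite powRD ?powRr1 ?(ltW s0)// (gt_eqF s0) implybT.
have E1 : csq (fun p => (1 : R)%:C * u p) = csq u by apply: csq_ext => p; rewrite mul1r.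
rewrite sd E1 in sp.
exact: absorb_le1 nu01 s0 (csq_ge0 _ _) (csq_ge0 _ _) (powR_ge0 _ _) sm co sp f1f.
Qed.

End SandwichBound.
End WeightedResolvent.

(** * Operator norms and exponents *)

Section OperatorNorms.
Context {R : realType}.
Implicit Types (delta lam nu theta : R).
Local Notation mu := (@leb2 R).
Local Notation csq := (@csq_on _ _ _ (@leb2 R)).
Local Notation cL2 := (@cL2_on _ _ _ (@leb2 R)).

Lemma L2norm_le (f : R * R -> R[i]) (K : R) : cL2 f -> 0 <= K ->
  (L2norm f <= K%:E)%E = (csq f <= K ^+ 2).
Proof.
move=> fL2 K0; rewrite L2normE// lee_fin -(@ler_pXn2r _ 2) ?nnegrE ?sqrtr_ge0//.
by rewrite sqr_sqrtr// csq_ge0.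
Qed.

(** Stated for squares, as all norms are compared through [csq]: with [B] the bracket,
    [(B^(delta / 2))^2 = B^delta], and [sqrt mu ^ (- delta)] is the [delta]-th power of
    [mu^(-1/2) <= mu^(- theta) <= B]. *)
Lemma powR_gap delta lam nu theta : 0 < theta <= 1 / 2 -> 0 < delta -> 0 < nu -> 1 <= `|lam| ->
  Num.sqrt `|lam| `^ (- delta) <=
  ((`|lam| `^ (- theta) + (1 + nu) * `|lam|^-1
    + (1 + nu ^- 2) * `|lam| `^ (theta - 1)) `^ (delta / 2)) ^+ 2.
Proof.
move=> /andP[t0 t2] d0 nu0 l1; have l0 : 0 < `|lam| by exact: lt_le_trans ltr01 l1.
set B := _ + _ + _; have B0 : `|lam| `^ (- theta) <= B.
  rewrite /B -addrA lerDl; apply: addr_ge0; apply: mulr_ge0.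
  - by apply: addr_ge0 => //; exact: ltW.
  - by rewrite invr_ge0 ltW.
  - by apply: addr_ge0 => //; rewrite invr_ge0; exact: sqr_ge0.
  - exact: powR_ge0.
have -> : (B `^ (delta / 2)) ^+ 2 = B `^ delta.
  by rewrite -powR_mulrn ?powR_ge0// -powRrM divfK.
have -> : Num.sqrt `|lam| `^ (- delta) = `|lam| `^ (- (1 / 2) * delta).
  by rewrite -powR12_sqrt ?ltW// -powRrM; congr (_ `^ _); rewrite mulrN mulNr div1r.
apply: (@le_trans _ _ ((`|lam| `^ (- theta)) `^ delta)).
  rewrite -powRrM; apply: ler_powR => //; rewrite ler_pM2r//; lra.
by apply: ge0_ler_powR => //; rewrite ?nnegrE ?powR_ge0 ?ltW// (lt_le_trans _ B0)// powR_gt0.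
Qed.

Lemma M_op_norm delta lam nu theta : 0 < theta <= 1 / 2 -> 0 < delta <= 2 -> 0 < nu <= 1 ->
  1 <= `|lam| ->
  (op_norm (M delta lam nu) <=
    (302 * nu^-1 *
         (`|lam| `^ (- theta) + (1 + nu) * `|lam|^-1
          + (1 + nu ^- 2) * `|lam| `^ (theta - 1)) `^ (delta / 2))%:E)%E.
Proof.
move=> t01 /andP[d0 d2] nu01 l1; have /andP[nu0 _] := nu01.
have := powR_gap t01 d0 nu0 l1; move: (X in X `^ (delta / 2)) => B gap.
apply: ge_ereal_sup => _ [f [g [/L2P fL2 /L2P gL2 Mfg f1 ->]]].
case: Mfg => u [v [/L2P _ /L2P vL2 vE] vu] [_ _ gE].
have K0 : 0 <= 302 * nu^-1 * B `^ (delta / 2).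
  by apply: mulr_ge0; [apply: mulr_ge0; [exact: ler0n|rewrite invr_ge0 ltW]|exact: powR_ge0].
rewrite L2norm_le//.
have {}f1 : csq f <= 1 by move: f1; rewrite L2norm_le// expr1n.
have /resolventP[_ uL2 _] := vu.
have wuL2 : cL2 (fun p => (weight delta p)%:C * u p).
  by have [] := @cL2_bounded _ _ _ mu _ _ (measurable_weight delta) (fun p => weight01 p (ltW d0)) uL2.
rewrite (csq_ae gL2 wuL2 gE).
have h : nu ^+ 2 * csq (fun p => (weight delta p)%:C * u p) <=
    302 ^+ 2 * Num.sqrt `|lam| `^ (- delta) * csq f.
  have [d1|d1] := leP delta 1.
    by apply: (sandwich_le1 nu01 l1 fL2 vL2 vE vu); rewrite ltW.
  by apply: (sandwich_ge1 nu01 l1 fL2 vL2 vE vu) => //; exact: ltW.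
rewrite -(@ler_pM2l _ (nu ^+ 2)) ?exprn_gt0//; apply: (le_trans h).
rewrite (_ : nu ^+ 2 * _ = 302 ^+ 2 * (B `^ (delta / 2)) ^+ 2); last by field; rewrite gt_eqF.
apply: (@le_trans _ _ (302 ^+ 2 * Num.sqrt `|lam| `^ (- delta) * 1)).
  by apply: ler_wpM2l f1; apply: mulr_ge0; [exact: sqr_ge0|exact: powR_ge0].
by rewrite mulr1; apply: ler_wpM2l gap; exact: sqr_ge0.
Qed.

Lemma resolvent_bounded lam nu : 0 < nu ->
  (forall f, cL2 f -> exists u, resolvent H0 (lam +i* nu) f u) ->
  resolvent_set H0 (lam +i* nu).
Proof.
move=> nu0 surj; split.
- move=> f /L2P fL2; have [u fu] := surj f fL2; exists u => //.
  by have /resolventP[_ uL2 _] := fu; apply/L2P.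
- by move=> f g h fg fh; exact: (resolvent_unique fg nu0 fh).
apply: (@le_lt_trans _ _ (nu^-1)%:E); last exact: ltry.
apply: ge_ereal_sup => _ [f [g [/L2P fL2 /L2P gL2 fg f1 ->]]].
have n0 : 0 <= nu^-1 by rewrite invr_ge0 ltW.
rewrite L2norm_le//; have {}f1 : csq f <= 1 by move: f1; rewrite L2norm_le// expr1n.
have := resolvent_coercive fg nu0 => h.
by rewrite exprVn -[leRHS]mulr1 ler_pdivlMl ?exprn_gt0//; exact: le_trans f1.
Qed.

End OperatorNorms.

(** * Smooth cutoffs *)

Section Flat.
Context {R : realType}.

(** The functions [x^-m exp (-1 / x)] extended by zero. The power is a parameter because
    differentiating [exp (-1 / x)] stays within the span of this family. *)
Definition flat (m : nat) (x : R) : R := if 0 < x then x^-1 ^+ m * expR (- x^-1) else 0.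

Lemma pow_expRN_le (m : nat) (y : R) : 0 <= y -> y ^+ m * expR (- y) <= m`!%:R.
Proof.
move=> y0; rewrite expRN -ler_pdivlMr ?invr_gt0 ?expR_gt0// invrK.
case: m => [|m]; first by rewrite mul1r expr0 -expR0 ler_expR.
rewrite -ler_pdivrMl ?ltr0n ?fact_gt0// mulrC; apply: le_trans (expR_ge1Dxn m y0).
by rewrite lerDr.
Qed.

Lemma flat_ge0 m x : 0 <= flat m x.
Proof.
rewrite /flat; case: ifP => // x0; apply: mulr_ge0; last exact: expR_ge0.
by apply: exprn_ge0; rewrite invr_ge0 ltW.
Qed.

Lemma flat_le m x : flat m x <= m`!%:R.
Proof.
rewrite /flat; case: ifP => [x0|_]; last exact: ler0n.
by apply: pow_expRN_le; rewrite invr_ge0 ltW.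
Qed.

(** Raising the index by two releases a factor [x^2]; quadratic vanishing is what makes the
    difference quotient at [0] tend to zero. *)
Lemma flat_le_sqr m x : flat m x <= m.+2`!%:R * x ^+ 2.
Proof.
rewrite /flat; case: ifP => [x0|_]; last by apply: mulr_ge0; [exact: ler0n|exact: sqr_ge0].
have -> : x^-1 ^+ m * expR (- x^-1) = x^-1 ^+ m.+2 * expR (- x^-1) * x ^+ 2.
  rewrite !exprS; move: (x^-1 ^+ m) (expR _) => A B; field.
  by rewrite gt_eqF.
by apply: ler_wpM2r; [exact: sqr_ge0|apply: pow_expRN_le; rewrite invr_ge0 ltW].
Qed.

Lemma is_derive_flat m (x : R) :
  is_derive x 1 (flat m) (flat m.+2 x - m%:R * flat m.+1 x).
Proof.
have [x0|x0|x0] := ltgtP 0 x.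
- pose g (y : R) := y^-1 ^+ m * expR (- y^-1).
  have xn0 : x != 0 by rewrite gt_eqF.
  have dV1 : is_derive x 1 (fun y : R => y^-1) (- x^-1 ^+ 2).
    have := is_deriveV (f := id) (x := x) (v := 1 : R) xn0 (is_derive_id _ _).
    by apply: is_derive_eqf => //; rewrite exprVn [_ *: _]mulr1.
  have dg : is_derive x 1 g (flat m.+2 x - m%:R * flat m.+1 x).
    rewrite /g {g}; have d : isd (x, 0) (dir false) (fun q : R * R => q.1^-1 ^+ m * expR (- q.1^-1))
        (flat m.+2 x - m%:R * flat m.+1 x); last exact: ((is_derive_x _ (x, 0) _).2 d).
    have d1 : isd (x, 0) (dir false) (fun q : R * R => q.1^-1) (- x^-1 ^+ 2 * 1).
      exact: (@dcomp _ (x, 0) (dir false) (fun y => y^-1) (fun q => q.1) _ _ dV1 (dfst _ _)).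
    have d2 : isd (x, 0) (dir false) (fun q : R * R => expR (- q.1^-1)) (expR (- x^-1) * - (- x^-1 ^+ 2 * 1)).
      exact: (@dcomp _ (x, 0) (dir false) expR (fun q => - q.1^-1) _ _ (is_derive_expR _) (dN d1)).
    rewrite /flat x0.
    case: m => [|n].
      by apply: isd_eq (dM (dC _ _ (x^-1 ^+ 0)) d2) _; rewrite /=; ring.
    by apply: isd_eq (dM (dX n d1) d2) _; rewrite /= !exprS; ring.
  apply: near_eq_is_derive dg => //.
  have : \forall y \near x, 0 < y by exact: lt_nbhsr.
  by apply: filterS => y y0; rewrite /g /flat y0.
- have -> : flat m.+2 x - m%:R * flat m.+1 x = 0 by rewrite /flat ltNge (ltW x0) /= mulr0 subrr.
  apply: (near_eq_is_derive _ (is_derive_cst (0 : R) x 1)) => //.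
  have : \forall y \near x, y < 0 by exact: lt_nbhsl.
  by apply: filterS => y y0; rewrite /flat ltNge (ltW y0).
- rewrite -{}x0.
  have -> : flat m.+2 0 - m%:R * flat m.+1 0 = 0 :> R by rewrite /flat ltxx mulr0 subrr.
  apply/is_deriveP; apply/cvgrPdist_le => e e0.
  pose K : R := m.+2`!%:R; have K0 : 0 < K by rewrite ltr0n fact_gt0.
  near=> h.
  rewrite sub0r normrN addr0 [h *: 1]mulr1 {2}/flat ltxx subr0 [_ *: _]mulrC.
  have h0 : h != 0 by near: h; exact: nbhs_dnbhs_neq.
  rewrite normrM normfV ler_pdivrMr ?normr_gt0// ger0_norm ?flat_ge0//.
  apply: (le_trans (flat_le_sqr _ _)); rewrite -/K -real_normK ?num_real// expr2 mulrA.
  apply: ler_wpM2r => //; rewrite mulrC -ler_pdivlMr//.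
  near: h; apply: dnbhs0_le; exact: divr_gt0.
Unshelve. all: by end_near. Qed.

End Flat.

Section ElementarySmooth.
Context {R : realType}.
Implicit Types f g : R * R -> R.

(* Stable under partial derivatives, so that [smooth_coind] applies to it. *)
Inductive elem : (R * R -> R) -> Prop :=
| elemC (c : R) : elem (fun=> c)
| elem_fst : elem (fun q => q.1)
| elem_snd : elem (fun q => q.2)
| elemD f g : elem f -> elem g -> elem (fun q => f q + g q)
| elemM f g : elem f -> elem g -> elem (fun q => f q * g q)
| elem_exp f : elem f -> elem (fun q => expR (f q))
| elem_cos f : elem f -> elem (fun q => cos (f q))
| elem_sin f : elem f -> elem (fun q => sin (f q))
| elem_flat m f : elem f -> elem (fun q => flat m (f q)).

Lemma elemN f : elem f -> elem (fun q => - f q).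
Proof.
move=> ef; have -> : (fun q => - f q) = (fun q => (-1) * f q) by apply/funext => q; rewrite mulN1r.
by apply: elemM => //; exact: elemC.
Qed.

Lemma continuous_flat m : continuous (@flat R m).
Proof. by move=> x; exact: (is_derive1_continuous (is_derive_flat m x)). Qed.

Lemma elem_continuous f : elem f -> contf f.
Proof.
elim=> {f} [c|||f g _ cf _ cg|f g _ cf _ cg|f _ cf|f _ cf|f _ cf|m f _ cf].
- exact: contC.
- exact: contfst.
- exact: contsnd.
- exact: contD.
- exact: contM.
- by apply: contcomp cf; exact: continuous_expR.
- by apply: contcomp cf; exact: continuous_cos.
- by apply: contcomp cf; exact: continuous_sin.
- by apply: contcomp cf; exact: continuous_flat.
Qed.

Lemma elem_is_derive b f : elem f -> exists2 g, elem g & forall p, isd p (dir b) f (g p).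
Proof.
elim=> {f} [c|||f g ef [f' ef' df] eg [g' eg' dg]|f g ef [f' ef' df] eg [g' eg' dg]
  |f ef [f' ef' df]|f ef [f' ef' df]|f ef [f' ef' df]|m f ef [f' ef' df]].
- by exists (fun=> 0); [exact: elemC|move=> p; exact: dC].
- by exists (fun=> (dir b).1); [exact: elemC|move=> p; exact: dfst].
- by exists (fun=> (dir b).2); [exact: elemC|move=> p; exact: dsnd].
- by exists (fun q => f' q + g' q); [exact: elemD|move=> p; exact: dD].
- exists (fun q => f' q * g q + f q * g' q); last by move=> p; exact: dM.
  by apply: elemD; exact: elemM.
- exists (fun q => expR (f q) * f' q); first by apply: elemM => //; exact: elem_exp.
  by move=> p; apply: (dcomp (h := expR)) => //; exact: is_derive_expR.
- exists (fun q => - sin (f q) * f' q).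
    by apply: elemM => //; apply: (elemN (f := fun q => sin (f q))); exact: elem_sin.
  by move=> p; apply: (dcomp (h := cos)) => //; exact: is_derive_cos.
- exists (fun q => cos (f q) * f' q); first by apply: elemM => //; exact: elem_cos.
  by move=> p; apply: (dcomp (h := sin)) => //; exact: is_derive_sin.
- exists (fun q => (flat m.+2 (f q) + - (m%:R * flat m.+1 (f q))) * f' q).
    apply: elemM => //; apply: elemD; first exact: elem_flat.
    apply: (elemN (f := fun q => m%:R * flat m.+1 (f q))).
    by apply: elemM; [exact: elemC|exact: elem_flat].
  by move=> p; apply: (dcomp (h := flat m)) => //; exact: is_derive_flat.
Qed.

Lemma elem_smooth f : elem f -> smooth f.
Proof.
apply: smooth_coind => {}f ef; split; first exact: elem_continuous.
move=> b; have [g eg dg] := elem_is_derive b ef; split.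
  by move=> p; have [] := dg p.
have -> : partial b f = g by apply/funext => p; exact: partialE (dg p).
exact: eg.
Qed.

End ElementarySmooth.

(** * Gaussian wave packets *)

Section Growth.
Context {R : realType}.
Implicit Types (f g : R -> R * R -> R) (T : R).

(** The first argument is a parameter: time for the packets, the scale of the cutoff when they are
    truncated. Uniformity in it supplies the majorants for limits and derivatives under the
    integral. As [w2 = <r>^-2], this is decay faster than any power, and [tame] is polynomial
    growth. *)
Definition rapid T f := forall k : nat, exists2 K, 0 <= K &
  forall t p, `|t| <= T -> `|f t p| <= K * w2 p ^+ k.

Definition tame T f := exists (k : nat) K, 0 <= K /\
  forall t p, `|t| <= T -> `|f t p| <= K * (w2 p)^-1 ^+ k.

Let wV1 (p : R * R) : 1 <= (w2 p)^-1.
Proof. by have /andP[h1 h2] := w2_01 p; rewrite -invr1 lef_pV2 ?posrE. Qed.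

Let w0 (p : R * R) : 0 < w2 p.
Proof. by have /andP[] := w2_01 p. Qed.

Lemma tame_weak T f k K m : (k <= m)%N -> 0 <= K ->
  (forall t p, `|t| <= T -> `|f t p| <= K * (w2 p)^-1 ^+ k) ->
  forall t p, `|t| <= T -> `|f t p| <= K * (w2 p)^-1 ^+ m.
Proof.
move=> km K0 h t p tT; apply: (le_trans (h t p tT)); apply: ler_wpM2l => //.
exact: ler_weXn2l.
Qed.

Lemma tameD T f g : tame T f -> tame T g -> tame T (fun t p => f t p + g t p).
Proof.
move=> [k [K [K0 hf]]] [l [L [L0 hg]]]; exists (maxn k l), (K + L); split; first exact: addr_ge0.
move=> t p tT; rewrite mulrDl; apply: (le_trans (ler_normD _ _)); apply: lerD.
  exact: (tame_weak (leq_maxl k l) K0 hf).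
exact: (tame_weak (leq_maxr k l) L0 hg).
Qed.

Lemma tameM T f g : tame T f -> tame T g -> tame T (fun t p => f t p * g t p).
Proof.
move=> [k [K [K0 hf]]] [l [L [L0 hg]]]; exists (k + l)%N, (K * L); split; first exact: mulr_ge0.
move=> t p tT; rewrite normrM exprD mulrACA.
by apply: ler_pM => //; [exact: hf|exact: hg].
Qed.

Lemma tameN T f : tame T f -> tame T (fun t p => - f t p).
Proof.
move=> [k [K [K0 hf]]]; exists k, K; split => // t p tT; rewrite normrN; exact: hf.
Qed.

Lemma tame_bounded T f K : (forall t p, `|t| <= T -> `|f t p| <= K) -> tame T f.
Proof.
move=> hf; exists 0%N, (Num.max K 0); split; first by rewrite le_max lexx orbT.
by move=> t p tT; rewrite expr0 mulr1 le_max hf.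
Qed.

Lemma tameC T (c : R) : tame T (fun _ _ => c).
Proof. exact: (@tame_bounded _ _ `|c|). Qed.

Lemma tame_time T : tame T (fun t _ => t).
Proof. exact: (@tame_bounded _ _ T). Qed.

Let lin_le (x : R) p : x ^+ 2 <= p.1 ^+ 2 + p.2 ^+ 2 -> `|x| <= 1 * (w2 p)^-1 ^+ 1.
Proof.
move=> h; rewrite expr1 mul1r /w2 invrK; apply: le_trans (_ : 1 + x ^+ 2 <= _); last by rewrite lerD2l.
rewrite -(real_normK (num_real x)); have := sqr_ge0 (`|x| - 1); have := normr_ge0 x; move: (`|x|) => y; nra.
Qed.

Lemma tame_fst T : tame T (fun _ p => p.1).
Proof.
exists 1%N, 1; split => // t p _; apply: lin_le; by rewrite lerDl sqr_ge0.
Qed.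

Lemma tame_snd T : tame T (fun _ p => p.2).
Proof.
exists 1%N, 1; split => // t p _; apply: lin_le; by rewrite lerDr sqr_ge0.
Qed.

Lemma rapidD T f g : rapid T f -> rapid T g -> rapid T (fun t p => f t p + g t p).
Proof.
move=> hf hg k; have [K K0 {}hf] := hf k; have [L L0 {}hg] := hg k.
exists (K + L); first exact: addr_ge0.
move=> t p tT; rewrite mulrDl; apply: (le_trans (ler_normD _ _)); apply: lerD; [exact: hf|exact: hg].
Qed.

Lemma rapidN T f : rapid T f -> rapid T (fun t p => - f t p).
Proof.
by move=> hf k; have [K K0 {}hf] := hf k; exists K => // t p tT; rewrite normrN; exact: hf.
Qed.

Lemma rapidM T f g : tame T f -> rapid T g -> rapid T (fun t p => f t p * g t p).
Proof.
move=> [l [L [L0 hf]]] hg k; have [K K0 {}hg] := hg (l + k)%N.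
exists (L * K); first exact: mulr_ge0.
move=> t p tT; rewrite normrM; apply: (le_trans (ler_pM _ _ (hf t p tT) (hg t p tT))) => //.
have wl : (w2 p)^-1 ^+ l * w2 p ^+ l = 1 by rewrite -exprMn mulVf ?gt_eqF// expr1n.
rewrite exprD le_eqVlt; apply/orP; left; apply/eqP.
rewrite -[in RHS](mulr1 (L * K)) -wl; move: ((w2 p)^-1 ^+ l) (w2 p ^+ l) (w2 p ^+ k) => A B C; ring.
Qed.

End Growth.

Ltac tame_rec :=
  lazymatch goal with
  | |- tame _ (fun t p => @GRing.add _ _ _) => apply: tameD; tame_rec
  | |- tame _ (fun t p => @GRing.opp _ _) => apply: tameN; tame_rec
  | |- tame _ (fun t p => @GRing.mul _ _ _) => apply: tameM; tame_rec
  | |- tame _ (fun t p => p.1) => exact: tame_fst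
  | |- tame _ (fun t p => p.2) => exact: tame_snd
  | |- tame _ (fun t p => t) => exact: tame_time
  | |- tame _ (fun t p => (@GRing.natmul _ _ _)) => exact: tameC
  | |- tame _ ?F =>
    first [ match goal with H : tame _ ?G |- _ => constr_eq F G; exact H end | exact: tameC ]
  end.

Ltac rapid_rec :=
  lazymatch goal with
  | |- rapid _ (fun t p => @GRing.add _ _ _) => apply: rapidD; rapid_rec
  | |- rapid _ (fun t p => @GRing.opp _ _) => apply: rapidN; rapid_rec
  | |- rapid _ (fun t p => @GRing.mul _ _ _) => apply: rapidM; [tame_rec | rapid_rec]
  | |- rapid _ ?F => match goal with H : rapid _ ?G |- _ => constr_eq F G; exact H end
  end.

Section CompositionRules.
Context {R : realType}.
Variables (p v : R * R).
Implicit Types f : R * R -> R.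

Lemma dexp f a : isd p v f a -> isd p v (fun q => expR (f q)) (expR (f p) * a).
Proof. by apply: dcomp; exact: is_derive_expR. Qed.
Lemma dcos f a : isd p v f a -> isd p v (fun q => cos (f q)) (- sin (f p) * a).
Proof. by apply: dcomp; exact: is_derive_cos. Qed.
Lemma dsin f a : isd p v f a -> isd p v (fun q => sin (f q)) (cos (f p) * a).
Proof. by apply: dcomp; exact: is_derive_sin. Qed.

Lemma isd_time (f : R -> R) (t d : R) :
  isd (t, 0) (dir false) (fun q => f q.1) d <-> is_derive t 1 f d.
Proof. by split => /(is_derive_x (fun q => f q.1) (t, 0) d). Qed.

End CompositionRules.

(** * Explicit solutions of the damped evolution equation *)

Section Packet.
Context {R : realType}.
Variables (rho lam nu x0 y0 Th : R).
Hypothesis rho01 : 0 <= rho < 1.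
Implicit Types (t : R) (p : R * R).

(* Shape and amplitude of a Gaussian packet as functions of time: they solve the Riccati system
   [grate' = 2 grate gchirp], [gchirp' = 1 - grate^2 + gchirp^2]; [rho = 0] is a coherent state,
   and the initial width tends to [0] as [rho] tends to [1]. *)
Definition gden t := 1 + rho ^+ 2 - 2 * rho * cos (2 * t).
Definition grate t := (1 - rho ^+ 2) / gden t.
Definition gchirp t := - (2 * rho * sin (2 * t)) / gden t.
Definition gamp_re t := (1 - rho * cos (2 * t)) / gden t.
Definition gamp_im t := - (rho * sin (2 * t)) / gden t.

Let rho0 : 0 <= rho. Proof. by case/andP: rho01. Qed.
Let rho1 : 0 < 1 - rho. Proof. by rewrite subr_gt0; case/andP: rho01. Qed.

Lemma gden_bounds t : (1 - rho) ^+ 2 <= gden t <= (1 + rho) ^+ 2.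
Proof.
have := cos_le1 (2 * t); have := cos_geN1 (2 * t); rewrite /gden; move: (cos _) => C h1 h2.
have := ler_wpM2l rho0 h1; have := ler_wpM2l rho0 h2 => h3 h4.
by apply/andP; split; lra.
Qed.

Lemma gden_gt0 t : 0 < gden t.
Proof. by have /andP[h _] := gden_bounds t; apply: lt_le_trans h; rewrite exprn_gt0. Qed.

Let dcs t : isd (t, 0) (dir false) (fun q : R * R => cos (2 * q.1)) (- 2 * sin (2 * t)).
Proof.
have d : isd (t, 0) (dir false) (fun q : R * R => 2 * q.1) 2.
  by apply: isd_eq; [deriv|rewrite /=; ring].
by apply: isd_eq (dcos d) _; rewrite /=; ring.
Qed.

Let dsn t : isd (t, 0) (dir false) (fun q : R * R => sin (2 * q.1)) (2 * cos (2 * t)).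
Proof.
have d : isd (t, 0) (dir false) (fun q : R * R => 2 * q.1) 2.
  by apply: isd_eq; [deriv|rewrite /=; ring].
by apply: isd_eq (dsin d) _; rewrite /=; ring.
Qed.

Let ddn t : isd (t, 0) (dir false) (fun q : R * R => (gden q.1)^-1) (- (gden t)^-1 ^+ 2 * (4 * rho * sin (2 * t))).
Proof.
apply: (dV (f := fun q : R * R => gden q.1)); first by rewrite /= (gt_eqF (gden_gt0 t)).
have h : is_derive _ _ _ _ := dcs t; apply: isd_eq; [rewrite /gden; deriv|rewrite /=; ring].
Qed.

Let dquot t (f : R -> R) d : isd (t, 0) (dir false) (fun q : R * R => f q.1) d ->
  is_derive t 1 (fun s => f s / gden s) ((d * gden t - f t * (4 * rho * sin (2 * t))) / gden t ^+ 2).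
Proof.
move=> h; apply/isd_time; apply: isd_eq (dM h (ddn t)) _ => /=.
by field; rewrite (gt_eqF (gden_gt0 t)).
Qed.

Let cs2 t : cos (2 * t) ^+ 2 = 1 - sin (2 * t) ^+ 2.
Proof. by apply/eqP; rewrite eq_sym subr_eq cos2Dsin2. Qed.

(** With [z = rho exp (-2 i t)], a point rotating at the cyclotron frequency, [grate + i gchirp] is
    the Cayley transform [G = (1 + z) / (1 - z)], [gamp_re + i gamp_im] is [m = 1 / (1 - z)], and
    [gden = |1 - z|^2]. From [z' = -2 i z] one gets [G' = i (1 - G^2)] and [m' = i (1 - G) m]; the
    four derivative lemmas are the real and imaginary parts. *)
Lemma grate_derive t : is_derive t 1 grate (2 * grate t * gchirp t).
Proof.
have d : isd (t, 0) (dir false) (fun q : R * R => 1 - rho ^+ 2) 0 by exact: dC.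
apply: (is_derive_eqf (f := grate) _ _ (dquot (f := fun=> 1 - rho ^+ 2) d)) => //.
by rewrite /grate /gchirp; field; rewrite (gt_eqF (gden_gt0 t)).
Qed.

Lemma gchirp_derive t : is_derive t 1 gchirp (1 - grate t ^+ 2 + gchirp t ^+ 2).
Proof.
have d : isd (t, 0) (dir false) (fun q : R * R => - (2 * rho * sin (2 * q.1))) (- (4 * rho * cos (2 * t))).
  by have h : is_derive _ _ _ _ := dsn t; apply: isd_eq; [deriv|rewrite /=; ring].
apply: (is_derive_eqf (f := gchirp) _ _ (dquot (f := fun s => - (2 * rho * sin (2 * s))) d)) => //.
have n0 : gden t != 0 by rewrite (gt_eqF (gden_gt0 t)).
apply: (canLR (mulfK _)); first by rewrite expf_neq0.
rewrite /grate /gchirp; transitivity (gden t ^+ 2 - (1 - rho ^+ 2) ^+ 2 + (2 * rho * sin (2 * t)) ^+ 2).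
  by rewrite /gden; have := cs2 t; move: (cos _) (sin _) => C S h; ring: h.
by field.
Qed.

Lemma gamp_re_derive t : is_derive t 1 gamp_re (gchirp t * gamp_re t - (1 - grate t) * gamp_im t).
Proof.
have d : isd (t, 0) (dir false) (fun q : R * R => 1 - rho * cos (2 * q.1)) (2 * rho * sin (2 * t)).
  by have h : is_derive _ _ _ _ := dcs t; apply: isd_eq; [deriv|rewrite /=; ring].
apply: (is_derive_eqf (f := gamp_re) _ _ (dquot (f := fun s => 1 - rho * cos (2 * s)) d)) => //.
have n0 : gden t != 0 by rewrite (gt_eqF (gden_gt0 t)).
apply: (canLR (mulfK _)); first by rewrite expf_neq0.
rewrite /grate /gchirp /gamp_re /gamp_im; transitivity (- (2 * rho * sin (2 * t)) * (1 - rho * cos (2 * t)) + (gden t - (1 - rho ^+ 2)) * (rho * sin (2 * t))).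
  by rewrite /gden; have := cs2 t; move: (cos _) (sin _) => C S h; ring: h.
by field.
Qed.

Lemma gamp_im_derive t : is_derive t 1 gamp_im (gchirp t * gamp_im t + (1 - grate t) * gamp_re t).
Proof.
have d : isd (t, 0) (dir false) (fun q : R * R => - (rho * sin (2 * q.1))) (- (2 * rho * cos (2 * t))).
  by have h : is_derive _ _ _ _ := dsn t; apply: isd_eq; [deriv|rewrite /=; ring].
apply: (is_derive_eqf (f := gamp_im) _ _ (dquot (f := fun s => - (rho * sin (2 * s))) d)) => //.
have n0 : gden t != 0 by rewrite (gt_eqF (gden_gt0 t)).
apply: (canLR (mulfK _)); first by rewrite expf_neq0.
rewrite /grate /gchirp /gamp_re /gamp_im; transitivity ((2 * rho * sin (2 * t)) * (rho * sin (2 * t)) + (gden t - (1 - rho ^+ 2)) * (1 - rho * cos (2 * t))).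
  by rewrite /gden; have := cs2 t; move: (cos _) (sin _) => C S h; ring: h.
by field.
Qed.

(* The centre [(x0, y0 + t)] drifts along [y], being driven by the potential [x]. *)
Definition ampl t p := - (grate t / 4) * ((p.1 - x0) ^+ 2 + (p.2 - y0 - t) ^+ 2) - nu * t.
Definition phase t p := Th + (lam - 3 / 4) * t - gchirp t / 4 * ((p.1 - x0) ^+ 2 + (p.2 - y0 - t) ^+ 2)
  - (p.1 - x0) * (p.2 - t + y0) / 2 + (p.2 - t) / 2 - t * p.1.
Definition pk1 t p := expR (ampl t p) * (gamp_re t * cos (phase t p) - gamp_im t * sin (phase t p)).
Definition pk2 t p := expR (ampl t p) * (gamp_re t * sin (phase t p) + gamp_im t * cos (phase t p)).

Definition ampl_t t p := - (2 * grate t * gchirp t / 4) * ((p.1 - x0) ^+ 2 + (p.2 - y0 - t) ^+ 2)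
  + grate t / 2 * (p.2 - y0 - t) - nu + gchirp t.
Definition phase_t t p := lam - 3 / 4
  - (1 - grate t ^+ 2 + gchirp t ^+ 2) / 4 * ((p.1 - x0) ^+ 2 + (p.2 - y0 - t) ^+ 2)
  + gchirp t / 2 * (p.2 - y0 - t) + (p.1 - x0) / 2 - 1 / 2 - p.1 + (1 - grate t).
Definition ampl_s (s : bool) t p := - (grate t / 2) * (if s then p.2 - y0 - t else p.1 - x0).
Definition phase_s (s : bool) t p := if s then - (gchirp t / 2) * (p.2 - y0 - t) - (p.1 - x0) / 2 + 1 / 2
  else - (gchirp t / 2) * (p.1 - x0) - (p.2 - t + y0) / 2 - t.

Lemma elem_packet t : elem (pk1 t) /\ elem (pk2 t).
Proof.
pose X : R * R -> R := fun p => p.1 + (- x0); pose Y : R * R -> R := fun p => p.2 + (- y0 - t).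
have eX : elem X by apply: elemD; [exact: elem_fst|exact: elemC].
have eY : elem Y by apply: elemD; [exact: elem_snd|exact: elemC].
have eQ : elem (fun p => X p * X p + Y p * Y p) by apply: elemD; exact: elemM.
have eE : elem (ampl t).
  have -> : ampl t = (fun p => - (grate t / 4) * (X p * X p + Y p * Y p) + - (nu * t)).
    by apply/funext => p; rewrite /ampl /X /Y; ring.
  by apply: elemD; [apply: elemM; [exact: elemC|]|exact: elemC].
have eG : elem (phase t).
  have -> : phase t = (fun p => (Th + (lam - 3 / 4) * t - t / 2 - t * x0 + y0 / 2 + t / 2) + ((- (gchirp t / 4)) * (X p * X p + Y p * Y p)
      + (X p * ((- (1 / 2)) * (Y p + (2 * y0)) + (- t)) + (1 / 2) * Y p))).
    by apply/funext => p; rewrite /phase /X /Y; field.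
  apply: elemD; first exact: elemC.
  apply: elemD; first by apply: elemM; [exact: elemC|].
  apply: elemD.
    apply: elemM => //; apply: elemD; last exact: elemC.
    by apply: elemM; [exact: elemC|apply: elemD => //; exact: elemC].
  by apply: elemM; [exact: elemC|].
have ec := elem_cos eG; have es := elem_sin eG; have ee := elem_exp eE.
split.
  have -> : pk1 t = (fun p => expR (ampl t p) * (gamp_re t * cos (phase t p) + (- gamp_im t) * sin (phase t p))).
    by apply/funext => p; rewrite /pk1 mulNr.
  by apply: elemM => //; apply: elemD; apply: elemM => //; exact: elemC.
by apply: elemM => //; apply: elemD; apply: elemM => //; exact: elemC.
Qed.

Lemma smooth_pk1 t : smooth (pk1 t). Proof. by apply: elem_smooth; case: (elem_packet t). Qed.
Lemma smooth_pk2 t : smooth (pk2 t). Proof. by apply: elem_smooth; case: (elem_packet t). Qed.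

Let ampl_derive s t p : isd p (dir s) (ampl t) (ampl_s s t p).
Proof.
rewrite /ampl; apply: isd_eq; first by deriv.
by rewrite /ampl_s; case: s; rewrite /dir /=; field.
Qed.

Let phase_derive s t p : isd p (dir s) (phase t) (phase_s s t p).
Proof.
rewrite /phase; apply: isd_eq; first by deriv.
by rewrite /phase_s; case: s; rewrite /dir /=; field.
Qed.

Lemma pk1_derive s t p : isd p (dir s) (pk1 t) (ampl_s s t p * pk1 t p - phase_s s t p * pk2 t p).
Proof.
have dE : is_derive _ _ _ _ := dexp (ampl_derive s t p).
have dc : is_derive _ _ _ _ := dcos (phase_derive s t p).
have ds : is_derive _ _ _ _ := dsin (phase_derive s t p).
by rewrite /pk1; apply: isd_eq; [deriv|rewrite /pk2; ring].
Qed.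

Lemma pk2_derive s t p : isd p (dir s) (pk2 t) (ampl_s s t p * pk2 t p + phase_s s t p * pk1 t p).
Proof.
have dE : is_derive _ _ _ _ := dexp (ampl_derive s t p).
have dc : is_derive _ _ _ _ := dcos (phase_derive s t p).
have ds : is_derive _ _ _ _ := dsin (phase_derive s t p).
by rewrite /pk2; apply: isd_eq; [deriv|rewrite /pk1; ring].
Qed.

Let ampl_tderive t p : isd (t, 0) (dir false) (fun q : R * R => ampl q.1 p) (ampl_t t p - gchirp t).
Proof.
have h1 : is_derive _ _ _ _ := (isd_time _ _ _).2 (grate_derive t).
by rewrite /ampl; apply: isd_eq; [deriv|rewrite /ampl_t /=; field].
Qed.

Let phase_tderive t p : isd (t, 0) (dir false) (fun q : R * R => phase q.1 p) (phase_t t p - (1 - grate t)).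
Proof.
have h1 : is_derive _ _ _ _ := (isd_time _ _ _).2 (gchirp_derive t).
by rewrite /phase; apply: isd_eq; [deriv|rewrite /phase_t /=; field].
Qed.

Lemma pk1_tderive t p : is_derive t 1 (pk1 ^~ p) (ampl_t t p * pk1 t p - phase_t t p * pk2 t p).
Proof.
suff d : isd (t, 0) (dir false) (fun q : R * R => pk1 q.1 p) (ampl_t t p * pk1 t p - phase_t t p * pk2 t p).
  exact: (isd_time _ _ _).1 d.
have h1 : is_derive _ _ _ _ := (isd_time _ _ _).2 (gamp_re_derive t).
have h2 : is_derive _ _ _ _ := (isd_time _ _ _).2 (gamp_im_derive t).
have dE : is_derive _ _ _ _ := dexp (ampl_tderive t p).
have dc : is_derive _ _ _ _ := dcos (phase_tderive t p).
have ds : is_derive _ _ _ _ := dsin (phase_tderive t p).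
by rewrite /pk1; apply: isd_eq; [deriv|rewrite /pk2 /=; ring].
Qed.

Lemma pk2_tderive t p : is_derive t 1 (pk2 ^~ p) (ampl_t t p * pk2 t p + phase_t t p * pk1 t p).
Proof.
suff d : isd (t, 0) (dir false) (fun q : R * R => pk2 q.1 p) (ampl_t t p * pk2 t p + phase_t t p * pk1 t p).
  exact: (isd_time _ _ _).1 d.
have h1 : is_derive _ _ _ _ := (isd_time _ _ _).2 (gamp_re_derive t).
have h2 : is_derive _ _ _ _ := (isd_time _ _ _).2 (gamp_im_derive t).
have dE : is_derive _ _ _ _ := dexp (ampl_tderive t p).
have dc : is_derive _ _ _ _ := dcos (phase_tderive t p).
have ds : is_derive _ _ _ _ := dsin (phase_tderive t p).
by rewrite /pk2; apply: isd_eq; [deriv|rewrite /pk1 /=; ring].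
Qed.

Lemma partial_pk1 s t : partial s (pk1 t) = fun p => ampl_s s t p * pk1 t p - phase_s s t p * pk2 t p.
Proof. by apply/funext => p; apply: partialE; exact: pk1_derive. Qed.

Lemma partial_pk2 s t : partial s (pk2 t) = fun p => ampl_s s t p * pk2 t p + phase_s s t p * pk1 t p.
Proof. by apply/funext => p; apply: partialE; exact: pk2_derive. Qed.

Let ampl_s_derive s t p : isd p (dir s) (ampl_s s t) (- (grate t / 2)).
Proof. by rewrite /ampl_s; case: s; apply: isd_eq; [deriv|rewrite /=; ring|deriv|rewrite /=; ring]. Qed.

Let phase_s_derive s t p : isd p (dir s) (phase_s s t) (- (gchirp t / 2)).
Proof. by rewrite /phase_s; case: s; apply: isd_eq; [deriv|rewrite /=; ring|deriv|rewrite /=; ring]. Qed.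

Lemma partial2_pk1 s t p : partial s (partial s (pk1 t)) p =
  (ampl_s s t p ^+ 2 - phase_s s t p ^+ 2 - grate t / 2) * pk1 t p
  + (gchirp t / 2 - 2 * (ampl_s s t p * phase_s s t p)) * pk2 t p.
Proof.
rewrite partial_pk1; apply: partialE.
have h1 : is_derive _ _ _ _ := ampl_s_derive s t p.
have h2 : is_derive _ _ _ _ := phase_s_derive s t p.
have h3 : is_derive _ _ _ _ := pk1_derive s t p.
have h4 : is_derive _ _ _ _ := pk2_derive s t p.
apply: isd_eq; first by deriv.
ring.
Qed.

Lemma partial2_pk2 s t p : partial s (partial s (pk2 t)) p =
  (ampl_s s t p ^+ 2 - phase_s s t p ^+ 2 - grate t / 2) * pk2 t p
  - (gchirp t / 2 - 2 * (ampl_s s t p * phase_s s t p)) * pk1 t p.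
Proof.
rewrite partial_pk2; apply: partialE.
have h1 : is_derive _ _ _ _ := ampl_s_derive s t p.
have h2 : is_derive _ _ _ _ := phase_s_derive s t p.
have h3 : is_derive _ _ _ _ := pk1_derive s t p.
have h4 : is_derive _ _ _ _ := pk2_derive s t p.
apply: isd_eq; first by deriv.
ring.
Qed.

(* Together: [d psi / dt = - i (H0 - lam - i nu) psi] for [psi = pk1 + i pk2]. *)
Lemma schrodinger1 t p : ampl_t t p * pk1 t p - phase_t t p * pk2 t p =
  HI (pk1 t) (pk2 t) p - lam * pk2 t p - nu * pk1 t p.
Proof.
rewrite /HI !partial2_pk2 partial_pk1 /ampl_t /phase_t /ampl_s /phase_s.
by move: (pk1 t p) (pk2 t p) (grate t) (gchirp t) => a b C1 C2; field.
Qed.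

Lemma schrodinger2 t p : ampl_t t p * pk2 t p + phase_t t p * pk1 t p =
  - (HR (pk1 t) (pk2 t) p - lam * pk1 t p + nu * pk2 t p).
Proof.
rewrite /HR !partial2_pk1 partial_pk2 /ampl_t /phase_t /ampl_s /phase_s.
by move: (pk1 t p) (pk2 t p) (grate t) (gchirp t) => a b C1 C2; field.
Qed.

Lemma amp_sqr t : gamp_re t ^+ 2 + gamp_im t ^+ 2 = (gden t)^-1.
Proof.
have n0 : gden t != 0 by rewrite (gt_eqF (gden_gt0 t)).
have E : (1 - rho * cos (2 * t)) ^+ 2 + (rho * sin (2 * t)) ^+ 2 = gden t.
  by rewrite /gden; have := cs2 t; move: (cos _) (sin _) => C S h; ring: h.
rewrite /gamp_re /gamp_im; transitivity (((1 - rho * cos (2 * t)) ^+ 2 + (rho * sin (2 * t)) ^+ 2) / gden t ^+ 2).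
  by field.
by rewrite E; field.
Qed.

Lemma packet_sqr t p : pk1 t p ^+ 2 + pk2 t p ^+ 2 = expR (ampl t p) ^+ 2 / gden t.
Proof.
rewrite -amp_sqr /pk1 /pk2; have := cos2Dsin2 (phase t p).
move: (cos _) (sin _) (expR _) (gamp_re t) (gamp_im t) => C S E M1 M2 h.
transitivity (E ^+ 2 * (M1 ^+ 2 + M2 ^+ 2) * (C ^+ 2 + S ^+ 2)); first by ring.
by rewrite h mulr1.
Qed.

(** The smallest value of [grate] over time, reached where [gden] is largest: the packet breathes
    but keeps a Gaussian bound uniform in time. *)
Definition width := (1 - rho) / (1 + rho).

Let rho1p : 0 < 1 + rho. Proof. by have := rho0 => h; apply: lt_le_trans ltr01 _; rewrite lerDl. Qed.

Lemma width_gt0 : 0 < width. Proof. exact: divr_gt0. Qed.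

Lemma width_le t : width <= grate t.
Proof.
have /andP[_ h] := gden_bounds t.
rewrite /grate ler_pdivlMr ?gden_gt0//; apply: le_trans (_ : width * (1 + rho) ^+ 2 <= _).
  by apply: ler_wpM2l => //; exact: ltW width_gt0.
by rewrite /width le_eqVlt; apply/orP; left; apply/eqP; field; rewrite gt_eqF.
Qed.

Lemma gdenV_bounds t : 0 < (gden t)^-1 <= (1 - rho) ^- 2.
Proof.
have /andP[h _] := gden_bounds t; rewrite invr_gt0 gden_gt0 /=.
by rewrite lef_pV2 ?posrE ?gden_gt0 ?exprn_gt0.
Qed.

Lemma grate_bounded T : tame T (fun t (_ : R * R) => grate t).
Proof.
apply: (@tame_bounded _ _ _ (1 * (1 - rho) ^- 2)) => t _ _.
have /andP[h1 h2] := gdenV_bounds t.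
rewrite /grate normrM; apply: ler_pM => //; last by rewrite gtr0_norm.
rewrite ler_norml; have := rho0; have := rho1; move=> *; apply/andP; split; nra.
Qed.

Lemma gchirp_bounded T : tame T (fun t (_ : R * R) => gchirp t).
Proof.
apply: (@tame_bounded _ _ _ (2 * (1 - rho) ^- 2)) => t _ _.
have /andP[h1 h2] := gdenV_bounds t.
rewrite /gchirp normrM; apply: ler_pM => //; last by rewrite gtr0_norm.
rewrite normrN !normrM (ger0_norm rho0) (ger0_norm (ler0n _ 2)).
have h3 : `|sin (2 * t)| <= 1 by rewrite ler_norml sin_geN1 sin_le1.
have h4 : rho <= 1 by rewrite -subr_ge0 ltW.
rewrite -mulrA ger_pMr ?ltr0n//; apply: le_trans (_ : 1 * 1 <= _); last by rewrite mulr1.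
exact: ler_pM.
Qed.

(** The bound [y^k exp (- y) <= k!] at [y = K (1 + d)]. The [1] added to [d], needed to dominate
    [1 + r^2], is repaid by the factor [exp K]. *)
Lemma gauss_le_w2 (k : nat) (L K d : R) p : 0 < K -> 0 <= L -> 0 <= d ->
  (w2 p)^-1 <= L * (1 + d) ->
  expR (- K * d) <= (L / K) ^+ k * k`!%:R * expR K * w2 p ^+ k.
Proof.
move=> K0 L0 d0 h; have /andP[w0 _] := w2_01 p.
have u0 : 0 <= K * (1 + d) by apply: mulr_ge0; [exact: ltW|exact: addr_ge0].
have := pow_expRN_le k u0; rewrite (_ : - (K * (1 + d)) = - K * d + - K); last by ring.
rewrite expRD expRN => h1.
have wk : 0 < (w2 p)^-1 ^+ k by rewrite exprn_gt0// invr_gt0.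
rewrite -(ler_pM2l wk) (_ : (w2 p)^-1 ^+ k * (_ * w2 p ^+ k) = (L / K) ^+ k * k`!%:R * expR K); last first.
  rewrite mulrCA -exprMn mulVf ?gt_eqF// expr1n mulr1 //.
have B0 : 0 <= (L / K) ^+ k by apply: exprn_ge0; apply: divr_ge0 => //; exact: ltW.
have a : (w2 p)^-1 ^+ k <= (L / K) ^+ k * (K * (1 + d)) ^+ k.
  rewrite -exprMn; apply: lerXn2r; rewrite ?nnegrE.
  - by rewrite invr_ge0 ltW.
  - by apply: mulr_ge0 => //; apply: divr_ge0 => //; exact: ltW.
  - by apply: (le_trans h); rewrite mulrA divfK// gt_eqF.
apply: (le_trans (ler_wpM2r (expR_ge0 _) a)).
apply: le_trans (ler_wpM2r (expR_ge0 K) (ler_wpM2l B0 h1)).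
have := expR_gt0 K; move: (expR K) (expR _) (_ ^+ k) (_ ^+ k) => F e U V F0.
rewrite le_eqVlt; apply/orP; left; apply/eqP; field.
by rewrite gt_eqF.
Qed.

Let shift_le (x u : R) : x ^+ 2 <= 2 * (x - u) ^+ 2 + 2 * u ^+ 2.
Proof. by have := sqr_ge0 (x - 2 * u); nra. Qed.

Lemma expR_ampl_le T k : exists2 K, 0 <= K & forall t p, `|t| <= T -> expR (ampl t p) <= K * w2 p ^+ k.
Proof.
(* [L] bounds the ratio of [1 + |p|^2] to one plus the squared distance from the moving centre,
   uniformly for [|t| <= T]. It comes from [x^2 <= 2 (x - u)^2 + 2 u^2] with [u = x0] and
   [u = y0 + t]. *)
pose L := 3 + 2 * x0 ^+ 2 + 4 * y0 ^+ 2 + 4 * T ^+ 2.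
have L0 : 0 <= L by rewrite /L; have := sqr_ge0 x0; have := sqr_ge0 y0; have := sqr_ge0 T; lra.
have k0 : 0 < width / 4 by apply: divr_gt0; [exact: width_gt0|exact: ltr0n].
pose C := (L / (width / 4)) ^+ k * k`!%:R * expR (width / 4).
have C0 : 0 <= C.
  apply: mulr_ge0; last exact: expR_ge0.
  by apply: mulr_ge0; [apply: exprn_ge0; apply: divr_ge0 => //; exact: ltW|exact: ler0n].
exists (expR (`|nu| * T) * C); first by apply: mulr_ge0 => //; exact: expR_ge0.
move=> t p tT; pose d := (p.1 - x0) ^+ 2 + (p.2 - y0 - t) ^+ 2.
have d0 : 0 <= d by apply: addr_ge0; exact: sqr_ge0.
have NL : (w2 p)^-1 <= L * (1 + d).
  have t2 : t ^+ 2 <= T ^+ 2.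
    by rewrite -(real_normK (num_real t)); apply: lerXn2r; rewrite ?nnegrE//; exact: le_trans tT.
  have h1 := shift_le p.1 x0; have h2 := shift_le p.2 (y0 + t).
  have h3 : (y0 + t) ^+ 2 <= 2 * y0 ^+ 2 + 2 * t ^+ 2 by have := sqr_ge0 (y0 - t); nra.
  have h4 : 2 * d <= L * d.
    by apply: ler_wpM2r => //; rewrite /L; have := sqr_ge0 x0; have := sqr_ge0 y0; have := sqr_ge0 T; lra.
  have h5 : (p.2 - (y0 + t)) ^+ 2 = (p.2 - y0 - t) ^+ 2 by rewrite opprD addrA.
  rewrite h5 in h2; rewrite /w2 invrK mulrDr mulr1; move: h4; rewrite /L {1}/d => h4.
  by have := sqr_ge0 x0; have := sqr_ge0 y0; have := sqr_ge0 T; lra.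
have := gauss_le_w2 k k0 L0 d0 NL; rewrite -/C => h.
rewrite -mulrA; apply: le_trans (ler_wpM2l (expR_ge0 _) h).
rewrite -expRD ler_expR /ampl -/d addrC; apply: lerD.
  apply: (le_trans (ler_norm _)); rewrite normrN normrM; exact: ler_wpM2l.
rewrite !mulNr lerN2; apply: ler_wpM2r => //; apply: ler_wpM2r; last exact: width_le.
by rewrite invr_ge0 ler0n.
Qed.

Let pk_le t p : `|pk1 t p| <= (1 - rho)^-1 * expR (ampl t p) /\ `|pk2 t p| <= (1 - rho)^-1 * expR (ampl t p).
Proof.
have e0 : 0 <= (1 - rho)^-1 * expR (ampl t p) by apply: mulr_ge0; [rewrite invr_ge0 ltW|exact: expR_ge0].
have h : pk1 t p ^+ 2 + pk2 t p ^+ 2 <= ((1 - rho)^-1 * expR (ampl t p)) ^+ 2.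
  rewrite packet_sqr exprMn mulrC; apply: ler_wpM2r; first exact: sqr_ge0.
  by rewrite exprVn; have /andP[] := gdenV_bounds t.
split; rewrite -(@ler_pXn2r _ 2) ?nnegrE// real_normK ?num_real//; apply: le_trans h.
  by rewrite lerDl sqr_ge0.
by rewrite lerDr sqr_ge0.
Qed.

Lemma rapid_pk1 T : rapid T pk1.
Proof.
move=> k; have [K K0 h] := expR_ampl_le T k; exists ((1 - rho)^-1 * K).
  by apply: mulr_ge0 => //; rewrite invr_ge0 ltW.
move=> t p tT; have [h1 _] := pk_le t p; apply: (le_trans h1); rewrite -mulrA.
by apply: ler_wpM2l; [rewrite invr_ge0 ltW|exact: h].
Qed.

Lemma rapid_pk2 T : rapid T pk2.
Proof.
move=> k; have [K K0 h] := expR_ampl_le T k; exists ((1 - rho)^-1 * K).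
  by apply: mulr_ge0 => //; rewrite invr_ge0 ltW.
move=> t p tT; have [_ h1] := pk_le t p; apply: (le_trans h1); rewrite -mulrA.
by apply: ler_wpM2l; [rewrite invr_ge0 ltW|exact: h].
Qed.

Lemma rapid_partial1 T s : rapid T (fun t p => partial s (pk1 t) p).
Proof.
have h1 := rapid_pk1 T; have h2 := rapid_pk2 T; have h3 := grate_bounded T; have h4 := gchirp_bounded T.
have -> : (fun t p => partial s (pk1 t) p) = (fun t p => ampl_s s t p * pk1 t p - phase_s s t p * pk2 t p).
  by apply/funext => t; exact: partial_pk1.
by rewrite /ampl_s /phase_s; case: s; rapid_rec.
Qed.

Lemma rapid_partial2 T s : rapid T (fun t p => partial s (pk2 t) p).
Proof.
have h1 := rapid_pk1 T; have h2 := rapid_pk2 T; have h3 := grate_bounded T; have h4 := gchirp_bounded T.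
have -> : (fun t p => partial s (pk2 t) p) = (fun t p => ampl_s s t p * pk2 t p + phase_s s t p * pk1 t p).
  by apply/funext => t; exact: partial_pk2.
by rewrite /ampl_s /phase_s; case: s; rapid_rec.
Qed.

Lemma rapid_partial21 T s : rapid T (fun t p => partial s (partial s (pk1 t)) p).
Proof.
have h1 := rapid_pk1 T; have h2 := rapid_pk2 T; have h3 := grate_bounded T; have h4 := gchirp_bounded T.
have -> : (fun t p => partial s (partial s (pk1 t)) p) =
  (fun t p => (ampl_s s t p * ampl_s s t p - phase_s s t p * phase_s s t p - grate t / 2) * pk1 t p
  + (gchirp t / 2 - 2 * (ampl_s s t p * phase_s s t p)) * pk2 t p).
  by apply/funext => t; apply/funext => p; rewrite -!expr2; exact: partial2_pk1.
by rewrite /ampl_s /phase_s; case: s; rapid_rec.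
Qed.

Lemma rapid_partial22 T s : rapid T (fun t p => partial s (partial s (pk2 t)) p).
Proof.
have h1 := rapid_pk1 T; have h2 := rapid_pk2 T; have h3 := grate_bounded T; have h4 := gchirp_bounded T.
have -> : (fun t p => partial s (partial s (pk2 t)) p) =
  (fun t p => (ampl_s s t p * ampl_s s t p - phase_s s t p * phase_s s t p - grate t / 2) * pk2 t p
  - (gchirp t / 2 - 2 * (ampl_s s t p * phase_s s t p)) * pk1 t p).
  by apply/funext => t; apply/funext => p; rewrite -!expr2; exact: partial2_pk2.
by rewrite /ampl_s /phase_s; case: s; rapid_rec.
Qed.

Let tame_ampl_t T : tame T ampl_t.
Proof.
have h3 := grate_bounded T; have h4 := gchirp_bounded T.
have -> : ampl_t = (fun t p => - (2 * grate t * gchirp t / 4) * ((p.1 - x0) * (p.1 - x0) + (p.2 - y0 - t) * (p.2 - y0 - t))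
  + grate t / 2 * (p.2 - y0 - t) - nu + gchirp t).
  by apply/funext => t; apply/funext => p; rewrite /ampl_t !expr2.
by tame_rec.
Qed.

Let tame_phase_t T : tame T phase_t.
Proof.
have h3 := grate_bounded T; have h4 := gchirp_bounded T.
have -> : phase_t = (fun t p => lam - 3 / 4
  - (1 - grate t * grate t + gchirp t * gchirp t) / 4 * ((p.1 - x0) * (p.1 - x0) + (p.2 - y0 - t) * (p.2 - y0 - t))
  + gchirp t / 2 * (p.2 - y0 - t) + (p.1 - x0) / 2 - 1 / 2 - p.1 + (1 - grate t)).
  by apply/funext => t; apply/funext => p; rewrite /phase_t !expr2.
by tame_rec.
Qed.

Lemma rapid_tderive1 T : rapid T (fun t p => ampl_t t p * pk1 t p - phase_t t p * pk2 t p).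
Proof.
have h1 := rapid_pk1 T; have h2 := rapid_pk2 T; have h3 := tame_ampl_t T; have h4 := tame_phase_t T.
by rapid_rec.
Qed.

Lemma rapid_tderive2 T : rapid T (fun t p => ampl_t t p * pk2 t p + phase_t t p * pk1 t p).
Proof.
have h1 := rapid_pk1 T; have h2 := rapid_pk2 T; have h3 := tame_ampl_t T; have h4 := tame_phase_t T.
by rapid_rec.
Qed.
End Packet.

Section ProductIntegrals.
Context {R : realType}.
Local Notation leb := (@lebesgue_measure R).
Local Notation mu := (@leb2 R).
Implicit Types f g : measurableTypeR R -> R.

Lemma itg_prod f g : itg leb f -> itg leb g ->
  itg mu (fun p => f p.1 * g p.2) /\
  \int[mu]_p (f p.1 * g p.2) = \int[leb]_x f x * \int[leb]_x g x.
Proof.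
move=> fi gi; have mf := itg_measurable fi; have mg := itg_measurable gi.
have mfg : measurable_fun setT (fun p : measurableTypeR R * measurableTypeR R => f p.1 * g p.2).
  apply: measurable_funM; first exact: (measurableT_comp mf measurable_fst).
  exact: (measurableT_comp mg measurable_snd).
have fgi : itg mu (fun p => f p.1 * g p.2).
  apply/integrable12ltyP; first exact/measurable_EFinP.
  rewrite (eq_integral (fun x => (`|f x| * \int[leb]_y `|g y|)%:E)) => [|x _].
    have h := itgZ (\int[leb]_y `|g y|) (itg_norm fi).
    rewrite (eq_integral (fun x => ((\int[leb]_y `|g y|) * `|f x|)%:E)) => [|x _].
      by rewrite itg_EFin// ltry.
    by rewrite mulrC.
  have h := itgZ `|f x| (itg_norm gi).
  rewrite (eq_integral (fun y => (`|f x| * `|g y|)%:E)) => [|y _].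
    by rewrite itg_EFin// IZ//; exact: itg_norm.
  by rewrite /= normrM.
split => //.
have := integral12_prod_meas1 fgi.
rewrite (itg_EFin fgi) /fubini_F => E.
apply: EFin_inj; rewrite -[LHS]E.
rewrite (eq_integral (fun x => ((\int[leb]_y g y) * f x)%:E)) => [|x _].
  by rewrite itg_EFin ?IZ//; [rewrite mulrC|exact: itgZ].
have h := itgZ (f x) gi.
transitivity (\int[leb]_y (f x * g y)%:E)%E; first by [].
by rewrite (itg_EFin h) (IZ _ gi) mulrC.
Qed.

Lemma itg_oneDsqrV : itg leb (fun x => (1 + x ^+ 2)^-1).
Proof.
have cf : continuous (fun x : R => (1 + x ^+ 2)^-1) by exact: continuous_oneDsqrV.
apply: ge0_itg.
- exact: continuous_measurable_fun.
- by move=> x; rewrite invr_ge0 addr_ge0// sqr_ge0.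
rewrite ge0_symfun_integralT//=.
- rewrite (_ : [set x | _] = `[0, +oo[%classic); last first.
    by apply/seteqP; split => x/=; rewrite in_itv/= andbT.
  by rewrite integral0y_oneDsqr -EFinM ltry.
- by move=> x; rewrite invr_ge0 addr_ge0// sqr_ge0.
- by move=> x /=; rewrite sqrrN.
Qed.

(** Comparison with a product of one-dimensional Cauchy densities, since
    [(1 + x^2 + y^2)^2 >= (1 + x^2) (1 + y^2)]. This makes [w2] a square-integrable majorant, up to
    a constant, for every rapidly decaying function. *)
Lemma sqitg_w2 : sqitg mu (@w2 R).
Proof.
split; first exact: continuous_measurable2 (@cw2 R).
pose h (x : measurableTypeR R) := (1 + x ^+ 2)^-1.
have [i _] := itg_prod itg_oneDsqrV itg_oneDsqrV.
apply: (@itg_le _ _ _ mu _ (fun p => h p.1 * h p.2)) => //.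
  apply: measurable_funX; exact: continuous_measurable2 (@cw2 R).
move=> p; rewrite ger0_norm ?sqr_ge0// /w2 /h -invfM exprVn lef_pV2 ?posrE.
- have := sqr_ge0 p.1; have := sqr_ge0 p.2; move: (p.1 ^+ 2) (p.2 ^+ 2) => a b a0 b0; nra.
- by apply: exprn_gt0; apply: ltr_wpDr => //; apply: addr_ge0; exact: sqr_ge0.
- by apply: mulr_gt0; apply: ltr_wpDr => //; exact: sqr_ge0.
Qed.

End ProductIntegrals.

(** * Truncation of rapidly decaying functions *)

Section Cutoff.
Context {R : realType}.
Implicit Types (eps : R) (p : R * R) (a b f : R * R -> R).
Local Notation Re := complex.Re.
Local Notation Im := complex.Im.
Local Notation mu := (@leb2 R).
Local Notation I2 := (Rintegral (@leb2 R) setT).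
Local Notation cL2 := (@cL2_on _ _ _ (@leb2 R)).
Local Notation cip := (@cip_on _ _ _ (@leb2 R)).

Definition cutarg eps p : R := 1 - eps * (p.1 ^+ 2 + p.2 ^+ 2).
(** [exp (-1 / (1 - eps r^2))] on the disc of radius [1 / sqrt eps], zero outside. As [eps] tends to
    [0] it tends to the constant [exp (-1)], which is as good as [1] for an integral that has to
    vanish. *)
Definition bump eps p : R := flat 0 (cutarg eps p).
Definition coord (s : bool) p : R := if s then p.2 else p.1.

Lemma elem_bump eps : elem (bump eps).
Proof.
apply: elem_flat.
have -> : cutarg eps = (fun p => 1 + (- eps) * (p.1 * p.1 + p.2 * p.2)).
  by apply/funext => p; rewrite /cutarg !expr2 mulNr.
have e1 := @elem_fst R; have e2 := @elem_snd R.
apply: elemD; [exact: elemC|apply: elemM; [exact: elemC|apply: elemD; exact: elemM]].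
Qed.

Lemma bump_in_box eps : 0 < eps <= 1 -> in_box eps^-1 (bump eps).
Proof.
move=> /andP[e0 e1] p hp; rewrite /bump /flat; case: ifP => //; rewrite /cutarg subr_gt0 => h.
have eV1 : 1 <= eps^-1 by rewrite -invr1 lef_pV2 ?posrE.
have k (x : R) : eps^-1 < `|x| -> 1 <= eps * x ^+ 2.
  move=> hx; rewrite -(real_normK (num_real x)) expr2 mulrA.
  rewrite -[leLHS](mulr1 1); apply: ler_pM => //; last exact: le_trans eV1 (ltW hx).
  by rewrite mulrC -ler_pdivrMr// div1r ltW.
have x0 := sqr_ge0 p.1; have y0 := sqr_ge0 p.2.
by case: hp => /k; nra.
Qed.

Lemma cutarg_derive s eps p : isd p (dir s) (cutarg eps) (- 2 * eps * coord s p).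
Proof. by rewrite /cutarg; apply: isd_eq; [deriv|case: s; rewrite /dir /coord /=; ring]. Qed.

Lemma flat_cutarg_derive m s eps p : isd p (dir s) (fun q => flat m (cutarg eps q))
  ((flat m.+2 (cutarg eps p) - m%:R * flat m.+1 (cutarg eps p)) * (- 2 * eps * coord s p)).
Proof. by apply: (dcomp (h := flat m)); [exact: is_derive_flat|exact: cutarg_derive]. Qed.

Lemma coord_derive s p : isd p (dir s) (coord s) 1.
Proof. by rewrite /coord; case: s; [exact: dsnd|exact: dfst]. Qed.

Lemma partial_bumpM s eps f : smooth f -> partial s (fun q => bump eps q * f q) =
  fun p => (- 2 * eps) * coord s p * flat 2 (cutarg eps p) * f p + bump eps p * partial s f p.
Proof.
move=> sf; apply/funext => p; apply: partialE.
have h1 : is_derive _ _ _ _ := flat_cutarg_derive 0 s eps p.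
have h2 := smooth_is_derive s p sf.
rewrite /bump; apply: isd_eq; [deriv|rewrite /=; gen_partial; ring].
Qed.

Lemma partial2_bumpM s eps f p : smooth f -> partial s (partial s (fun q => bump eps q * f q)) p =
  ((- 2 * eps) * flat 2 (cutarg eps p)
    + 4 * eps ^+ 2 * coord s p ^+ 2 * (flat 4 (cutarg eps p) - 2 * flat 3 (cutarg eps p))) * f p
  + 2 * ((- 2 * eps) * coord s p * flat 2 (cutarg eps p)) * partial s f p
  + bump eps p * partial s (partial s f) p.
Proof.
move=> sf; rewrite partial_bumpM//; apply: partialE.
have h1 : is_derive _ _ _ _ := flat_cutarg_derive 0 s eps p.
have h2 := smooth_is_derive s p sf.
have h3 := smooth_is_derive s p (smooth_partial s sf).
have h4 : is_derive _ _ _ _ := flat_cutarg_derive 2 s eps p.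
have h5 : is_derive _ _ _ _ := coord_derive s p.
rewrite /bump; apply: isd_eq; [deriv|rewrite /=; gen_partial; ring].
Qed.

Variables (v : R * R -> R[i]) (lam nu : R).
Hypothesis vL2 : cL2 v.
Hypothesis vorth : forall u, test_function u -> cip v (shifted lam nu u) = 0.

Variables (a b : R * R -> R).
Hypotheses (ea : elem a) (eb : elem b).
Local Notation dx := (partial false).
Local Notation dy := (partial true).
Local Notation const f := (fun (_ : R) p => f p).

(** Real part of the commutator of [H0] with the bump, applied to [- i (a + i b)] and divided by
    [eps]: each derivative falling on the bump releases a factor [eps]. The imaginary part is
    [errI]. *)
Definition errR eps p :=
  - (- 4 * flat 2 (cutarg eps p) + 4 * eps * (p.1 * p.1 + p.2 * p.2) *
      (flat 4 (cutarg eps p) - 2 * flat 3 (cutarg eps p))) * b p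
  + 4 * flat 2 (cutarg eps p) * (p.1 * dx b p + p.2 * dy b p)
  + 4 * p.1 * p.2 * flat 2 (cutarg eps p) * a p.

Definition errI eps p :=
  (- 4 * flat 2 (cutarg eps p) + 4 * eps * (p.1 * p.1 + p.2 * p.2) *
      (flat 4 (cutarg eps p) - 2 * flat 3 (cutarg eps p))) * a p
  - 4 * flat 2 (cutarg eps p) * (p.1 * dx a p + p.2 * dy a p)
  + 4 * p.1 * p.2 * flat 2 (cutarg eps p) * b p.

Let sa := elem_smooth ea.
Let sb := elem_smooth eb.
(** The truncation of [- i (a + i b)]. With the factor [- i], applying [H0 - z] gives the time
    derivative of a packet rather than a rotation of it. *)
Let wtest eps p : R[i] := (bump eps p * b p) +i* (bump eps p * - a p).

Let wtest_test eps : 0 < eps <= 1 -> test_function (wtest eps).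
Proof.
move=> e01; apply: (@in_box_test _ _ eps^-1).
- by apply: elem_smooth; apply: elemM => //; exact: elem_bump.
- by apply: elem_smooth; apply: elemM; [exact: elem_bump|exact: elemN].
- by move=> p hp; rewrite /wtest (bump_in_box e01 hp) !mul0r.
Qed.

Let mR eps p := bump eps p * (HI a b p - lam * b p - nu * a p) + eps * errR eps p.
Let mI eps p := bump eps p * - (HR a b p - lam * a p + nu * b p) + eps * errI eps p.

Let partialNa s : partial s (fun q => - a q) = fun p => - partial s a p.
Proof. by apply/funext => p; exact: partialN. Qed.

Let wtestE eps p : shifted lam nu (wtest eps) p = mR eps p +i* mI eps p.
Proof.
have sNa : smooth (fun q => - a q) by apply: elem_smooth; exact: elemN.
have s1 : smooth (fun q => bump eps q * b q) by apply: elem_smooth; apply: elemM => //; exact: elem_bump.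
have s2 : smooth (fun q => bump eps q * - a q) by apply: elem_smooth; apply: elemM; [exact: elem_bump|exact: elemN].
rewrite (shiftedE lam nu (a := fun q => bump eps q * b q) (b := fun q => bump eps q * - a q))//.
rewrite /HR /HI (partial2_bumpM false eps p sb) (partial2_bumpM true eps p sb).
rewrite (partial2_bumpM false eps p sNa) (partial2_bumpM true eps p sNa).
rewrite (partial_bumpM false eps sb) (partial_bumpM false eps sNa) !partialNa.
rewrite (partialN false p (smooth_partial false sa)) (partialN true p (smooth_partial true sa)).
rewrite /mR /mI /errR /errI /HR /HI /coord; congr Complex; gen_partial; ring.
Qed.

Hypotheses (ra : rapid 1 (const a)) (rb : rapid 1 (const b))
  (ra1 : forall s, rapid 1 (const (partial s a))) (rb1 : forall s, rapid 1 (const (partial s b)))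
  (ra2 : forall s, rapid 1 (const (partial s (partial s a))))
  (rb2 : forall s, rapid 1 (const (partial s (partial s b)))).

Let tame_flat m : tame 1 (fun eps p => flat m (cutarg eps p)).
Proof. by apply: (@tame_bounded _ _ _ m`!%:R) => t p _; rewrite ger0_norm ?flat_ge0 ?flat_le. Qed.

Let rapid_errR : rapid 1 errR.
Proof.
have f2 := tame_flat 2; have f3 := tame_flat 3; have f4 := tame_flat 4.
have d1 := rb1 false; have d2 := rb1 true.
by rewrite /errR; rapid_rec.
Qed.

Let rapid_errI : rapid 1 errI.
Proof.
have f2 := tame_flat 2; have f3 := tame_flat 3; have f4 := tame_flat 4.
have d1 := ra1 false; have d2 := ra1 true.
by rewrite /errI; rapid_rec.
Qed.

Let rapid_mainR : rapid 1 (const (fun p => HI a b p - lam * b p - nu * a p)).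
Proof.
have d1 := ra1 false; have d2 := rb2 false; have d3 := rb2 true.
have -> : const (fun p => HI a b p - lam * b p - nu * a p) = const (fun p =>
   - dx (dx b) p - dy (dy b) p - 2 * p.2 * dx a p + p.2 * p.2 * b p + p.1 * b p - lam * b p - nu * a p).
  by apply/funext => _; apply/funext => p; rewrite /HI expr2.
by rapid_rec.
Qed.

Let rapid_mainI : rapid 1 (const (fun p => - (HR a b p - lam * a p + nu * b p))).
Proof.
have d1 := rb1 false; have d2 := ra2 false; have d3 := ra2 true.
have -> : const (fun p => - (HR a b p - lam * a p + nu * b p)) = const (fun p =>
   - (- dx (dx a) p - dy (dy a) p + 2 * p.2 * dx b p + p.2 * p.2 * a p + p.1 * a p - lam * a p + nu * b p)).
  by apply/funext => _; apply/funext => p; rewrite /HR expr2.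
by rapid_rec.
Qed.

Let cutoff_cvg (S : R * R -> R) (E : R -> R * R -> R) p : rapid 1 E ->
  bump n.+1%:R^-1 p * S p + n.+1%:R^-1 * E n.+1%:R^-1 p @[n --> \oo] --> expR (-1) * S p.
Proof.
move=> rE; have [K K0 hE] := rE 0%N.
have inv0 : (n.+1%:R^-1 : R) @[n --> \oo] --> 0 by exact: cvg_harmonic.
have inv1 n : `|n.+1%:R^-1 : R| <= 1 by rewrite ger0_norm ?invr_ge0// invf_le1 ?ltr0n// ler1n.
rewrite -[X in _ --> X]addr0; apply: ncvgD.
  rewrite [X in _ --> X]mulrC.
  apply: (@ncvg_ext _ (fun n => S p * bump n.+1%:R^-1 p) _ (S p * expR (-1))) => // [n|].
    by rewrite mulrC.
  apply: ncvgZ.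
  have c : {for 0, continuous (fun eps : R => flat 0 (cutarg eps p))}.
    apply: (@continuous_comp _ _ _ (fun eps : R => cutarg eps p) (flat 0)).
      apply: cvgB; first exact: cvg_cst.
      by apply: cvgMl; exact: cvg_id.
    exact: continuous_flat.
  have : flat 0 (cutarg n.+1%:R^-1 p) @[n --> \oo] --> flat 0 (cutarg 0 p).
    exact: (cvg_comp _ _ inv0 c).
  by rewrite /cutarg mul0r subr0 {2}/flat ltr01 expr0 mul1r invr1.
have h : (K * n.+1%:R^-1) ^+ 2 @[n --> \oo] --> 0.
  apply: (@ncvg_ext _ (fun n => (K * n.+1%:R^-1) * (K * n.+1%:R^-1)) _ ((K * 0) * (K * 0))) => //.
    by rewrite mulr0 mul0r.
  by apply: ncvgM; apply: ncvgZ.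
apply: ncvg_sqr0; apply: (ncvg_squeeze0 _ h) => n; rewrite sqr_ge0 /=.
rewrite -(real_normK (num_real (_ * E _ _))); apply: lerXn2r; rewrite ?nnegrE//.
  by apply: mulr_ge0; rewrite ?invr_ge0.
rewrite normrM mulrC; have := hE _ p (inv1 n); rewrite expr0 mulr1 => h1.
by apply: ler_pM => //; rewrite ger0_norm ?invr_ge0.
Qed.

Let bump_tame : tame 1 (fun eps p => bump eps p).
Proof. exact: (tame_flat 0). Qed.

Let ctest_measurable eps : 0 < eps <= 1 -> measurable_fun setT (fun p => mR eps p) /\ measurable_fun setT (fun p => mI eps p).
Proof.
move=> e01; have [[m1 _] [m2 _]] := test_shifted_cL2 lam nu (wtest_test e01).
split.
  by move: m1; congr (measurable_fun _ _); apply/funext => p; rewrite wtestE.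
by move: m2; congr (measurable_fun _ _); apply/funext => p; rewrite wtestE.
Qed.

(** Dominated convergence at scales [eps = 1 / (n + 1)]: the commutator errors vanish with [eps], a
    multiple of [|v| w2] dominates, and the limit is [exp (-1)] times the integral in question. *)
Lemma cutoff_orthogonal :
  itg mu (fun p => Re (v p) * (HI a b p - lam * b p - nu * a p) + Im (v p) * - (HR a b p - lam * a p + nu * b p)) /\
  I2 (fun p => Re (v p) * (HI a b p - lam * b p - nu * a p) + Im (v p) * - (HR a b p - lam * a p + nu * b p)) = 0.
Proof.
have inv01 n : 0 < (n.+1%:R^-1 : R) <= 1 by rewrite invr_gt0 ltr0n invf_le1 ?ltr0n// ler1n.
have rR : rapid 1 mR by rewrite /mR; have h := rapid_errR; have h' := rapid_mainR; apply: rapidD; apply: rapidM => //; exact: tame_time.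
have rI : rapid 1 mI by rewrite /mI; have h := rapid_errI; have h' := rapid_mainI; apply: rapidD; apply: rapidM => //; exact: tame_time.
have [K K0 hR] := rR 1%N; have [L L0 hI] := rI 1%N.
have [v1 v2] := vL2.
have w2L : sqitg mu (@w2 R) := sqitg_w2.
pose G p := K * `|Re (v p) * w2 p| + L * `|Im (v p) * w2 p|.
have Gi : itg mu G by apply: itgD; apply: itgZ; apply: itg_norm; exact: sqitg_mul.
pose F n p := Re (v p) * mR n.+1%:R^-1 p + Im (v p) * mI n.+1%:R^-1 p.
have [||||fi fl] := @I_dct _ _ _ mu F (fun p => expR (-1) * (Re (v p) * (HI a b p - lam * b p - nu * a p) + Im (v p) * - (HR a b p - lam * a p + nu * b p))) G.
- move=> n; have [h1 h2] := ctest_measurable (inv01 n).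
  by apply: measurable_funD; apply: measurable_funM => //; [case: v1|case: v2].
- exact: Gi.
- move=> n p; have /andP[e0 e1] := inv01 n.
  have en : `|n.+1%:R^-1 : R| <= 1 by rewrite gtr0_norm.
  have wp : 0 <= w2 p :> R by have /andP[/ltW] := w2_01 p.
  apply: (le_trans (ler_normD _ _)); rewrite /G !normrM (ger0_norm wp).
  have := hR _ p en; have := hI _ p en; rewrite expr1 => h1 h2.
  apply: lerD; rewrite mulrCA; exact: ler_wpM2l.
- move=> p.
  apply: (@ncvg_ext _ (fun n => F n p) _ (Re (v p) * (expR (-1) * (HI a b p - lam * b p - nu * a p)) + Im (v p) * (expR (-1) * - (HR a b p - lam * a p + nu * b p)))) => //.
    ring.
  apply: ncvgD; apply: ncvgZ.
    exact: (@cutoff_cvg (fun p => HI a b p - lam * b p - nu * a p) _ p rapid_errR).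
  exact: (@cutoff_cvg (fun p => - (HR a b p - lam * a p + nu * b p)) _ p rapid_errI).
have F0 n : I2 (F n) = 0.
  rewrite -(vorth (wtest_test (inv01 n))); apply: I_ext => p.
  by rewrite wtestE.
have l0 : I2 (F n) @[n --> \oo] --> (0 : R).
  by apply: (@ncvg_ext _ (fun=> 0) _ 0) => //; exact: cvg_cst.
have E := ncvg_unique fl l0.
have e0 := expR_gt0 (-1 : R).
have fi' : itg mu (fun p => Re (v p) * (HI a b p - lam * b p - nu * a p) + Im (v p) * - (HR a b p - lam * a p + nu * b p)).
  have := itgZ (expR (-1))^-1 fi; congr (itg _ _); apply/funext => p.
  by rewrite mulKf// gt_eqF.
split => //; move: E; rewrite (IZ _ fi') => /eqP; rewrite mulf_eq0 gt_eqF//= => /eqP.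
by [].
Qed.

End Cutoff.

Section GaussianKernel.
Context {R : realType}.
Local Notation mu := (@leb2 R).
Local Notation I2 := (Rintegral (@leb2 R) setT).
Implicit Types (s : R) (p q : R * R).

Definition gker s q p := normal_pdf q.1 s p.1 * normal_pdf q.2 s p.2.

Lemma gker_integral s q : itg mu (gker s q) /\ I2 (gker s q) = 1.
Proof.
have i m : itg (@lebesgue_measure R) (normal_pdf m s) by exact: integrable_normal_pdf.
have e m : (\int[@lebesgue_measure R]_x normal_pdf m s x)%R = 1.
  by rewrite /Rintegral integral_normal_pdf.
by have := itg_prod (i q.1) (i q.2); rewrite !e mulr1.
Qed.

Lemma gkerE s q p : 0 < s ->
  gker s q p = normal_peak s ^+ 2 * expR (- ((p.1 - q.1) ^+ 2 + (p.2 - q.2) ^+ 2) / (s ^+ 2 *+ 2)).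
Proof.
move=> s0; have sn0 : s != 0 by rewrite gt_eqF.
rewrite /gker !normal_pdfE// /normal_fun.
rewrite opprD mulrDl expRD; ring.
Qed.

Lemma gker_ge0 s q p : 0 <= gker s q p.
Proof. by apply: mulr_ge0; exact: normal_pdf_ge0. Qed.

(** The constant has to be independent of the centre, because the centre of a packet moves with
    time. *)
Lemma gauss_integral2 (k : R) : 0 < k -> exists C, forall q,
  itg mu (fun p => expR (- k * ((p.1 - q.1) ^+ 2 + (p.2 - q.2) ^+ 2))) /\
  I2 (fun p => expR (- k * ((p.1 - q.1) ^+ 2 + (p.2 - q.2) ^+ 2))) = C.
Proof.
move=> k0; pose s := Num.sqrt (k *+ 2)^-1.
have k2 : 0 < k *+ 2 by rewrite pmulrn_lgt0.
have s0 : 0 < s by rewrite sqrtr_gt0 invr_gt0.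
have s2 : s ^+ 2 = (k *+ 2)^-1 by rewrite sqr_sqrtr// invr_ge0 ltW.
have pk : 0 < normal_peak s by rewrite normal_peak_gt0// gt_eqF.
exists (normal_peak s ^- 2) => q.
have E p : expR (- k * ((p.1 - q.1) ^+ 2 + (p.2 - q.2) ^+ 2)) = normal_peak s ^- 2 * gker s q p.
  rewrite gkerE// mulKf ?expf_neq0 ?gt_eqF//; congr expR.
  by rewrite s2; field; rewrite gt_eqF.
have [gi g1] := gker_integral s q.
have Ef : (fun p => expR (- k * ((p.1 - q.1) ^+ 2 + (p.2 - q.2) ^+ 2))) = (fun p => normal_peak s ^- 2 * gker s q p).
  by apply/funext.
by rewrite Ef; split; [exact: itgZ|rewrite (IZ _ gi) g1 mulr1].
Qed.

End GaussianKernel.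

(** * Constancy and decay of the pairing with a packet *)

Section Pairing.
Context {R : realType}.
Local Notation Re := complex.Re.
Local Notation Im := complex.Im.
Local Notation mu := (@leb2 R).
Local Notation I2 := (Rintegral (@leb2 R) setT).
Local Notation csq := (@csq_on _ _ _ (@leb2 R)).
Local Notation cL2 := (@cL2_on _ _ _ (@leb2 R)).
Local Notation cip := (@cip_on _ _ _ (@leb2 R)).
Variables (v : R * R -> R[i]) (lam nu : R).
Hypothesis nu0 : 0 < nu.
Hypothesis vL2 : cL2 v.
Hypothesis vorth : forall u, test_function u -> cip v (shifted lam nu u) = 0.

(** At a frozen time the packet becomes a constant family, whose parameter can then be read as the
    cutoff scale of [cutoff_orthogonal]. *)
Lemma rapid_at T (f : R -> R * R -> R) t : `|t| <= T -> rapid T f -> rapid 1 (fun _ => f t).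
Proof. by move=> tT rf k; have [K K0 h] := rf k; exists K => // _ p _; exact: h. Qed.

Lemma rapid_dominated T (f g : R -> R * R -> R) : rapid T f -> rapid T g ->
  exists2 G : R * R -> R, itg mu G /\ (forall p, 0 <= G p) & forall t p, `|t| <= T ->
    `|Re (v p) * f t p + Im (v p) * g t p| <= G p.
Proof.
move=> rf rg; have [K K0 hK] := rf 1%N; have [L L0 hL] := rg 1%N.
have [v1 v2] := vL2; have w2L : sqitg mu (@w2 R) := sqitg_w2.
exists (fun p => K * `|Re (v p) * w2 p| + L * `|Im (v p) * w2 p|).
  split; first by apply: itgD; apply: itgZ; apply: itg_norm; exact: sqitg_mul.
  by move=> p; apply: addr_ge0; exact: mulr_ge0.
move=> t p tT; have wp : 0 <= w2 p :> R by have /andP[/ltW] := w2_01 p.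
apply: (le_trans (ler_normD _ _)); rewrite !normrM (ger0_norm wp).
have := hK _ p tT; have := hL _ p tT; rewrite expr1 => h1 h2.
by apply: lerD; rewrite mulrCA; exact: ler_wpM2l.
Qed.

Section FixedPacket.
Variables (rho x0 y0 Th : R).
Hypothesis rho01 : 0 <= rho < 1.
Local Notation pk1 := (pk1 rho lam nu x0 y0 Th).
Local Notation pk2 := (pk2 rho lam nu x0 y0 Th).
Local Notation ampl_t := (ampl_t rho nu x0 y0).
Local Notation phase_t := (phase_t rho lam x0 y0).

Definition pairing t := I2 (fun p => Re (v p) * pk1 t p + Im (v p) * pk2 t p).

Let mpk t : measurable_fun setT (pk1 t) /\ measurable_fun setT (pk2 t).
Proof.
by split; apply: continuous_measurable2; apply: smooth_continuous; [exact: smooth_pk1|exact: smooth_pk2].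
Qed.

Lemma pairing_itg t : itg mu (fun p => Re (v p) * pk1 t p + Im (v p) * pk2 t p).
Proof.
have [G [Gi _] h] := rapid_dominated (rapid_pk1 lam nu x0 y0 Th rho01 `|t|) (rapid_pk2 lam nu x0 y0 Th rho01 `|t|).
have [gamp_re gamp_im] := mpk t; have [[v1 _] [v2 _]] := vL2.
apply: (itg_le _ Gi); last by move=> p; exact: h.
by apply: measurable_funD; exact: measurable_funM.
Qed.

Lemma pairing_derive (t : R) : is_derive t 1 pairing 0.
Proof.
pose dt1 t p := ampl_t t p * pk1 t p - phase_t t p * pk2 t p.
pose dt2 t p := ampl_t t p * pk2 t p + phase_t t p * pk1 t p.
(* The majorant is taken up to [|t| + 1] so that it holds on the whole unit neighbourhood of [t]. *)
have [G [Gi G0] hG] := rapid_dominated (rapid_tderive1 lam nu x0 y0 Th rho01 (`|t| + 1)) (rapid_tderive2 lam nu x0 y0 Th rho01 (`|t| + 1)).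
pose f t p := Re (v p) * pk1 t p + Im (v p) * pk2 t p.
have df (s : R) p : is_derive s 1 (f ^~ p) (Re (v p) * dt1 s p + Im (v p) * dt2 s p).
  suff d : isd (s, 0) (dir false) (fun q : R * R => f q.1 p) (Re (v p) * dt1 s p + Im (v p) * dt2 s p).
    exact: (isd_time _ _ _).1 d.
  have h1 : is_derive _ _ _ _ := (isd_time _ _ _).2 (pk1_tderive lam nu x0 y0 Th rho01 s p).
  have h2 : is_derive _ _ _ _ := (isd_time _ _ _).2 (pk2_tderive lam nu x0 y0 Th rho01 s p).
  by rewrite /f; apply: isd_eq; [deriv|rewrite /dt1 /dt2; ring].
have d1E s p : partial1of2 f s p = Re (v p) * dt1 s p + Im (v p) * dt2 s p.
  by rewrite partial1of2E; have [_ ->] := df s p.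
have tI : `](t - 1), (t + 1)[%classic t by rewrite /= in_itv /= ltrBlDr ltrDl ltr01.
have fi s : `](t - 1), (t + 1)[%classic s -> itg mu (f s) by move=> _; exact: pairing_itg.
have fd s p : `](t - 1), (t + 1)[%classic s -> [set: R * R] p -> derivable (f ^~ p) s 1.
  by move=> _ _; have [] := df s p.
have fG s p : `](t - 1), (t + 1)[%classic s -> [set: R * R] p -> `|partial1of2 f s p| <= G p.
  rewrite /= in_itv /= => /andP[s1 s2] _; rewrite d1E; apply: hG.
  have : `|s - t| <= 1 by rewrite ler_norml; apply/andP; split; lra.
  by have := ler_normD (s - t) t; rewrite subrK addrC => h1 h2; apply: (le_trans h1); rewrite lerD2l.
have dF := @derivable_under_integral _ _ _ mu f setT measurableT t _ _ tI fi fd G G0 Gi fG.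
have eF := @differentiation_under_integral _ _ _ mu f setT measurableT t _ _ tI fi fd G G0 Gi fG.
apply: DeriveDef; first exact: dF.
rewrite -derive1E eF.
have [e1 e2] := elem_packet rho lam nu x0 y0 Th t.
have tt := lexx `|t|.
have [_ E] := cutoff_orthogonal vL2 vorth e1 e2
  (rapid_at tt (rapid_pk1 lam nu x0 y0 Th rho01 `|t|)) (rapid_at tt (rapid_pk2 lam nu x0 y0 Th rho01 `|t|))
  (fun s => rapid_at tt (rapid_partial1 lam nu x0 y0 Th rho01 `|t| s))
  (fun s => rapid_at tt (rapid_partial2 lam nu x0 y0 Th rho01 `|t| s))
  (fun s => rapid_at tt (rapid_partial21 lam nu x0 y0 Th rho01 `|t| s))
  (fun s => rapid_at tt (rapid_partial22 lam nu x0 y0 Th rho01 `|t| s)).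
rewrite -{}E; apply: I_ext => p; rewrite d1E /dt1 /dt2.
by rewrite (schrodinger1 rho lam nu x0 y0 Th t p) (schrodinger2 rho lam nu x0 y0 Th t p).
Qed.

(** Cauchy-Schwarz with the norm of the packet: its Gaussian rate is at least [width], its squared
    amplitude at most [(1 - rho)^-2], and its integral does not see the moving centre, so the only
    dependence on time is the damping. *)
Lemma pairing_decay : exists C, forall t, expR (2 * (nu * t)) * pairing t ^+ 2 <= C.
Proof.
have k0 : 0 < width rho / 2 by apply: divr_gt0; [exact: width_gt0|].
have [C hC] := gauss_integral2 k0.
exists (csq v * ((1 - rho) ^- 2 * C)) => t.
have [gamp_re gamp_im] := mpk t.
pose psi p : R[i] := pk1 t p +i* pk2 t p.
have psi_le p : pk1 t p ^+ 2 + pk2 t p ^+ 2 <= expR (- (2 * (nu * t))) * ((1 - rho) ^- 2 * expR (- (width rho / 2) * ((p.1 - x0) ^+ 2 + (p.2 - (y0 + t)) ^+ 2))).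
  rewrite packet_sqr//; have /andP[_ d] := gdenV_bounds rho01 t.
  rewrite [leRHS]mulrCA [leLHS]mulrC; apply: ler_pM => //.
  - by rewrite invr_ge0 ltW// gden_gt0.
  - rewrite -expRM_natl -expRD ler_expR /ampl opprD addrA.
    have := width_le rho01 t; set d2 := (p.1 - x0) ^+ 2 + _ => h.
    have d0 : 0 <= d2 by apply: addr_ge0; exact: sqr_ge0.
    have := ler_wpM2r d0 h; lra.
have [gi gE] := hC (x0, y0 + t).
have gi' := itgZ (expR (- (2 * (nu * t)))) (itgZ ((1 - rho) ^- 2) gi).
have psiL2 : cL2 psi.
  split; split => //=; apply: (itg_le _ gi') => [|p]; try exact: measurable_funX.
    rewrite ger0_norm ?sqr_ge0//; apply: le_trans (psi_le p); by rewrite lerDl sqr_ge0.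
  rewrite ger0_norm ?sqr_ge0//; apply: le_trans (psi_le p); by rewrite lerDr sqr_ge0.
have pE : pairing t = cip v psi by exact: I_ext.
have cs : pairing t ^+ 2 <= csq v * csq psi by rewrite pE; exact: (cauchy_schwarz vL2 psiL2).
have psi_csq : csq psi <= expR (- (2 * (nu * t))) * ((1 - rho) ^- 2 * C).
  have := I_le (cip_itg psiL2 psiL2) gi'; rewrite (IZ _ (itgZ _ gi)) (IZ _ gi) gE; apply => p.
  by rewrite /= -!expr2; exact: psi_le.
have e0 : 0 <= expR (2 * (nu * t)) by exact: expR_ge0.
apply: (le_trans (ler_wpM2l e0 cs)).
apply: (le_trans (ler_wpM2l e0 (ler_wpM2l (csq_ge0 _ _) psi_csq))).
rewrite expRN le_eqVlt; apply/orP; left; apply/eqP.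
by move: (expR_gt0 (2 * (nu * t))) => h; field; rewrite !gt_eqF ?subr_gt0//; case/andP: rho01.
Qed.

Lemma pairing0 : pairing 0 = 0.
Proof.
have [C hC] := pairing_decay.
have E t : pairing t = pairing 0 by apply: is_derive_0_is_cst => s; exact: pairing_derive.
apply/eqP; apply: contraT => n0.
have F0 : 0 < pairing 0 ^+ 2 by rewrite lt_def sqr_ge0 sqrf_eq0 n0.
(* At this time [1 + 2 nu t], a lower bound of the exponential, already lifts the left-hand side to
   [C] plus the positive number [pairing 0 ^+ 2]. *)
pose t := (C / pairing 0 ^+ 2) / (2 * nu).
have := hC t; rewrite E => h.
have h2 : (1 + 2 * (nu * t)) * pairing 0 ^+ 2 <= C.
  by apply: le_trans h; apply: ler_wpM2r; [exact: sqr_ge0|exact: expR_ge1Dx].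
have h3 : (1 + 2 * (nu * t)) * pairing 0 ^+ 2 = pairing 0 ^+ 2 + C.
  by rewrite /t; field; rewrite n0 gt_eqF.
by move: h2; rewrite h3 gerDr leNgt F0.
Qed.

End FixedPacket.

(** Phase at time zero of the packet centred at [q], normalised to vanish at [p = q]. *)
Definition gphase (q p : R * R) := - ((p.1 - q.1) * (p.2 + q.2)) / 2 + (p.2 - q.2) / 2.

Lemma gker_pairing0 s q Th : 0 < s <= 1 ->
  I2 (fun p => gker s q p * (Re (v p) * cos (Th + gphase q p) + Im (v p) * sin (Th + gphase q p))) = 0.
Proof.
(* [rho] solves [(1 + rho) / (1 - rho) = 2 / s^2], which makes the packet at time zero a Gaussian of
   standard deviation [s]. *)
move=> /andP[s0 s1]; pose rho := (2 - s ^+ 2) / (2 + s ^+ 2).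
have s2 : 0 < s ^+ 2 <= 1 by rewrite exprn_gt0//= exprn_ile1// ltW.
have d0 : 0 < 2 + s ^+ 2 by lra.
have rho01 : 0 <= rho < 1.
  by rewrite /rho ltr_pdivrMr// divr_ge0 ?(ltW d0)//=; lra.
have r1 : 1 - rho != 0 by rewrite gt_eqF// subr_gt0; case/andP: rho01.
(* The shift by [q.2 / 2] compensates the term [p.2 / 2] of [phase], which does not vanish at the
   centre. *)
have E := pairing0 q.1 q.2 (Th - q.2 / 2) rho01.
have dn0E : gden rho 0 = (1 - rho) ^+ 2 by rewrite /gden mulr0 cos0; ring.
have sn0 : s != 0 by rewrite gt_eqF.
have dn0 : 2 + s ^+ 2 != 0 by rewrite gt_eqF.
have c10 : grate rho 0 = 2 / s ^+ 2.
  by rewrite /grate dn0E /rho; field; rewrite dn0 sn0 /=; apply/negP => /eqP; lra.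
have c20 : gchirp rho 0 = 0 by rewrite /gchirp mulr0 sin0 mulr0 oppr0 mul0r.
have m10 : gamp_re rho 0 = (1 - rho)^-1 by rewrite /gamp_re dn0E mulr0 cos0 mulr1; field.
have m20 : gamp_im rho 0 = 0 by rewrite /gamp_im mulr0 sin0 mulr0 oppr0 mul0r.
pose K := normal_peak s ^+ 2 * (1 - rho).
transitivity (K * pairing rho q.1 q.2 (Th - q.2 / 2) 0); last by rewrite E mulr0.
rewrite -IZ; last exact: pairing_itg.
apply: I_ext => p.
have A : ampl rho nu q.1 q.2 0 p = - ((p.1 - q.1) ^+ 2 + (p.2 - q.2) ^+ 2) / (s ^+ 2 *+ 2).
  by rewrite /ampl c10; field.
have P : phase rho lam q.1 q.2 (Th - q.2 / 2) 0 p = Th + gphase q p.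
  by rewrite /phase c20 /gphase; field.
rewrite /pk1 /pk2 A P m10 m20 gkerE// /K.
by move: (expR _) (cos _) (sin _) => e C S; field.
Qed.

End Pairing.

(** * Approximate identity *)

Section Swap.
Context d (T : measurableType d) (R : realType) (m : {sigma_finite_measure set T -> \bar R}).
Local Notation I := (Rintegral m setT).

Lemma Rintegral_swap (h : T * T -> R) : itg (m \x m)%E h ->
  (forall p, itg m (fun q => h (p, q))) -> (forall q, itg m (fun p => h (p, q))) ->
  itg m (fun p => I (fun q => h (p, q))) /\
  I (fun p => I (fun q => h (p, q))) = I (fun q => I (fun p => h (p, q))).
Proof.
move=> hi h1 h2; split.
  have := integrable_fubini_F hi; congr (integrable _ _ _); apply/funext => p.
  exact: (itg_EFin (h1 p)).
rewrite {1}/Rintegral [in RHS]/Rintegral; congr fine.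
transitivity (\int[m]_p (fubini_F m (EFin \o h) p))%E.
  by apply: eq_integral => p _; rewrite /fubini_F; exact/esym/(itg_EFin (h1 p)).
rewrite (integral12_prod_meas1 hi) -(integral21_prod_meas1 hi).
by apply: eq_integral => p _; rewrite /fubini_G; exact: (itg_EFin (h2 p)).
Qed.

Lemma itg_prod_ge0 (H : T * T -> R) (f : T -> R) : measurable_fun setT H ->
  (forall z, 0 <= H z) -> (forall p, 0 <= f p) -> itg m f ->
  (forall q, itg m (fun p => H (p, q))) ->
  (forall q, I (fun p => H (p, q)) = f q) -> itg (m \x m)%E H.
Proof.
move=> mH H0 f0 fi Hi HE; apply/integrable21ltyP; first exact/measurable_EFinP.
rewrite (eq_integral (fun q => (f q)%:E)) => [|q _]; first by rewrite itg_EFin// ltry.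
rewrite (eq_integral (fun p => (H (p, q))%:E)) => [|p _]; first by rewrite itg_EFin// HE.
by rewrite /= ger0_norm.
Qed.

End Swap.

Section ApproximateIdentity.
Context {R : realType}.
Local Notation leb := (@lebesgue_measure R).
Local Notation mu := (@leb2 R).
Local Notation I2 := (Rintegral (@leb2 R) setT).
Implicit Types (s : R) (p q : R * R).

Lemma cos_dist (a b : R) : `|cos (a + b) - cos a| <= `|b|.
Proof.
have key (x h : R) : 0 < h -> `|cos (x + h) - cos x| <= h.
  move=> h0; have [c _ ->] := MVT_is_derive x h0 (fun y => is_derive_cos y).
  rewrite normrM normrN (gtr0_norm h0) ger_pMl// ler_norml sin_geN1 sin_le1 //.
have [b0|b0|<-] := ltgtP 0 b; last by rewrite addr0 subrr normr0.
  by rewrite (gtr0_norm b0); exact: key.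
have h : 0 < - b by rewrite oppr_gt0.
by rewrite (ltr0_norm b0); have := key (a + b) _ h; rewrite addrK distrC.
Qed.

(** The bound depends on the centre through [|q.2|] only, and this stays bounded when [q] runs over
    the support of a test function. *)
Lemma gphase_le q p : `|gphase q p| <=
  (1 + `|q.2|) * (`|p.1 - q.1| + `|p.2 - q.2| + `|p.1 - q.1| * `|p.2 - q.2|).
Proof.
have -> : gphase q p = - ((p.1 - q.1) * ((p.2 - q.2) + 2 * q.2)) / 2 + (p.2 - q.2) / 2.
  by rewrite /gphase; field.
move: (p.1 - q.1) (p.2 - q.2) => X Y.
have h : `|X * (Y + 2 * q.2)| <= `|X| * `|Y| + 2 * (`|X| * `|q.2|).
  rewrite normrM (_ : _ + 2 * _ = `|X| * (`|Y| + 2 * `|q.2|)); last by ring.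
  by apply: ler_wpM2l => //; apply: (le_trans (ler_normD _ _)); rewrite normrM ger0_norm.
move: (X * _) h => A h.
apply: (le_trans (ler_normD _ _)); rewrite !normrM normrN [`|2^-1|]ger0_norm ?invr_ge0//.
have := normr_ge0 X; have := normr_ge0 Y; have := normr_ge0 q.2.
move: (`|A|) (`|X|) (`|Y|) (`|q.2|) h => z x y w h w0 y0 x0.
have := mulr_ge0 x0 y0; have := mulr_ge0 w0 y0; have := mulr_ge0 w0 (mulr_ge0 x0 y0).
by have := mulr_ge0 x0 w0; lra.
Qed.

Lemma gkerC s q p : 0 < s -> gker s q p = gker s p q.
Proof.
move=> s0; rewrite (gkerE q p s0) (gkerE p q s0).
have E (a b : R) : (a - b) ^+ 2 = (b - a) ^+ 2 by ring.
by rewrite (E p.1) (E p.2).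
Qed.

(* [|p - q|] is of size [s] where the kernel lives; the wider kernel absorbs the polynomial. *)
Lemma gker_moment s q p : 0 < s <= 1 ->
  gker s q p * ((1 + ((p.1 - q.1) ^+ 2 + (p.2 - q.2) ^+ 2)) *
    (`|p.1 - q.1| + `|p.2 - q.2| + `|p.1 - q.1| * `|p.2 - q.2|)) <=
  s * (8 * (16 / 3) ^+ 2) * gker (2 * s) q p.
Proof.
move=> /andP[s0 s1].
have s20 : 0 < 2 * s by exact: mulr_gt0.
rewrite (gkerE q p s0) (gkerE q p s20).
move: (p.1 - q.1) (p.2 - q.2) => X Y.
have pk : normal_peak s ^+ 2 = 4 * normal_peak (2 * s) ^+ 2.
  rewrite /normal_peak !exprVn !sqr_sqrtr; last 2 first.
  - by rewrite mulrn_wge0// mulr_ge0 ?pi_ge0// sqr_ge0.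
  - by rewrite mulrn_wge0// mulr_ge0 ?pi_ge0// sqr_ge0.
  by move: (@pi R) (@pi_gt0 R) => P h; field; rewrite (gt_eqF s0) (gt_eqF h).
pose z := (X ^+ 2 + Y ^+ 2) / s ^+ 2.
have z0 : 0 <= z by apply: divr_ge0; [apply: addr_ge0; exact: sqr_ge0|exact: sqr_ge0].
have zE : X ^+ 2 + Y ^+ 2 = s ^+ 2 * z by rewrite /z; field; rewrite gt_eqF.
(* The exponent [z / 2] is split as [z / 8 + 3 z / 8]: the first part is the Gaussian of twice the
   width, the second, a square, absorbs the factor of degree two in [1 + z]. *)
have e1 : expR (- (X ^+ 2 + Y ^+ 2) / (s ^+ 2 *+ 2)) = expR (- (z / 8)) / expR (3 * z / 16) ^+ 2.
  rewrite -expRM_natl -expRN -expRD zE; congr expR; field; rewrite gt_eqF//.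
have e2 : expR (- (X ^+ 2 + Y ^+ 2) / ((2 * s) ^+ 2 *+ 2)) = expR (- (z / 8)).
  by rewrite zE; congr expR; field; rewrite gt_eqF.
rewrite e1 e2 pk.
have absX (t : R) : t ^+ 2 <= s ^+ 2 * z -> `|t| <= s * (1 + z) / 2.
  move=> h; have k : 0 <= (`|t| - s) ^+ 2 by exact: sqr_ge0.
  have : 2 * s * `|t| <= s ^+ 2 * (1 + z).
    move: k h; rewrite -(real_normK (num_real t)); move: (`|t|) => y k h; nra.
  by move=> h1; rewrite -(ler_pM2l s20) (_ : 2 * s * (s * (1 + z) / 2) = s ^+ 2 * (1 + z))//; field.
have hX := absX X; have hY := absX Y.
have {}hX : `|X| <= s * (1 + z) / 2 by apply: hX; rewrite -zE lerDl sqr_ge0.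
have {}hY : `|Y| <= s * (1 + z) / 2 by apply: hY; rewrite -zE lerDr sqr_ge0.
have hXY : `|X| * `|Y| <= s * z.
  have : 2 * (`|X| * `|Y|) <= s ^+ 2 * z.
    rewrite -zE -(real_normK (num_real X)) -(real_normK (num_real Y)).
    have := sqr_ge0 (`|X| - `|Y|); move: `|X| `|Y| => x y; nra.
  have : s ^+ 2 * z <= s * z by apply: ler_wpM2r => //; rewrite expr2 ger_pMl.
  have := mulr_ge0 (normr_ge0 X) (normr_ge0 Y); lra.
have poly : (1 + (X ^+ 2 + Y ^+ 2)) * (`|X| + `|Y| + `|X| * `|Y|) <= (1 + z) * (2 * s * (1 + z)).
  apply: ler_pM.
  - by apply: addr_ge0 => //; apply: addr_ge0; exact: sqr_ge0.
  - by rewrite !addr_ge0// mulr_ge0.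
  - rewrite lerD2l zE -[leRHS]mul1r; apply: ler_wpM2r => //.
    by apply: exprn_ile1 => //; exact: ltW.
  - lra.
have ex : 3 / 16 * (1 + z) <= expR (3 * z / 16).
  by apply: le_trans (expR_ge1Dx _); lra.
have E0 := expR_gt0 (3 * z / 16).
have P0 : 0 <= normal_peak (2 * s) ^+ 2 * expR (- (z / 8)) by apply: mulr_ge0; [exact: sqr_ge0|exact: expR_ge0].
have ex2 : (3 / 16 * (1 + z)) ^+ 2 <= expR (3 * z / 16) ^+ 2.
  by apply: lerXn2r => //; rewrite nnegrE; [apply: mulr_ge0; lra|exact: ltW].
move: E0 ex2 P0 poly; move: (expR (3 * z / 16)) (expR (- (z / 8))) (_ * (`|X| + _ + _)) => E e Q E0 ex2 P0 poly.
have E20 : 0 < E ^+ 2 by exact: exprn_gt0.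
have QE : Q <= 2 * s * (16 / 3) ^+ 2 * E ^+ 2.
  apply: (le_trans poly).
  rewrite (_ : (1 + z) * (2 * s * (1 + z)) = 2 * s * (16 / 3) ^+ 2 * (3 / 16 * (1 + z)) ^+ 2); last by field.
  apply: ler_wpM2l => //; apply: mulr_ge0; last exact: sqr_ge0.
  by apply: mulr_ge0 => //; exact: ltW.
move: P0 pk; set P := normal_peak (2 * s) ^+ 2 => P0 pk.
rewrite (_ : 4 * P * (e / E ^+ 2) * Q = 4 * (P * e) * (Q / E ^+ 2)); last by field; rewrite gt_eqF.
rewrite (_ : s * (8 * (16 / 3) ^+ 2) * (P * e) = 4 * (P * e) * (2 * s * (16 / 3) ^+ 2)); last by ring.
apply: ler_wpM2l; first by apply: mulr_ge0.
by rewrite ler_pdivrMr.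
Qed.

(** The measure of the plane under a name that carries its sigma-finiteness, for Fubini on pairs of
    points of the plane. *)
Definition plane_measure : set (measurableTypeR R * measurableTypeR R)%type -> \bar R := @leb2 R.
HB.instance Definition _ := Measure.on plane_measure.
Lemma plane_measure_sigma_finite : sigma_finite setT plane_measure.
Proof.
have /sigma_finiteP[F [TF ndF Foo]] := sigma_finiteT leb.
exists (fun n => F n `*` F n).
  rewrite -setXTT TF predeqE => -[x y]; split.
    move=> [/= [n _ Fnx] [k _ Fky]]; exists (maxn n k) => //; split.
    - by move: x Fnx; exact/subsetPset/ndF/leq_maxl.
    - by move: y Fky; exact/subsetPset/ndF/leq_maxr.
  by move=> [n _ []/= ? ?]; split; exists n.
move=> k; have [? ?] := Foo k.
split; first exact: measurableX.
by rewrite /plane_measure /leb2 /= product_measure1E// lte_mul_pinfty// ge0_fin_numE.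
Qed.
HB.instance Definition _ := Measure_isSigmaFinite.Build _ _ _ plane_measure plane_measure_sigma_finite.
Definition leb2s : {sigma_finite_measure set _ -> \bar R} := plane_measure.

Lemma mgker s q : measurable_fun setT (gker s q).
Proof. by have [/itg_measurable] := gker_integral s q. Qed.

Lemma gker_sym_integral s p : 0 < s -> itg mu (fun q => gker s q p) /\ I2 (fun q => gker s q p) = 1.
Proof.
move=> s0; have -> : (fun q => gker s q p) = gker s p by apply/funext => q; exact: gkerC.
exact: gker_integral.
Qed.

Lemma gker_ub s q p : gker s q p <= normal_peak s ^+ 2 \/ s = 0.
Proof.
have [->|s0] := eqVneq s 0; [by right|left].
by rewrite expr2; apply: ler_pM; rewrite ?normal_pdf_ge0 ?normal_pdf_ub.
Qed.

Section TestFunctional.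
Variables (phi : R * R -> R) (M L : R).
Hypotheses (M0 : 0 <= M) (cphi : contf phi) (bphi : in_box M phi)
  (phi_le : forall p, `|phi p| <= L)
  (phi_lip : forall p q, `|phi q - phi p| <= L * (`|p.1 - q.1| + `|p.2 - q.2|)).

Let L0 : 0 <= L. Proof. exact: le_trans (normr_ge0 _) (phi_le (0, 0)). Qed.
Let T := (measurableTypeR R * measurableTypeR R)%type.

Let cgphase p : contf (fun q => gphase q p).
Proof. by rewrite /gphase; cont_rec. Qed.

Let ccos Th p : contf (fun q => cos (Th + gphase q p)).
Proof. by apply: contcomp; [exact: continuous_cos|apply: contD; [exact: contC|exact: cgphase]]. Qed.

Let ccosl Th q : contf (fun p => cos (Th + gphase q p)).
Proof.
apply: contcomp; first exact: continuous_cos.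
by apply: contD; [exact: contC|rewrite /gphase; cont_rec].
Qed.

Let not_in_box p : phi p != 0 -> `|p.1| <= M /\ `|p.2| <= M.
Proof.
move=> h; split; rewrite leNgt; apply/negP => hM; move: h; rewrite bphi ?eqxx//.
  by left.
by right.
Qed.

Let diff_le Th p q : `|phi q * cos (Th + gphase q p) - cos Th * phi p| <=
  L * (2 + M) * (`|p.1 - q.1| + `|p.2 - q.2| + `|p.1 - q.1| * `|p.2 - q.2|).
Proof.
rewrite (_ : _ - _ = phi q * (cos (Th + gphase q p) - cos Th) + cos Th * (phi q - phi p)); last by ring.
apply: (le_trans (ler_normD _ _)); rewrite !normrM.
set m := _ + _ + _.
have m0 : 0 <= m by rewrite /m !addr_ge0// mulr_ge0.
have h1 : `|phi q| * `|cos (Th + gphase q p) - cos Th| <= L * ((1 + M) * m).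
  have [->|/not_in_box[_ q2]] := eqVneq (phi q) 0.
    by rewrite normr0 mul0r; apply: mulr_ge0 => //; apply: mulr_ge0 => //; apply: addr_ge0.
  apply: ler_pM => //; apply: (le_trans (cos_dist _ _)); apply: (le_trans (gphase_le _ _)).
  by apply: ler_wpM2r => //; rewrite lerD2l.
have h2 : `|cos Th| * `|phi q - phi p| <= 1 * (L * m).
  apply: ler_pM => //; first by rewrite ler_norml cos_geN1 cos_le1.
  apply: (le_trans (phi_lip _ _)); apply: ler_wpM2l => //.
  by rewrite /m lerDl mulr_ge0.
by apply: (le_trans (lerD h1 h2)); rewrite le_eqVlt; apply/orP; left; apply/eqP; ring.
Qed.

(** Where the left-hand side is nonzero, [p] or [q] lies in the box, so [1 + |p|^2] is at most
    [2 + 4 M^2] times [1 + |p - q|^2]. The factor [w2 p] obtained in this way makes the error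
    integrable against any square-integrable function. *)
Let diff_w2 Th p q : `|phi q * cos (Th + gphase q p) - cos Th * phi p| <=
  w2 p * (L * (2 + M) * (2 + 4 * M ^+ 2)) * ((1 + ((p.1 - q.1) ^+ 2 + (p.2 - q.2) ^+ 2)) *
    (`|p.1 - q.1| + `|p.2 - q.2| + `|p.1 - q.1| * `|p.2 - q.2|)).
Proof.
have /andP[w0 _] := w2_01 p.
have h := diff_le Th p q; set D := `|_| in h *.
set m := (`|p.1 - q.1| + `|p.2 - q.2| + _) in h *.
set r := (p.1 - q.1) ^+ 2 + (p.2 - q.2) ^+ 2.
have r0 : 0 <= r by apply: addr_ge0; exact: sqr_ge0.
have m0 : 0 <= m by rewrite /m !addr_ge0// mulr_ge0.
have A0 : 0 <= L * (2 + M) by apply: mulr_ge0 => //; apply: addr_ge0.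
have M20 := sqr_ge0 M.
have [D0|N] : D = 0 \/ (w2 p)^-1 <= (2 + 4 * M ^+ 2) * (1 + r).
  have sq (x : R) : `|x| <= M -> x ^+ 2 <= M ^+ 2.
    by move=> hx; rewrite -(real_normK (num_real x)); apply: lerXn2r; rewrite ?nnegrE.
  have [p0|/not_in_box[/sq h1 /sq h2]] := eqVneq (phi p) 0; last first.
    by right; rewrite /w2 invrK; have := mulr_ge0 M20 r0; lra.
  have [q0|/not_in_box[/sq h1 /sq h2]] := eqVneq (phi q) 0.
    by left; rewrite /D p0 q0 mul0r mulr0 subr0 normr0.
  right; rewrite /w2 invrK; have := mulr_ge0 M20 r0; rewrite /r.
  have := sqr_ge0 (p.1 - 2 * q.1); have := sqr_ge0 (p.2 - 2 * q.2).
  by move: h1 h2; rewrite !expr2; lra.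
- by rewrite D0; repeat apply: mulr_ge0 => //; [exact: ltW|apply: addr_ge0..] => //; apply: mulr_ge0.
apply: (le_trans h).
rewrite (_ : w2 p * _ * _ = L * (2 + M) * m * (w2 p * ((2 + 4 * M ^+ 2) * (1 + r)))); last by ring.
rewrite -[leLHS]mulr1; apply: ler_wpM2l; first exact: mulr_ge0.
by rewrite -ler_pdivrMl// mulr1.
Qed.

Let C := L * (2 + M) * (2 + 4 * M ^+ 2) * (8 * (16 / 3) ^+ 2).

Let itg_smear Th s p : 0 < s -> itg mu (fun q => phi q * (gker s q p * cos (Th + gphase q p))).
Proof.
move=> s0; have [gi _] := gker_sym_integral p s0.
apply: (itg_le _ (itgZ L gi)).
  apply: measurable_funM; first exact: continuous_measurable2 cphi.
  by apply: measurable_funM; [exact: itg_measurable gi|apply: continuous_measurable2; exact: ccos].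
move=> q; rewrite normrM normrM (ger0_norm (gker_ge0 _ _ _)); apply: ler_pM => //.
  by apply: mulr_ge0 => //; exact: gker_ge0.
by rewrite ler_piMr ?gker_ge0// ler_norml cos_geN1 cos_le1.
Qed.

(** By symmetry the kernel has unit mass in the centre [q] too, so [cos Th * phi p] can be put under
    the integral. The polynomial factor of the difference is then absorbed by the kernel of width
    [2 s], again of unit mass. *)
Lemma smear_bound Th s p : 0 < s <= 1 ->
  `|I2 (fun q => phi q * (gker s q p * cos (Th + gphase q p))) - cos Th * phi p| <= s * C * w2 p.
Proof.
move=> s01; have /andP[s0 s1] := s01; have s20 : 0 < 2 * s by exact: mulr_gt0.
have [gi g1] := gker_sym_integral p s0; have [gi2 g12] := gker_sym_integral p s20.
have si := itg_smear Th p s0; have ci := itgZ (cos Th * phi p) gi.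
have -> : I2 (fun q => phi q * (gker s q p * cos (Th + gphase q p))) - cos Th * phi p =
   I2 (fun q => phi q * (gker s q p * cos (Th + gphase q p)) - cos Th * phi p * gker s q p).
  by rewrite (IB si ci) (IZ _ gi) g1 mulr1.
have di := itgB si ci.
apply: (le_trans (I_norm di)).
rewrite -[leRHS]mulr1 -g12 -(IZ _ gi2).
apply: (I_le (itg_norm di) (itgZ _ gi2)) => q.
have := ler_wpM2l (gker_ge0 s q p) (diff_w2 Th p q).
rewrite -{1}(ger0_norm (gker_ge0 s q p)) -normrM.
rewrite (_ : gker s q p * (_ - _) = phi q * (gker s q p * cos (Th + gphase q p)) - cos Th * phi p * gker s q p); last by ring.
move=> h; apply: (le_trans h); rewrite mulrCA.
have w0 : 0 <= w2 p * (L * (2 + M) * (2 + 4 * M ^+ 2)).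
  have /andP[/ltW w0 _] := w2_01 p; apply: mulr_ge0 => //; apply: mulr_ge0.
    by apply: mulr_ge0 => //; apply: addr_ge0.
  by apply: addr_ge0 => //; apply: mulr_ge0 => //; exact: sqr_ge0.
apply: (le_trans (ler_wpM2l w0 (gker_moment q p s01))).
by rewrite /C le_eqVlt; apply/orP; left; apply/eqP; ring.
Qed.

Let gker_measurable2 s : 0 < s -> measurable_fun setT (fun z : T * T => gker s z.2 z.1).
Proof.
move=> s0.
have m11 : measurable_fun setT (fun z : T * T => z.1.1).
  exact: (measurableT_comp measurable_fst measurable_fst).
have m12 : measurable_fun setT (fun z : T * T => z.1.2).
  exact: (measurableT_comp measurable_snd measurable_fst).
have m21 : measurable_fun setT (fun z : T * T => z.2.1).
  exact: (measurableT_comp measurable_fst measurable_snd).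
have m22 : measurable_fun setT (fun z : T * T => z.2.2).
  exact: (measurableT_comp measurable_snd measurable_snd).
have -> : (fun z : T * T => gker s z.2 z.1) = (fun z : T * T => normal_peak s ^+ 2 *
    expR ((- (s ^+ 2 *+ 2)^-1) * ((z.1.1 - z.2.1) ^+ 2 + (z.1.2 - z.2.2) ^+ 2))).
  by apply/funext => z; rewrite gkerE//; congr (_ * expR _); rewrite mulrC mulrN mulNr.
apply: measurable_funM; first exact: measurable_cst.
apply: (measurableT_comp (@measurable_expR R)).
apply: measurable_funM; first exact: measurable_cst.
by apply: measurable_funD; apply: measurable_funX; exact: measurable_funB.
Qed.

Let smear_measurable (w : T -> R) Th s : 0 < s -> measurable_fun setT w ->
  measurable_fun setT (fun z : T * T =>
    w z.1 * (phi z.2 * (gker s z.2 z.1 * cos (Th + gphase z.2 z.1)))).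
Proof.
move=> s0 mw.
have m11 : measurable_fun setT (fun z : T * T => z.1.1).
  exact: (measurableT_comp measurable_fst measurable_fst).
have m12 : measurable_fun setT (fun z : T * T => z.1.2).
  exact: (measurableT_comp measurable_snd measurable_fst).
have m21 : measurable_fun setT (fun z : T * T => z.2.1).
  exact: (measurableT_comp measurable_fst measurable_snd).
have m22 : measurable_fun setT (fun z : T * T => z.2.2).
  exact: (measurableT_comp measurable_snd measurable_snd).
have mX : measurable_fun setT (fun z : T * T => z.1.1 - z.2.1) by exact: measurable_funB.
have mY : measurable_fun setT (fun z : T * T => z.1.2 - z.2.2) by exact: measurable_funB.
apply: measurable_funM; first exact: (measurableT_comp mw measurable_fst).
apply: measurable_funM.
  exact: (measurableT_comp (continuous_measurable2 cphi) measurable_snd).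
apply: measurable_funM.
  exact: gker_measurable2.
apply: (measurableT_comp (continuous_measurable_fun (@continuous_cos R))).
apply: measurable_funD; first exact: measurable_cst.
have -> : (fun z : T * T => gphase z.2 z.1) = (fun z : T * T =>
    (- 2^-1) * ((z.1.1 - z.2.1) * (z.1.2 + z.2.2)) + 2^-1 * (z.1.2 - z.2.2)).
  by apply/funext => z; rewrite /gphase; field.
apply: measurable_funD; apply: measurable_funM; try exact: measurable_cst.
  by apply: measurable_funM => //; exact: measurable_funD.
exact: mY.
Qed.

(** The kernel is bounded by its peak, so its square is at most the peak times itself: the product
    with a square-integrable function is integrable. *)
Let gker_mul_le s q p (t : R) : s != 0 ->
  gker s q p * `|t| <= 2^-1 * (normal_peak s ^+ 2 * gker s q p + t ^+ 2).
Proof.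
move=> s0; have [h|/eqP] := gker_ub s q p; last by rewrite (negbTE s0).
have g0 := gker_ge0 s q p.
have := ler_wpM2r g0 h; have := sqr_ge0 (gker s q p - `|t|).
rewrite -(real_normK (num_real t)); move: (gker s q p) (normal_peak s ^+ 2) (`|t|) => g P y.
by rewrite sqrrB !expr2; lra.
Qed.

Let gker_itg (w : T -> R) Th s q : 0 < s -> sqitg mu w ->
  itg mu (fun p => gker s q p * (w p * cos (Th + gphase q p))).
Proof.
move=> s0 [mw wi]; have sn0 : s != 0 by rewrite gt_eqF.
have [gi _] := gker_integral s q.
apply: (@itg_le _ _ _ mu _ (fun p => 2^-1 * (normal_peak s ^+ 2 * gker s q p + w p ^+ 2))).
- apply: measurable_funM; first exact: mgker.
  apply: measurable_funM; [exact: mw|apply: continuous_measurable2; exact: ccosl].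
- by apply: itgZ; apply: itgD; [exact: itgZ|exact: wi].
- move=> p; apply: le_trans (gker_mul_le q p (w p) sn0).
  rewrite normrM (ger0_norm (gker_ge0 _ _ _)) normrM; apply: ler_wpM2l; first exact: gker_ge0.
  by rewrite ler_piMr// ler_norml cos_geN1 cos_le1.
Qed.

(** Fubini on pairs of points: the majorant [H] integrates over [p] to a constant multiple of
    [|phi q|], which is integrable because [phi] has bounded support. *)
Lemma smear_swap (w : T -> R) Th s : 0 < s -> sqitg mu w ->
  itg mu (fun p => w p * I2 (fun q => phi q * (gker s q p * cos (Th + gphase q p)))) /\
  I2 (fun p => w p * I2 (fun q => phi q * (gker s q p * cos (Th + gphase q p)))) =
  I2 (fun q => phi q * I2 (fun p => gker s q p * (w p * cos (Th + gphase q p)))).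
Proof.
move=> s0 [mw wi]; have sn0 : s != 0 by rewrite gt_eqF.
pose h (z : T * T) := w z.1 * (phi z.2 * (gker s z.2 z.1 * cos (Th + gphase z.2 z.1))).
pose H (z : T * T) := `|phi z.2| * (2^-1 * (normal_peak s ^+ 2 * gker s z.2 z.1 + w z.1 ^+ 2)).
have mh : measurable_fun setT h by exact: smear_measurable.
have cos1 (x : R) : `|cos x| <= 1 by rewrite ler_norml cos_geN1 cos_le1.
have hH z : `|h z| <= H z.
  rewrite /h /H normrM normrM normrM (ger0_norm (gker_ge0 _ _ _)) mulrCA.
  apply: ler_wpM2l => //; apply: le_trans (gker_mul_le z.2 z.1 _ sn0).
  by rewrite mulrCA; apply: ler_wpM2l; [exact: gker_ge0|rewrite ler_piMr].
have Hi q : itg mu (fun p => H (p, q)).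
  have [gi _] := gker_integral s q.
  by rewrite /H /=; apply: itgZ; apply: itgZ; apply: itgD => //; exact: itgZ.
pose W := I2 (fun p => w p ^+ 2).
have HE q : I2 (fun p => H (p, q)) = `|phi q| * (2^-1 * (normal_peak s ^+ 2 + W)).
  have [gi g1] := gker_integral s q.
  have i1 := itgZ (normal_peak s ^+ 2) gi.
  rewrite /H /= (IZ _ (itgZ _ (itgD i1 wi))) (IZ _ (itgD i1 wi)) (ID i1 wi) (IZ _ gi) g1 mulr1 //.
have phii : itg mu phi by exact: itg_in_box cphi bphi.
have Di : itg mu (fun q => `|phi q| * (2^-1 * (normal_peak s ^+ 2 + W))).
  have := itgZ (2^-1 * (normal_peak s ^+ 2 + W)) (itg_norm phii); congr (itg _ _).
  by apply/funext => q; rewrite mulrC.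
have W0 : 0 <= W by apply: I_ge0 => p; exact: sqr_ge0.
have mH : measurable_fun setT H.
  apply: measurable_funM; first exact: (measurableT_comp (itg_measurable (itg_norm phii)) measurable_snd).
  apply: measurable_funM; first exact: measurable_cst.
  apply: measurable_funD.
    by apply: measurable_funM; [exact: measurable_cst|exact: gker_measurable2].
  by apply: measurable_funX; exact: (measurableT_comp mw measurable_fst).
have hi : itg (leb2s \x leb2s)%E h.
  apply: (itg_le mh _ hH).
  apply: (itg_prod_ge0 (m := leb2s) (f := fun q => `|phi q| * (2^-1 * (normal_peak s ^+ 2 + W)))) => //.
  - move=> z; apply: mulr_ge0 => //; apply: mulr_ge0; rewrite ?invr_ge0//.
    by apply: addr_ge0; [apply: mulr_ge0; [exact: sqr_ge0|exact: gker_ge0]|exact: sqr_ge0].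
  - by move=> q; apply: mulr_ge0 => //; apply: mulr_ge0; rewrite ?invr_ge0// addr_ge0// sqr_ge0.
have h1 p : itg leb2s (fun q => h (p, q)) by exact: (itgZ (w p) (itg_smear Th p s0)).
have h2 q : itg leb2s (fun p => h (p, q)).
  apply: (itg_le _ (Hi q)); last by move=> p; exact: hH.
  exact: (measurableT_comp mh (measurable_pair2 q)).
have [ei eE] := Rintegral_swap hi h1 h2.
have E1 p : I2 (fun q => h (p, q)) = w p * I2 (fun q => phi q * (gker s q p * cos (Th + gphase q p))).
  exact: (IZ (w p) (itg_smear Th p s0)).
have E2 q : I2 (fun p => h (p, q)) = phi q * I2 (fun p => gker s q p * (w p * cos (Th + gphase q p))).
  rewrite -(IZ _ (gker_itg Th q s0 (conj mw wi))); apply: I_ext => p; rewrite /h /=; ring.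
split.
  by move: ei; congr (itg _ _); apply/funext => p; exact: E1.
transitivity (I2 (fun p => I2 (fun q => h (p, q)))); first by apply: I_ext => p; rewrite E1.
by rewrite eE; apply: I_ext => q; exact: E2.
Qed.

Lemma smear_limit (w : T -> R) Th s : 0 < s <= 1 -> sqitg mu w ->
  `|I2 (fun q => phi q * I2 (fun p => gker s q p * (w p * cos (Th + gphase q p))))
    - cos Th * I2 (fun p => w p * phi p)| <= s * (C * I2 (fun p => `|w p * w2 p|)).
Proof.
move=> s01 wL; have /andP[s0 s1] := s01; have [Ji JE] := smear_swap Th s0 wL.
have phiL : sqitg mu phi by exact: sqitg_in_box cphi bphi.
have wpi : itg mu (fun p => w p * phi p) by exact: (sqitg_mul wL phiL).
have cwi := itgZ (cos Th) wpi.
have wwi : itg mu (fun p => `|w p * w2 p|) by apply: itg_norm; apply: (sqitg_mul wL); exact: sqitg_w2.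
rewrite -JE -(IZ _ wpi) -(IB Ji cwi) mulrA -(IZ _ wwi).
apply: (le_trans (I_norm (itgB Ji cwi))).
apply: (I_le (itg_norm (itgB Ji cwi)) (itgZ _ wwi)) => p.
rewrite (_ : _ - _ = w p * (I2 (fun q => phi q * (gker s q p * cos (Th + gphase q p))) - cos Th * phi p)); last by ring.
rewrite normrM normrM [leRHS]mulrCA; apply: ler_wpM2l; first exact: normr_ge0.
have /andP[/ltW w0 _] := w2_01 p; rewrite (ger0_norm w0); exact: smear_bound.
Qed.

(** The hypothesis is integrated over the centres [q] against [phi]; as [s] tends to zero the
    smeared test functions tend to [cos Th * phi] and [sin Th * phi]. *)
Lemma test_pairing0 (v1 v2 : T -> R) Th : sqitg mu v1 -> sqitg mu v2 ->
  (forall s q, 0 < s <= 1 ->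
    I2 (fun p => gker s q p * (v1 p * cos (Th + gphase q p) + v2 p * sin (Th + gphase q p))) = 0) ->
  cos Th * I2 (fun p => v1 p * phi p) + sin Th * I2 (fun p => v2 p * phi p) = 0.
Proof.
move=> v1L v2L h.
have nv2L : sqitg mu (fun p => - v2 p) by exact: sqitgN.
pose K := C * I2 (fun p => `|v1 p * w2 p|) + C * I2 (fun p => `|- v2 p * w2 p|).
have nE : I2 (fun p => - v2 p * phi p) = - I2 (fun p => v2 p * phi p).
  rewrite -IN; first by apply: I_ext => p; rewrite mulNr.
  by apply: sqitg_mul => //; exact: sqitg_in_box cphi bphi.
have key s : 0 < s <= 1 ->
    `|cos Th * I2 (fun p => v1 p * phi p) + sin Th * I2 (fun p => v2 p * phi p)| <= s * K.
  move=> s01; have /andP[s0 _] := s01.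
  (* The sine is the cosine of an angle shifted by [pi / 2], so one limit serves both components;
     the hypothesis then says that the two smeared integrals coincide, the sign having been given to
     [v2]. *)
  have l1 := smear_limit Th s01 v1L; have l2 := smear_limit (Th - pi / 2) s01 nv2L.
  have E q : I2 (fun p => gker s q p * (v1 p * cos (Th + gphase q p))) =
      I2 (fun p => gker s q p * (- v2 p * cos (Th - pi / 2 + gphase q p))).
    have i1 := gker_itg Th q s0 v1L; have i2 := gker_itg (Th - pi / 2) q s0 nv2L.
    apply/eqP; rewrite -subr_eq0 -(IB i1 i2) -(h s q s01); apply/eqP; apply: I_ext => p.
    by rewrite addrAC cosBpihalf; ring.
  have E2 : I2 (fun q => phi q * I2 (fun p => gker s q p * (v1 p * cos (Th + gphase q p)))) =
     I2 (fun q => phi q * I2 (fun p => gker s q p * (- v2 p * cos (Th - pi / 2 + gphase q p)))).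
    by apply: I_ext => q; rewrite E.
  rewrite E2 in l1; rewrite nE cosBpihalf in l2.
  move: l1 l2; rewrite /K mulrDr; move: (I2 (fun q => phi q * _)) (_ * I2 (fun p => v1 p * phi p)) => A B.
  rewrite mulrN; move: (_ * I2 (fun p => v2 p * phi p)) => D l1 l2.
  rewrite (_ : B + D = (A - - D) - (A - B)); last by ring.
  by apply: (le_trans (ler_normB _ _)); rewrite addrC; exact: lerD.
apply/eqP; rewrite -normr_le0; apply/ler_addgt0Pl => e e0; rewrite addr0.
have K1 : 0 < `|K| + 1 by apply: ltr_wpDl.
pose s := Num.min 1 (e / (`|K| + 1)).
have s0 : 0 < s by rewrite lt_min ltr01 divr_gt0.
have s01 : 0 < s <= 1 by rewrite s0 ge_min lexx.
apply: (le_trans (key s s01)); apply: (@le_trans _ _ (s * (`|K| + 1))).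
  by apply: ler_wpM2l; [exact: ltW|apply: (le_trans (ler_norm K)); rewrite lerDl].
by rewrite -ler_pdivlMr// ge_min lexx orbT.
Qed.

End TestFunctional.
End ApproximateIdentity.

(** * Functions whose integrals vanish on a generating class *)

Section NullSets.
Context d (T : measurableType d) (R : realType) (mu : {measure set T -> \bar R}).
Local Notation I := (Rintegral mu setT).

Lemma itg_indic f A : measurable A -> itg mu f -> itg mu (fun z => f z * \1_A z).
Proof.
move=> mA fi; apply: (itg_le _ (itg_norm fi)).
  by apply: measurable_funM; [exact: itg_measurable fi|exact: measurable_indic].
by move=> z; rewrite normrM indicE; case: (z \in A); rewrite ?normr1 ?mulr1// normr0 mulr0.
Qed.

(** The pi-lambda theorem for a signed integral: the sets on which it vanishes form a lambda-system,
    disjoint unions being handled by dominated convergence under [|f|]. The map [j] allows the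
    generating class to live in a single coordinate. *)
Lemma null_dynkin d1 (T1 : measurableType d1) (G : set (set T1)) (j : T -> T1) f :
  @measurable _ T1 = <<s G >> -> setI_closed G -> measurable_fun setT j -> itg mu f ->
  I f = 0 -> (forall A, G A -> I (fun z => f z * \1_A (j z)) = 0) ->
  forall A, measurable A -> I (fun z => f z * \1_A (j z)) = 0.
Proof.
move=> mG GI mj fi f0 fG A mA.
have jm B : measurable B -> measurable (j @^-1` B).
  by move=> mB; rewrite -[X in measurable X]setTI; exact: mj.
have fB B : measurable B -> itg mu (fun z => f z * \1_B (j z)).
  by move=> mB; exact: (itg_indic (jm _ mB) fi).
move: A mA; rewrite mG; apply: (dynkin_induction mG GI).
- by rewrite -[RHS]f0; apply: I_ext => z; rewrite indicT mulr1.
- exact: fG.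
- move=> S mS S0.
  transitivity (I (fun z => f z - f z * \1_S (j z))); last by rewrite (IB fi (fB _ mS)) f0 S0 subrr.
  apply: I_ext => z; rewrite !indicE in_setC; case: (_ \in S) => /=; ring.
- move=> F mF tF F0.
  pose S n z := \sum_(i < n) f z * \1_(F i) (j z).
  have Si n : itg mu (S n) /\ I (S n) = 0.
    elim: n => [|n [IHi IH0]].
      rewrite /S; have -> : (fun z => \sum_(i < 0) f z * \1_(F i) (j z)) = (fun=> 0).
        by apply/funext => z; rewrite big_ord0.
      split; first exact: itg0.
      transitivity (0 * I f); last by rewrite mul0r.
      by rewrite -(IZ 0 fi); apply: I_ext => z; rewrite mul0r.
    have -> : S n.+1 = (fun z => S n z + f z * \1_(F n) (j z)).
      by apply/funext => z; rewrite /S big_ord_recr.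
    by split; [apply: itgD => //; exact: fB|rewrite (ID IHi (fB _ (mF n))) IH0 F0 addr0].
  have one x n i : (i < n)%N -> F i x -> \sum_(k < n) (\1_(F k) x : R) = 1.
    move=> ltin Fix; rewrite (bigD1 (Ordinal ltin))//= big1 => [|k kn].
      by rewrite addr0 indicE mem_set.
    rewrite indicE memNset// => Fkx; move/eqP: kn; apply; apply/val_inj => /=.
    by apply: (tF k i) => //; exists x.
  have zero x n : (forall i, (i < n)%N -> ~ F i x) -> \sum_(k < n) (\1_(F k) x : R) = 0.
    by move=> h; apply: big1 => k _; rewrite indicE memNset//; exact: h.
  have SE n z : S n z = f z * \sum_(k < n) (\1_(F k) (j z) : R) by rewrite /S mulr_sumr.
  have le1 n x : 0 <= \sum_(k < n) (\1_(F k) x : R) <= 1.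
    have [[i [ltin Fix]]|h] := pselect (exists i, (i < n)%N /\ F i x).
      by rewrite (one _ _ _ ltin Fix) ler01 lexx.
    by rewrite zero ?lexx ?ler01// => i ltin Fix; apply: h; exists i.
  have [||||_ L] := @I_dct _ _ _ mu S (fun z => f z * \1_(\bigcup_k F k) (j z)) (fun z => `|f z|).
  + by move=> n; have [/itg_measurable] := Si n.
  + exact: itg_norm.
  + move=> n z; rewrite SE normrM; have /andP[h1 h2] := le1 n (j z).
    by rewrite (ger0_norm h1) ler_piMr.
  + move=> z; apply: cvg_near_cst.
    have [[i _ Fiz]|h] := pselect ((\bigcup_k F k) (j z)).
      exists i.+1 => // n /= ltin; rewrite SE (one _ _ _ ltin Fiz) indicE mem_set//.
      by exists i.
    exists 0%N => // n _; rewrite /= SE zero ?indicE ?memNset// => i _ Fiz.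
    by apply: h; exists i.
  have L0 : I (S n) @[n --> \oo] --> (0 : R).
    by apply: (@ncvg_ext _ (fun=> 0) _ 0) => [n||]; [have [_ ->] := Si n| |exact: cvg_cst].
  exact: ncvg_unique L L0.
Qed.

Lemma null_ae f : itg mu f -> (forall A, measurable A -> I (fun z => f z * \1_A z) = 0) ->
  \forall z \ae mu, f z = 0.
Proof.
move=> fi f0.
have mc : measurable_fun setT (fun _ : T => 0%E : \bar R) by exact: measurable_cst.
have H := integral_ae_eq measurableT fi mc.
apply: filterS (H _) => [z /(_ Logic.I) []//|E _ mE].
have fEi := itg_indic mE fi.
rewrite integral_mkcond (eq_integral (fun z => (f z * \1_E z)%:E)) => [|z _].
  by rewrite (itg_EFin fEi) f0// integral0.
by rewrite patchE indicE; case: (z \in E); rewrite /= ?mulr1 ?mulr0.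
Qed.

End NullSets.

(** * Lipschitz approximation of half-open intervals *)

Section Tents.
Context {R : realType}.
Implicit Types (x t a b : R) (n : nat).

Definition clamp t : R := Num.min 1 (Num.max 0 t).

Lemma clamp01 t : 0 <= clamp t <= 1.
Proof. by rewrite /clamp le_min ler01 le_max lexx /= ge_min lexx. Qed.

Lemma clamp_le0 t : t <= 0 -> clamp t = 0.
Proof. by move=> t0; rewrite /clamp max_l// min_r. Qed.

Lemma clamp_ge1 t : 1 <= t -> clamp t = 1.
Proof. by move=> t1; rewrite /clamp min_l// le_max t1 orbT. Qed.

Lemma clamp_id t : 0 <= t <= 1 -> clamp t = t.
Proof. by move=> /andP[t0 t1]; rewrite /clamp max_r// min_r. Qed.

Lemma clamp_lip t u : `|clamp t - clamp u| <= `|t - u|.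
Proof.
rewrite ler_norml; have := ler_norm (t - u); have := ler_norm (u - t); rewrite (distrC u t) => h1 h2.
have [t0|/ltW t0] := leP t 0; [rewrite (clamp_le0 t0)|have [t1|/ltW t1] := leP t 1;
  [rewrite (@clamp_id t) ?t0//|rewrite (clamp_ge1 t1)]];
(have [u0|/ltW u0] := leP u 0; [rewrite (clamp_le0 u0)|have [u1|/ltW u1] := leP u 1;
  [rewrite (@clamp_id u) ?u0//|rewrite (clamp_ge1 u1)]]); apply/andP; split; lra.
Qed.

Lemma continuous_clamp : continuous clamp.
Proof.
move=> x; apply/cvgrPdist_le => e e0; near=> y.
apply: (le_trans (clamp_lip _ _)); near: y.
exact: (cvgrPdist_le _ _).1 (@cvg_id _ _) e e0.
Unshelve. all: by end_near. Qed.

(** The first factor rises only to the right of [a]. The [1 +] in the second delays the fall to the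
    right of [b], so that the pointwise limit is the indicator of an interval open at [a] and closed
    at [b]. *)
Definition tent n a b x := clamp (n.+1%:R * (x - a)) * clamp (1 + n.+1%:R * (b - x)).

Lemma tent01 n a b x : 0 <= tent n a b x <= 1.
Proof.
have /andP[h1 h2] := clamp01 (n.+1%:R * (x - a)); have /andP[h3 h4] := clamp01 (1 + n.+1%:R * (b - x)).
by rewrite /tent mulr_ge0//= mulr_ile1.
Qed.

Lemma mul01_lip (u v u' v' : R) : 0 <= u <= 1 -> 0 <= v' <= 1 ->
  `|u * v - u' * v'| <= `|u - u'| + `|v - v'|.
Proof.
move=> /andP[u0 u1] /andP[v0 v1].
rewrite (_ : u * v - u' * v' = (u - u') * v' + u * (v - v')); last by ring.
apply: (le_trans (ler_normD _ _)); rewrite !normrM (ger0_norm v0) (ger0_norm u0).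
by apply: lerD; [rewrite ler_piMr|rewrite ler_piMl].
Qed.

Lemma tent_lip n a b x y : `|tent n a b x - tent n a b y| <= 2 * n.+1%:R * `|x - y|.
Proof.
have N0 : 0 <= n.+1%:R :> R by exact: ler0n.
rewrite /tent; apply: le_trans; first by apply: mul01_lip; exact: clamp01.
apply: (le_trans (lerD (clamp_lip _ _) (clamp_lip _ _))).
rewrite (_ : n.+1%:R * (x - a) - n.+1%:R * (y - a) = n.+1%:R * (x - y)); last by ring.
rewrite (_ : 1 + n.+1%:R * (b - x) - (1 + n.+1%:R * (b - y)) = - (n.+1%:R * (x - y))); last by ring.
by rewrite normrN normrM (ger0_norm N0); lra.
Qed.

Lemma tent_out n a b x M : `|a| + `|b| + 1 <= M -> M < `|x| -> tent n a b x = 0.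
Proof.
move=> hM hx; have N1 : 1 <= n.+1%:R :> R by rewrite ler1n.
have c0 := clamp_le0.
have := ler_norm a; have := ler_norm b; have := ler_norm (- a); have := ler_norm (- b).
rewrite !normrN => b1 a1 b2 a2.
rewrite /tent; have [x0|x0] := leP 0 x.
  rewrite (ger0_norm x0) in hx.
  rewrite [X in _ * X]c0 ?mulr0//.
  have : n.+1%:R * 1 <= n.+1%:R * (x - b) by apply: ler_wpM2l; [exact: ler0n|lra].
  by have -> : n.+1%:R * (b - x) = - (n.+1%:R * (x - b)) by [ring]; lra.
rewrite (ltr0_norm x0) in hx.
by rewrite [X in X * _]c0 ?mul0r//; apply: mulr_ge0_le0; [exact: ler0n|lra].
Qed.

Lemma tent_cvg a b x : tent n a b x @[n --> \oo] --> (\1_(`]a, b]%classic) x : R).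
Proof.
have c0 := clamp_le0.
have c1 := clamp_ge1.
have big (t : R) : 0 < t -> \forall n \near \oo, 1 <= n.+1%:R * t.
  move=> t0; near=> n; rewrite -ler_pdivrMr//.
  by apply: (@le_trans _ _ n%:R); [near: n; exact: nbhs_infty_ger|rewrite ler_nat].
have [ax|xa] := ltP a x; last first.
  apply: cvg_near_cst; apply: nearW => n; rewrite /tent [X in X * _]c0 ?mul0r.
    by rewrite indicE memNset//= in_itv /= => /andP[]; rewrite ltNge xa.
  by apply: mulr_ge0_le0; [exact: ler0n|rewrite subr_le0].
have [xb|bx] := leP x b.
  apply: cvg_near_cst; near=> n; rewrite /tent !c1 ?mulr1.
  - by rewrite indicE mem_set//= in_itv /= ax xb.
  - by rewrite lerDl mulr_ge0// subr_ge0.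
  - by near: n; apply: big; rewrite subr_gt0.
apply: cvg_near_cst; near=> n; rewrite /tent [X in _ * X]c0 ?mulr0.
  by rewrite indicE memNset//= in_itv /= => /andP[_]; rewrite leNgt bx.
rewrite -opprB mulrN subr_le0; near: n; apply: big; by rewrite subr_gt0.
Unshelve. all: by end_near. Qed.

End Tents.

(** * Triviality of the orthogonal complement of the range *)

Section RectangleTest.
Context {R : realType}.
Local Notation mu := (@leb2 R).
Local Notation I2 := (Rintegral (@leb2 R) setT).
Local Notation T1 := (measurableTypeR R).
Variable w : R * R -> R.
Hypothesis wL : sqitg mu w.
Hypothesis w0 : forall (phi : R * R -> R) (M L : R), 0 <= M -> contf phi -> in_box M phi ->
  (forall p, `|phi p| <= L) ->
  (forall p q, `|phi q - phi p| <= L * (`|p.1 - q.1| + `|p.2 - q.2|)) ->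
  I2 (fun p => w p * phi p) = 0.

Let sqitg_box M : sqitg mu (fun p => \1_(box M) p : R).
Proof.
have bi := itg_box M; split; first exact: itg_measurable bi.
by move: bi; congr (itg _ _); apply/funext => p; rewrite indicE; case: (_ \in _); rewrite ?expr1n ?expr0n.
Qed.

Let box_itg M : itg mu (fun p => `|w p * \1_(box M) p|).
Proof. by apply: itg_norm; apply: (sqitg_mul wL); exact: sqitg_box. Qed.

Let contf_tent n a b (f : R * R -> R) : contf f -> contf (fun p => tent n a b (f p)).
Proof.
move=> cf; rewrite /tent; apply: contM; apply: contcomp; try exact: continuous_clamp; by cont_rec.
Qed.

Lemma rect0 (A B : set T1) : ocitv A -> ocitv B ->
  I2 (fun p => w p * (\1_A p.1 * \1_B p.2)) = 0.
Proof.
move=> [[a b] _ <-] [[c d] _ <-] /=.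
pose M := (`|a| + `|b| + 1) + (`|c| + `|d| + 1).
pose phi n (p : R * R) := tent n a b p.1 * tent n c d p.2.
have bphi n : in_box M (phi n).
  move=> p [h|h]; rewrite /phi; [rewrite (@tent_out _ n a b _ M)|rewrite (@tent_out _ n c d _ M)];
    rewrite ?mul0r ?mulr0// /M ?lerDl ?lerDr !addr_ge0//.
have cphi n : contf (phi n) by apply: contM; apply: contf_tent; [exact: contfst|exact: contsnd].
have phi01 n p : 0 <= phi n p <= 1.
  have /andP[h1 h2] := tent01 n a b p.1; have /andP[h3 h4] := tent01 n c d p.2.
  by rewrite /phi mulr_ge0//= mulr_ile1.
have [||||_ L] := @I_dct _ _ _ mu (fun n p => w p * phi n p) (fun p => w p * (\1_(`]a, b]%classic) p.1 * \1_(`]c, d]%classic) p.2)) (fun p => `|w p * \1_(box M) p|).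
- move=> n; apply: measurable_funM; first by case: wL.
  exact: continuous_measurable2 (cphi n).
- exact: box_itg.
- move=> n p; rewrite normrM [leRHS]normrM; apply: ler_wpM2l => //.
  have /andP[h1 h2] := phi01 n p; rewrite (ger0_norm h1) indicE.
  have [pM|npM] := boolP (p \in box M); first by rewrite normr1.
  have /notin_boxP pM : ~ box M p by move=> h; move: npM; rewrite mem_set.
  by rewrite normr0 (bphi n p).
- move=> p; apply: ncvgZ; apply: ncvgM; exact: tent_cvg.
have L0 : I2 (fun p => w p * phi n p) @[n --> \oo] --> (0 : R).
  apply: (@ncvg_ext _ (fun=> 0) _ 0) => [n||] //; last exact: cvg_cst.
  apply/esym; apply: (@w0 (phi n) M (2 * n.+1%:R)).
  - by rewrite /M !addr_ge0.
  - exact: cphi.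
  - exact: bphi.
  - move=> p; have /andP[h1 h2] := phi01 n p; rewrite (ger0_norm h1); apply: (le_trans h2).
    by have : 1 <= n.+1%:R :> R by [rewrite ler1n]; lra.
  - move=> p q; rewrite /phi mulrDr.
    apply: le_trans; first by apply: mul01_lip; exact: tent01.
    by apply: lerD; rewrite distrC; exact: tent_lip.
exact: ncvg_unique L L0.
Qed.

Let sq (n : nat) : set T1 := `](- n%:R), n%:R]%classic.
(** On a square the square-integrable [w] becomes integrable, as the pi-lambda argument requires;
    the squares exhaust the plane. *)
Let gk n (p : R * R) := w p * (\1_(sq n) p.1 * \1_(sq n) p.2).

Let oc_sq n : ocitv (sq n). Proof. exact: is_ocitv. Qed.

Let msq n : measurable (sq n). Proof. exact: measurable_itv. Qed.

Let gk_itg n : itg mu (gk n).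
Proof.
apply: (itg_le _ (box_itg n%:R)).
  apply: measurable_funM; first by case: wL.
  by apply: measurable_funM; [apply: (measurableT_comp _ measurable_fst)|apply: (measurableT_comp _ measurable_snd)];
    apply: measurable_indic.
move=> p; rewrite !normrM; apply: ler_wpM2l => //; rewrite !indicE.
have [h1|h1] := boolP (p.1 \in _); last by rewrite normr0 mul0r.
have [h2|h2] := boolP (p.2 \in _); last by rewrite normr0 mulr0.
rewrite mem_set ?normr1 ?mulr1//; apply/boxP.
move/set_mem: h1; move/set_mem: h2; rewrite /sq /= !in_itv /= => /andP[h3 h4] /andP[h5 h6].
by rewrite !ler_norml h4 h6 !ltW.
Qed.

Let ind_mul (A B : set T1) (x : R) : \1_A x * \1_B x = \1_(A `&` B) x :> R.
Proof. by rewrite indicI. Qed.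

Let gk_rect n A B : ocitv A -> ocitv B -> I2 (fun p => gk n p * (\1_A p.1 * \1_B p.2)) = 0.
Proof.
move=> oA oB; rewrite -[RHS](rect0 (ocitvI (oc_sq n) oA) (ocitvI (oc_sq n) oB)).
by apply: I_ext => p; rewrite /gk -!ind_mul; ring.
Qed.

(** The class of test sets grows one coordinate at a time: products of intervals, an arbitrary set
    in [x], arbitrary sets in both, and from these rectangles all measurable sets of the plane. *)
Let gk_step1 n A B : measurable A -> ocitv B -> I2 (fun p => gk n p * (\1_A p.1 * \1_B p.2)) = 0.
Proof.
move=> mA oB.
have mB : measurable (B : set T1) by case: oB => -[c d] _ <-; exact: measurable_itv.
have mB2 : measurable (snd @^-1` B : set (T1 * T1)).
  by rewrite -[X in measurable X]setTI; exact: measurable_snd.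
have fi : itg mu (fun p => gk n p * \1_B p.2) by exact: (itg_indic mB2 (gk_itg n)).
transitivity (I2 (fun p => gk n p * \1_B p.2 * \1_A p.1)).
  by apply: I_ext => p; ring.
apply: (@null_dynkin _ _ _ mu _ T1 (@ocitv R) fst _ _ _ _ fi) => //.
- exact: ocitvI.
(* The total integral vanishes because [gk n] already contains the indicator of a bounded interval
   in [x]. *)
- rewrite -[RHS](gk_rect n (oc_sq n) oB); apply: I_ext => p.
  by rewrite /gk !indicE; case: (p.1 \in _); case: (p.2 \in sq n) => /=; ring.
- by move=> A' oA'; rewrite -[RHS](gk_rect n oA' oB); apply: I_ext => p; ring.
Qed.

Let gk_step2 n A B : measurable A -> measurable B -> I2 (fun p => gk n p * (\1_A p.1 * \1_B p.2)) = 0.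
Proof.
move=> mA mB.
have mA2 : measurable (fst @^-1` A : set (T1 * T1)).
  by rewrite -[X in measurable X]setTI; exact: measurable_fst.
have fi : itg mu (fun p => gk n p * \1_A p.1) by exact: (itg_indic mA2 (gk_itg n)).
transitivity (I2 (fun p => gk n p * \1_A p.1 * \1_B p.2)).
  by apply: I_ext => p; rewrite mulrA.
apply: (@null_dynkin _ _ _ mu _ T1 (@ocitv R) snd _ _ _ _ fi) => //.
- exact: ocitvI.
- rewrite -[RHS](gk_step1 n mA (oc_sq n)); apply: I_ext => p.
  by rewrite /gk !indicE; case: (p.1 \in sq n); case: (p.2 \in _) => /=; ring.
- by move=> B' oB'; rewrite -[RHS](gk_step1 n mA oB'); apply: I_ext => p; ring.
Qed.

Let gk_null n (E : set (T1 * T1)) : measurable E -> I2 (fun p => gk n p * \1_E p) = 0.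
Proof.
move=> mE; have := @measurable_prod_measurableType _ _ T1 T1 => mG.
apply: (@null_dynkin _ _ _ mu _ (T1 * T1)%type _ id _ mG _ _ (gk_itg n)) => //.
- move=> _ _ [A mA [B mB <-]] [A' mA' [B' mB' <-]].
  exists (A `&` A'); first exact: measurableI.
  by exists (B `&` B'); [exact: measurableI|rewrite setXI].
- rewrite -[RHS](gk_rect n (oc_sq n) (oc_sq n)); apply: I_ext => p.
  by rewrite /gk !indicE; case: (p.1 \in _); case: (p.2 \in _) => /=; ring.
- move=> _ [A mA [B mB <-]]; rewrite -[RHS](gk_step2 n mA mB); apply: I_ext => p.
  by rewrite /= !indicE in_setX; case: (p.1 \in A); case: (p.2 \in B) => /=; ring.
Qed.

Lemma rectangle_test : \forall p \ae mu, w p = 0.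
Proof.
have H n : \forall p \ae mu, gk n p = 0 by apply: null_ae; [exact: gk_itg|exact: gk_null].
have := ae_foralln H; apply: ae_mono => p hp.
pose n := maxn (Num.bound `|p.1|) (Num.bound `|p.2|).
have b1 : `|p.1| < n%:R.
  by apply: (lt_le_trans (archi_boundP (normr_ge0 _))); rewrite ler_nat leq_maxl.
have b2 : `|p.2| < n%:R.
  by apply: (lt_le_trans (archi_boundP (normr_ge0 _))); rewrite ler_nat leq_maxr.
have := hp n; rewrite /gk !indicE !mem_set ?mulr1// /sq /= in_itv /=.
  by move: b2; rewrite ltr_norml => /andP[-> /ltW ->].
by move: b1; rewrite ltr_norml => /andP[-> /ltW ->].
Qed.

End RectangleTest.

Lemma ae_mono2 d (T : measurableType d) (R : realType) (mu : {measure set T -> \bar R})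
  (P Q S : T -> Prop) : (forall x, P x -> Q x -> S x) ->
  {ae mu, forall x, P x} -> {ae mu, forall x, Q x} -> {ae mu, forall x, S x}.
Proof. by move=> PQS; apply: filterS2. Qed.

Section Surjectivity.
Context {R : realType}.
Variables (lam nu : R).
Hypothesis nu0 : 0 < nu.
Local Notation Re := complex.Re.
Local Notation Im := complex.Im.
Local Notation mu := (@leb2 R).
Local Notation I2 := (Rintegral (@leb2 R) setT).
Local Notation csq := (@csq_on _ _ _ (@leb2 R)).
Local Notation cL2 := (@cL2_on _ _ _ (@leb2 R)).
Local Notation cip := (@cip_on _ _ _ (@leb2 R)).

(** The angle [Th] is at disposal: [Th = 0] extracts the real part of [v], [Th = pi / 2] its
    imaginary part. *)
Lemma range_orthogonal_trivial (v : R * R -> R[i]) : cL2 v ->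
  (forall u, test_function u -> cip v (shifted lam nu u) = 0) -> csq v = 0.
Proof.
move=> vL2 vorth; have [v1 v2] := vL2.
have key Th (phi : R * R -> R) (M L : R) : 0 <= M -> contf phi -> in_box M phi ->
    (forall p, `|phi p| <= L) ->
    (forall p q, `|phi q - phi p| <= L * (`|p.1 - q.1| + `|p.2 - q.2|)) ->
    cos Th * I2 (fun p => Re (v p) * phi p) + sin Th * I2 (fun p => Im (v p) * phi p) = 0.
  move=> M0 cphi bphi ble blip; apply: (test_pairing0 M0 cphi bphi ble blip v1 v2) => s q s01.
  exact: (gker_pairing0 nu0 vL2 vorth q Th s01).
have r1 : \forall p \ae mu, Re (v p) = 0.
  apply: (rectangle_test v1) => phi M L M0 cphi bphi ble blip.
  by have := key 0 phi M L M0 cphi bphi ble blip; rewrite cos0 sin0 mul1r mul0r addr0.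
have r2 : \forall p \ae mu, Im (v p) = 0.
  apply: (rectangle_test v2) => phi M L M0 cphi bphi ble blip.
  by have := key (pi / 2) phi M L M0 cphi bphi ble blip; rewrite cos_pihalf sin_pihalf mul1r mul0r add0r.
have zL2 : cL2 (fun p => 0%:C * v p) by exact: cL2Z.
rewrite (csq_ae vL2 zL2); first by rewrite csqZ// expr0n mul0r.
apply: ae_mono2 r1 r2 => p e1 e2; apply: complex_ext; rewrite !reimE /= e1 e2; ring.
Qed.

Lemma test0 : test_function (fun _ : R * R => (0 : R[i])).
Proof.
have s0 : smooth (fun _ : R * R => (0 : R)) by apply: elem_smooth; exact: elemC.
by apply: (@in_box_test _ _ 0).
Qed.

Lemma shifted0 p : shifted lam nu (fun=> 0) p = 0.
Proof.
have s0 : smooth (fun _ : R * R => (0 : R)) by apply: elem_smooth; exact: elemC.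
have d0 s : partial s (fun _ : R * R => (0 : R)) = fun=> 0.
  by apply/funext => q; apply: partialE; exact: dC.
rewrite /shifted (@H0_exprE _ _ (fun=> 0) (fun=> 0) p)// /HR /HI !d0.
by apply: complex_ext; rewrite !reimE /=; ring.
Qed.

Lemma resolvent_surjective (f : R * R -> R[i]) : cL2 f -> exists u, resolvent H0 (lam +i* nu) f u.
Proof.
move=> fL2.
pose S g := exists2 u, test_function u & g = shifted lam nu u.
have dense n : exists2 u, test_function u & csq (fun p => shifted lam nu u p - f p) < 4^-1 ^+ n.
  have e0 : 0 < 4^-1 ^+ n :> R by apply: exprn_gt0; rewrite invr_gt0.
  have [||||_ [u tu ->] h] := @dense_of_orthogonal_trivial _ _ _ mu S _ _ _ _ f fL2 _ e0.
  - exists (fun=> 0); first exact: test0.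
    by apply/funext => p; rewrite shifted0.
  - move=> _ _ t [u tu ->] [w tw ->]; exists (fun p => u p + t%:C * w p); first exact: test_lin.
    by apply/funext => p; rewrite shifted_lin.
  - by move=> _ [u tu ->]; exact: test_shifted_cL2.
  - by move=> v vL2 vorth; apply: range_orthogonal_trivial => // u tu; apply: vorth; exists u.
  by exists u.
pose un n := sval (cid2 (dense n)).
have tun n : test_function (un n) by rewrite /un; case: cid2.
have hun n : csq (fun p => shifted lam nu (un n) p - f p) < 4^-1 ^+ n by rewrite /un; case: cid2.
have sL2 n : cL2 (shifted lam nu (un n)) by exact: test_shifted_cL2.
have unL2 n : cL2 (un n) by exact: test_cL2.
(* Two consecutive errors contribute [2 (1 + 1 / 4) 4^-n], less than [4 * 4^-n], and coercivity
   divides by [nu^2]. *)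
have cauchy n : csq (fun p => un n.+1 p - un n p) <= (4 / nu ^+ 2) * 4^-1 ^+ n.
  have tw : test_function (fun p => un n.+1 p + (-1)%:C * un n p) by exact: test_lin.
  have := test_coercive lam tw nu0.
  have -> : csq (fun p => un n.+1 p + (-1)%:C * un n p) = csq (fun p => un n.+1 p - un n p).
    by apply: csq_ext => p; rewrite rmorphN1 mulN1r.
  have d1 : cL2 (fun p => shifted lam nu (un n.+1) p - f p) by exact: cL2B.
  have d2 : cL2 (fun p => shifted lam nu (un n) p - f p) by exact: cL2B.
  have -> : csq (shifted lam nu (fun p => un n.+1 p + (-1)%:C * un n p)) =
      csq (fun p => (shifted lam nu (un n.+1) p - f p) + (-1)%:C * (shifted lam nu (un n) p - f p)).
    by apply: csq_ext => p; rewrite shifted_lin// rmorphN1 !mulN1r; ring.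
  move=> h; have := csq_sum_le d1 (cL2Z (-1)%:C d2).
  rewrite (csqZ _ d2) sqrrN expr1n mul1r => h2.
  have := hun n; have := hun n.+1; rewrite exprS => h3 h4.
  have e0 : 0 <= 4^-1 ^+ n :> R by apply: exprn_ge0; rewrite invr_ge0.
  rewrite mulrAC ler_pdivlMr ?exprn_gt0// mulrC; apply: (le_trans h); apply: (le_trans h2).
  lra.
have [u uL2 ucvg] := complex_riesz_fischer unL2 cauchy.
exists u; apply/resolventP; split => //; exists un; split => //.
apply: (@ncvg_squeeze0 _ _ (fun n => 4^-1 ^+ n)).
  by move=> n; rewrite csq_ge0 /= ltW.
by apply: cvg_expr; rewrite ger0_norm ?invr_ge0// invf_lt1// ltr1n.
Qed.

End Surjectivity.

Unset Implicit Arguments.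

Theorem proposition3p1 (R : realType) (theta : R)
    (htheta : 0 < theta <= 1 / 2) :
  exists2 C : R, 0 < C &
    forall delta lambda nu : R,
      0 < delta <= 2 -> 0 < nu <= 1 ->
      resolvent_set H0 (lambda +i* nu) /\
      (1 <= `|lambda| ->
       (op_norm (M delta lambda nu) <=
        (C * nu^-1 *
         (`|lambda| `^ (- theta) + (1 + nu) * `|lambda|^-1
          + (1 + nu ^- 2) * `|lambda| `^ (theta - 1)) `^ (delta / 2))%:E)%E).
Proof.
exists 302; first by rewrite ltr0n.
move=> delta lambda nu d02 nu01; have /andP[nu0 _] := nu01; split.
  by apply: (resolvent_bounded nu0) => f fL2; exact: (resolvent_surjective lambda nu0 fL2).
by move=> l1; exact: M_op_norm.
Qed.
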